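(* Let $n\ge 6$ and let $C_n$ be the cycle graph with $n$ vertices and $n$ edges. The pure complex $\mathcal{SM}_{\mathrm{pure}}(C_n)$ of strong discrete Morse matchings on $C_n$ has the homotopy type $$\mathcal{SM}_{\mathrm{pure}}(C_n)\simeq\begin{cases}\mathbb{S}^{2}\vee\mathbb{S}^{2k-2}\vee\mathbb{S}^{2k-2}\vee\mathbb{S}^{2k-2}\vee\mathbb{S}^{2k-2} & \text{if } n=3k,\\ \mathbb{S}^{2}\vee\mathbb{S}^{2k-1}\vee\mathbb{S}^{2k-1} & \text{if } n=3k+1 \text{ or } n=3k+2.\end{cases}$$
   Context: All simplicial complexes are finite. For a simplicial complex $K$ and a vertex $v$, the link $\mathrm{lk}(v,K)$ consists of the simplices $\sigma$ of $K$ with $v\notin\sigma$ and $\sigma\cup\{v\}\in K$. A vertex $v$ is dominated by a vertex $a\ne v$ in $K$ if $\mathrm{lk}(v,K)=a*K_0$ is a simplicial cone with apex $a$ (over a possibly empty subcomplex $K_0$). A vertex filtration is an injective map $g:V(K)\to\mathbb{R}$; $K_{g(v)}$ denotes the full subcomplex of $K$ on the vertices $w$ with $g(w)\le g(v)$. The vertex $v$ is descending dominated by $a$ if $v$ is dominated by $a$ in $K_{g(v)}$ (so $g(a)<g(v)$). A strong Morse matching associated with $g$ is obtained by choosing, for every descending dominated vertex $v$, one vertex $a_v$ dominating it in $K_{g(v)}$, and taking the set of all pairs $(\sigma,\sigma\cup\{a_v\})$ where $\sigma$ is a simplex of $K_{g(v)}$ with $v\in\sigma$ and $a_v\notin\sigma$;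 vertices that are not descending dominated contribute no pairs. A strong Morse matching on $K$ is one associated with some vertex filtration (and some choices). The complex $\mathcal{SM}(K)$ is the simplicial complex whose simplices are all nonempty subsets of strong Morse matchings on $K$ (so its vertices are the pairs $(\sigma,\tau)$, $\sigma$ a codimension-one face of $\tau$, occurring in some strong Morse matching). $\mathcal{SM}_{\mathrm{pure}}(K)$ is the subcomplex of $\mathcal{SM}(K)$ generated by its simplices of maximal dimension $\dim\mathcal{SM}(K)$. *)

(* Defs.v *)
From HB Require Import structures.
From mathcomp Require Import all_boot all_order all_algebra.
From mathcomp Require Import all_classical all_reals all_analysis.
From mathcomp Require Import homotopy wedge_sigT fintype finset.

Set Implicit Arguments.
Unset Strict Implicit.
Unset Printing Implicit Defensive.

Import Order.TTheory GRing.Theory Num.Theory.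
Import numFieldNormedType.Exports.

Local Open Scope ring_scope.

(* Simplices are the nonempty ones; elements of [V] need not be vertices. *)
Record complex (V : finType) := Complex {
  simplices :> {set {set V}};
  complex_nonempty : set0 \notin simplices;
  complex_closed : forall s t : {set V},
    s \in simplices -> t \subset s -> t != set0 -> t \in simplices }.

Section Complexes.
Variable V : finType.
Implicit Types (K : complex V) (W s : {set V}) (v a : V).

Definition vertices K : {set V} := [set v | [set v] \in simplices K].

Definition dim K : nat := \max_(s in simplices K) #|s|.-1.

Definition full_simplices K W := [set s in simplices K | s \subset W].

Fact full_nonempty K W : set0 \notin full_simplices K W.
Proof. by rewrite inE negb_and complex_nonempty. Qed.

Fact full_closed K W (s t : {set V}) :
  s \in full_simplices K W -> t \subset s -> t != set0 ->
  t \in full_simplices K W.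
Proof.
rewrite !inE => /andP[sK sW] ts t0.
by rewrite (complex_closed sK ts t0) (fintype.subset_trans ts sW).
Qed.

Definition full K W : complex V :=
  Complex (full_nonempty K W) (@full_closed K W).

Definition link v K : {set {set V}} :=
  [set s in simplices K | (v \notin s) && (v |: s \in simplices K)].

Definition cone a K0 : {set {set V}} :=
  [set a] |: simplices K0 :|: [set a |: s | s in simplices K0].

Definition dominated_by K v a : Prop :=
  [/\ v \in vertices K, a != v &
      exists K0, a \notin vertices K0 /\ link v K = cone a K0].

Definition pure_simplices K : {set {set V}} :=
  [set s in simplices K |
    [exists t in simplices K, (s \subset t) && (#|t|.-1 == dim K)]].

Fact pure_nonempty K : set0 \notin pure_simplices K.
Proof. by rewrite inE negb_and complex_nonempty. Qed.

Fact pure_closed K (s t : {set V}) :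
  s \in pure_simplices K -> t \subset s -> t != set0 ->
  t \in pure_simplices K.
Proof.
rewrite !inE => /andP[sK /exists_inP[u uK /andP[su du]]] ts t0.
rewrite (complex_closed sK ts t0); apply/exists_inP; exists u => //.
by rewrite (fintype.subset_trans ts su).
Qed.

Definition pure_part K : complex V :=
  Complex (pure_nonempty K) (@pure_closed K).

End Complexes.

Section StrongMorse.
Variables (R : realType) (V : finType).
Implicit Types (K : complex V) (g : V -> R) (v : V).

Definition sublevel K g v : complex V :=
  full K [set w in vertices K | g w <= g v].

Definition desc_dominated_by K g v a : Prop :=
  dominated_by (sublevel K g v) v a.

Definition desc_dominated K g v : Prop := exists a, desc_dominated_by K g v a.

Definition matching K g (a : V -> V) : {set {set V} * {set V}} :=
  [set p | [exists v, [&& `[< desc_dominated K g v >],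
     p.1 \in simplices (sublevel K g v), v \in p.1, a v \notin p.1 &
     p.2 == a v |: p.1]]].

Definition strong_matching K (M : {set {set V} * {set V}}) : Prop :=
  exists (g : V -> R) (a : V -> V),
    [/\ {in vertices K &, injective g},
        forall v, desc_dominated K g v -> desc_dominated_by K g v (a v) &
        M = matching K g a].

Definition SM_simplices K : {set {set {set V} * {set V}}} :=
  [set N | (N != set0) &&
    `[< exists M, strong_matching K M /\ N \subset M >]].

Fact SM_nonempty K : set0 \notin SM_simplices K.
Proof. by rewrite inE eqxx. Qed.

Fact SM_closed K (s t : {set {set V} * {set V}}) :
  s \in SM_simplices K -> t \subset s -> t != set0 -> t \in SM_simplices K.
Proof.
rewrite !inE => /andP[_ /asboolP[M [smM sM]]] ts ->; apply/asboolP.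
by exists M; split=> //; apply: fintype.subset_trans sM.
Qed.

Definition SM K : complex ({set V} * {set V})%type :=
  Complex (SM_nonempty K) (@SM_closed K).

Definition SM_pure K := pure_part (SM K).

End StrongMorse.

Section Cycle.
Variable n : nat.

(* The usual cycle graph only for [2 < n]. *)
Definition cycle_simplices : {set {set 'I_n}} :=
  [set [set i] | i : 'I_n] :|: [set [set i; ordS i] | i : 'I_n].

Fact cycle_nonempty : set0 \notin cycle_simplices.
Proof.
rewrite inE negb_or; apply/andP; split; apply/imsetP => -[i _ /setP/(_ i)].
  by rewrite !inE eqxx.
by rewrite !inE eqxx.
Qed.

Fact cycle_closed (s t : {set 'I_n}) :
  s \in cycle_simplices -> t \subset s -> t != set0 -> t \in cycle_simplices.
Proof.
have S1 i : [set i] \in cycle_simplices by rewrite inE imset_f.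
have S2 i : [set i; ordS i] \in cycle_simplices.
  by rewrite inE orbC (imset_f (fun i => [set i; ordS i])).
rewrite inE => /orP[] /imsetP[i _ ->] ts t0.
  by move: ts; rewrite subset1 (negPf t0) orbF => /eqP ->.
have tE : t = [set i; ordS i] :&: t by apply/esym/setIidPr.
have [it|it] := boolP (i \in t); have [jt|jt] := boolP (ordS i \in t).
- have -> // : t = [set i; ordS i].
  by apply/eqP; rewrite eqEsubset ts subUset !sub1set it jt.
- have -> // : t = [set i].
  apply/setP=> x; rewrite tE !inE; have [->|_ /=] := eqVneq x i; first by rewrite it.
  by have [->|] := eqVneq x (ordS i); first by rewrite (negPf jt).
- have -> // : t = [set ordS i].
  apply/setP=> x; rewrite tE !inE; have [->|_] := eqVneq x (ordS i).
    by rewrite orbT jt.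
  by rewrite orbF; have [->|//] := eqVneq x i; rewrite (negPf it).
- case/set0Pn: t0 => x xt; move: (subsetP ts _ xt).
  by rewrite !inE => /orP[] /eqP xE; move: xt; rewrite xE ?(negPf it) ?(negPf jt).
Qed.

Definition cycle_complex : complex 'I_n :=
  Complex cycle_nonempty cycle_closed.

End Cycle.

Section Spaces.
Local Open Scope classical_set_scope.
Variable R : realType.

Definition homotopic (X Y : topologicalType) (f g : X -> Y) : Prop :=
  exists H : X * R -> Y,
    [/\ {within [set: X] `*` `[0, 1], continuous H},
        forall x, H (x, 0) = f x & forall x, H (x, 1) = g x].

Definition homotopy_equivalent (X Y : topologicalType) : Prop :=
  exists (f : X -> Y) (g : Y -> X),
    [/\ continuous f, continuous g,
        homotopic (g \o f) idfun & homotopic (f \o g) idfun].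

(* Barycentric coordinates: the support of a point is a simplex. *)
Definition realization_set (V : finType) (K : complex V) : set {ptws V -> R} :=
  [set x : {ptws V -> R} | [/\ forall v, 0 <= x v, \sum_v x v = 1 &
               [set v | x v != 0]%SET \in simplices K]].

Definition realization (V : finType) (K : complex V) : topologicalType :=
  classical_sets.set_type (realization_set K).

(* The norm of ['rV[R]_m.+1] is the sup norm; only its topology is used. *)
Definition sphere_set (m : nat) : set 'rV[R]_m.+1 :=
  [set x : 'rV[R]_m.+1 | \sum_i x ord0 i ^+ 2 = 1].
Arguments sphere_set : clear implicits.

Definition sphere (m : nat) : topologicalType :=
  classical_sets.set_type (sphere_set m).

Fact sphere_base_subproof m : delta_mx ord0 ord0 \in sphere_set m.
Proof.
apply/mem_set; rewrite /sphere_set /= (bigD1 ord0)//= mxE eqxx expr1n.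
by rewrite big1 ?addr0// => i /negPf i0; rewrite mxE i0 expr0n.
Qed.

Definition sphere_base (m : nat) : sphere m :=
  exist (fun x => x \in sphere_set m) _ (sphere_base_subproof m).

(* [S^m_1 \/ ... \/ S^m_r] for [ms = [:: m_1; ...; m_r]]. *)
Definition wedge_spheres (ms : seq nat) : topologicalType :=
  wedge (fun i : 'I_(size ms) => sphere_base (nth 0%N ms i)).

End Spaces.

(* Main.v *)
Require Import Defs.
From mathcomp Require Import all_boot all_order all_algebra.
From mathcomp Require Import all_classical all_reals all_analysis.
From mathcomp Require Import wedge_sigT fintype finset ring lra zify.

(** Write [c_i], [d_i] for the pairs matching the vertex [i] of the cycle with
    the edge to its successor, resp. predecessor. A vertex filtration with a
    single local maximum [x] and a single local minimum [y] matches the [c_i]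
    on the open arc from [x] to [y] and the [d_i] on the open arc from [y] to
    [x], and these sets of [n - 2] pairs are exactly the maximal dimensional
    facets; they generate the complex [Delta].

    The homotopy equivalences between complexes are sequences of cone
    removals: when [s] is a nonempty set and [c] a vertex off [s] such that
    [c |: t] is a simplex for each simplex [t] above [s], the simplices above
    [s] can be removed. First [Delta] shrinks to a complex [X] in which the
    mixed simplices triangulate an annulus, while the simplices of one colour
    are the sets of vertices with two consecutive gaps, the Alexander dual of
    the independence complex of [C_n]. Pairing each block [3j, 3j+1, 3j+2]
    with its middle vertex reduces each colour to the sets avoiding
    [{3j, 3j+2}]; after a further collapse unless [3] divides [n], only a cone
    and two (one if [3] does not divide [n]) further facets per colour are
    left. Together with one triangle of the annulus they are facets whose
    removal leaves a contractible complex: once the triangle is gone, the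
    annulus collapses onto an edge joining the two cones.

    A complex that becomes contractible when a set of its facets is removed is
    a wedge of spheres, one for each of these facets: the contraction, extended
    to the collars of the facets, shows that collapsing the complement of the
    open facets to a point is a homotopy equivalence, and inverse stereographic
    projection identifies each open facet with a sphere minus its base point. *)

Set Implicit Arguments.
Unset Strict Implicit.
Unset Printing Implicit Defensive.

Import Order.TTheory GRing.Theory Num.Theory.
Import numFieldNormedType.Exports.

Local Open Scope classical_set_scope.
Local Open Scope ring_scope.

(** * Homotopies *)

(** No attaching map is ever studied: all chosen facets are removed at once and only the
    contractibility of the rest matters. That comes from an apex per colour, and the sets to which
    the apex cannot be added dictate the facets. Adding a vertex that is no block end fails only if
    it fills the last pair of consecutive gaps. Since no block contains both its ends, each then
    contains its middle, and the set contains the residues 0, 1, or 1, 2, or switches once from the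
    latter to the former. If [n = 3k], a switching set cannot close up around the cycle; both
    residue patterns obstruct the apex 1 and, deprived of 1, are the facets, with [2k - 1] vertices.
    Otherwise the apex is [3k], outside all blocks, and switching sets obstruct it too, so they are
    collapsed. For [n = 3k + 1] this absorbs the pattern 0, 1; for [n = 3k + 2] the pattern 1, 2
    obstructs only together with [3k + 1], and then it is no simplex. One pattern with [2k] vertices
    is left per colour. The annulus is undisturbed: two vertices of one colour that are not
    cyclically adjacent have no common neighbour of the other colour, so these collapses touch no
    mixed simplex. *)

Section Continuity.
Variables X Y Z : topologicalType.

Lemma cont_id : continuous (fun x : X => x).
Proof. by move=> x; exact: cvg_id. Qed.

Lemma cont_const (y : Y) : continuous (fun _ : X => y).
Proof. by move=> x; exact: cvg_cst. Qed.

Lemma cont_fst : continuous (@fst X Y).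
Proof. by move=> x; exact: cvg_fst. Qed.

Lemma cont_snd : continuous (@snd X Y).
Proof. by move=> x; exact: cvg_snd. Qed.

Lemma cont_pair (f : X -> Y) (g : X -> Z) :
  continuous f -> continuous g -> continuous (fun x => (f x, g x)).
Proof. by move=> cf cg x; exact: (cvg_pair (cf x) (cg x)). Qed.

Lemma cont_comp (f : X -> Y) (g : Y -> Z) :
  continuous f -> continuous g -> continuous (fun x => g (f x)).
Proof. by move=> cf cg x; apply: continuous_comp; [exact: cf|exact: cg]. Qed.

End Continuity.

Section RealContinuity.
Variables (R : realType) (T : topologicalType).
Implicit Types f g : T -> R.

Lemma cont_cst (c : R) : continuous (fun _ : T => c).
Proof. by move=> x; exact: cvg_cst. Qed.

Lemma cont_add f g :
  continuous f -> continuous g -> continuous (fun x => f x + g x).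
Proof. by move=> cf cg x; apply: cvgD; [exact: cf|exact: cg]. Qed.

Lemma cont_opp f : continuous f -> continuous (fun x => - f x).
Proof. by move=> cf x; apply: cvgN; exact: cf. Qed.

Lemma cont_sub f g :
  continuous f -> continuous g -> continuous (fun x => f x - g x).
Proof. by move=> cf cg; apply: cont_add => //; exact: cont_opp. Qed.

Lemma cont_mul f g :
  continuous f -> continuous g -> continuous (fun x => f x * g x).
Proof. by move=> cf cg x; apply: cvgM; [exact: cf|exact: cg]. Qed.

Lemma cont_exp f n : continuous f -> continuous (fun x => f x ^+ n).
Proof.
move=> cf; elim: n => [|n IH].
  by have -> : (fun x => f x ^+ 0) = (fun=> 1) by []; exact: cont_cst.
have -> : (fun x => f x ^+ n.+1) = (fun x => f x * f x ^+ n).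
  by apply/funext => x; rewrite exprS.
exact: cont_mul.
Qed.

Lemma cont_inv f : continuous f -> (forall x, f x != 0) ->
  continuous (fun x => (f x)^-1).
Proof. by move=> cf f0 x; apply: cvgV; [exact: f0|exact: cf]. Qed.

Lemma cont_max f g :
  continuous f -> continuous g -> continuous (fun x => Num.max (f x) (g x)).
Proof. by move=> cf cg x; apply: (continuous_max (cf x) (cg x)). Qed.

Lemma cont_min f g :
  continuous f -> continuous g -> continuous (fun x => Num.min (f x) (g x)).
Proof. by move=> cf cg x; apply: (continuous_min (cf x) (cg x)). Qed.

Lemma cont_sum (I : Type) (r : seq I) (P : pred I) (F : I -> T -> R) :
  (forall i, P i -> continuous (F i)) ->
  continuous (fun x => \sum_(i <- r | P i) F i x).
Proof.
move=> cF; elim: r => [|i r IH].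
  have -> : (fun x => \sum_(j <- [::] | P j) F j x) = (fun=> 0).
    by apply/funext => x; rewrite big_nil.
  exact: cont_cst.
have -> : (fun x => \sum_(j <- i :: r | P j) F j x) = (fun x => if P i then
    F i x + \sum_(j <- r | P j) F j x else \sum_(j <- r | P j) F j x).
  by apply/funext => x; rewrite big_cons.
by case Pi: (P i) => //; apply: cont_add => //; exact: cF.
Qed.

Lemma cont_prod (I : Type) (r : seq I) (P : pred I) (F : I -> T -> R) :
  (forall i, P i -> continuous (F i)) ->
  continuous (fun x => \prod_(i <- r | P i) F i x).
Proof.
move=> cF; elim: r => [|i r IH].
  have -> : (fun x => \prod_(j <- [::] | P j) F j x) = (fun=> 1).
    by apply/funext => x; rewrite big_nil.
  exact: cont_cst.
have -> : (fun x => \prod_(j <- i :: r | P j) F j x) = (fun x => if P i then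
    F i x * \prod_(j <- r | P j) F j x else \prod_(j <- r | P j) F j x).
  by apply/funext => x; rewrite big_cons.
by case Pi: (P i) => //; apply: cont_mul => //; exact: cF.
Qed.

Lemma cont_bigmin (I : Type) (c : R) (r : seq I) (P : pred I) (F : I -> T -> R) :
  (forall i, P i -> continuous (F i)) ->
  continuous (fun x => \big[Num.min/c]_(i <- r | P i) F i x).
Proof.
move=> cF; elim: r => [|i r IH].
  have -> : (fun x => \big[Num.min/c]_(j <- [::] | P j) F j x) = (fun=> c).
    by apply/funext => x; rewrite big_nil.
  exact: cont_cst.
have -> : (fun x => \big[Num.min/c]_(j <- i :: r | P j) F j x) = (fun x => if P i then
    Num.min (F i x) (\big[Num.min/c]_(j <- r | P j) F j x) else \big[Num.min/c]_(j <- r | P j) F j x).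
  by apply/funext => x; rewrite big_cons.
by case Pi: (P i) => //; apply: cont_min => //; exact: cF.
Qed.

Lemma closed_le_cont f g :
  continuous f -> continuous g -> closed [set x | f x <= g x].
Proof.
move=> cf cg; have -> : [set x | f x <= g x] =
    (fun x => g x - f x) @^-1` [set y | 0 <= y].
  by apply/seteqP; split=> x /=; rewrite subr_ge0.
by apply: preimage_closed; [move=> x _; exact: cont_sub|exact: closed_ge].
Qed.

End RealContinuity.

Section Homotopy.
Variable R : realType.
Implicit Types X Y Z : topologicalType.

Definition clamp (s : R) : R := Num.max 0 (Num.min s 1).

Lemma clamp_ge0 s : 0 <= clamp s.
Proof. by rewrite le_max lexx. Qed.

Lemma clamp_le1 s : clamp s <= 1.
Proof. by rewrite ge_max ler01 ge_min lexx orbT. Qed.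

Lemma clamp_id s : 0 <= s <= 1 -> clamp s = s.
Proof. by case/andP=> s0 s1; rewrite /clamp min_l // max_r. Qed.

Lemma clamp0 : clamp 0 = 0. Proof. by rewrite clamp_id// lexx ler01. Qed.
Lemma clamp1 : clamp 1 = 1. Proof. by rewrite clamp_id// lexx ler01. Qed.

Lemma clamp_itv s : `[0, 1]%classic (clamp s).
Proof. by rewrite /= in_itv /= clamp_ge0 clamp_le1. Qed.

Lemma clamp_continuous : continuous clamp.
Proof.
apply: cont_max; first exact: cont_cst.
by apply: cont_min; [move=> s; exact: cvg_id|exact: cont_cst].
Qed.

Lemma continuous_comp_within X Y Z (A : set Y) (f : X -> Y) (g : Y -> Z) :
  continuous f -> (forall x, A (f x)) -> {within A, continuous g} ->
  continuous (g \o f).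
Proof.
move=> cf Af /subspace_continuousP cg x U gU.
have /cg := Af x; move=> /(_ U gU); rewrite nbhs_simpl /within /= => gA.
have := cf x _ gA; rewrite nbhs_simpl /=.
apply: filterS => y /=; apply; exact: Af.
Qed.

Lemma continuous_paste X Y (A B : set X) (h f g : X -> Y) :
  closed A -> closed B -> (forall x, A x \/ B x) ->
  {in A, h =1 f} -> {in B, h =1 g} ->
  {within A, continuous f} -> {within B, continuous g} -> continuous h.
Proof.
move=> cA cB AB hf hg cf cg; apply/continuous_subspace_setT.
have <- : A `|` B = [set: X] by apply/seteqP; split=> x // _; exact: AB.
apply: withinU_continuous => //.
- by apply: (subspace_eq_continuous _ cf) => x xA; apply/esym; exact: hf.
- by apply: (subspace_eq_continuous _ cg) => x xA; apply/esym; exact: hg.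
Qed.

Lemma homotopicP X Y (f g : X -> Y) : homotopic R f g <->
  exists H : X * R -> Y, [/\ continuous H, forall x, H (x, 0) = f x &
    forall x, H (x, 1) = g x].
Proof.
split=> -[H [cH H0 H1]]; last first.
  by exists H; split => //; exact: continuous_subspaceT.
exists (H \o (fun p => (p.1, clamp p.2))); split => [|x|x] /=.
- apply: (continuous_comp_within _ _ cH).
    apply: cont_pair; first exact: cont_fst.
    by apply: cont_comp; [exact: cont_snd|exact: clamp_continuous].
  by move=> p; split => //; exact: clamp_itv.
- by rewrite clamp0.
- by rewrite clamp1.
Qed.

Lemma homotopic_refl X Y (f : X -> Y) : continuous f -> homotopic R f f.
Proof.
move=> cf; apply/homotopicP; exists (f \o fst); split=> //.
by apply: cont_comp => //; exact: cont_fst.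
Qed.

Lemma homotopic_comp X Y X' Y' (k : X' -> X) (h : Y -> Y') (f g : X -> Y) :
  continuous k -> continuous h ->
  homotopic R f g -> homotopic R (h \o f \o k) (h \o g \o k).
Proof.
move=> ck ch /homotopicP[H [cH H0 H1]]; apply/homotopicP.
exists (h \o H \o (fun p => (k p.1, p.2))); split=> [|x|x] /=.
- do 2?apply: cont_comp => //; apply: cont_pair; last exact: cont_snd.
  by apply: cont_comp => //; exact: cont_fst.
- by rewrite H0.
- by rewrite H1.
Qed.

Lemma homotopic_trans X Y (f g h : X -> Y) :
  homotopic R f g -> homotopic R g h -> homotopic R f h.
Proof.
move=> /homotopicP[F [cF F0 F1]] /homotopicP[G [cG G0 G1]]; apply/homotopicP.
pose F' (p : X * R) := F (p.1, 2 * p.2).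
pose G' (p : X * R) := G (p.1, 2 * p.2 - 1).
exists (fun p => if p.2 <= 2^-1 then F' p else G' p).
have c2 : continuous (snd : X * R -> R) by exact: cont_snd.
have c2' : continuous (fun p : X * R => 2 * p.2).
  by apply: (@cont_mul R); [exact: cont_cst|exact: c2].
split=> [|x|x] /=.
- apply: (@continuous_paste _ _ [set p : X * R | p.2 <= 2^-1]
    [set p : X * R | 2^-1 <= p.2] _ F' G').
  + by apply: closed_le_cont => //; exact: cont_cst.
  + by apply: closed_le_cont => //; exact: cont_cst.
  + by move=> p /=; case: (leP p.2 2^-1) => [|/ltW]; [left|right].
  + by move=> p /set_mem /= ->.
  + move=> p /set_mem /= p2; case: ifP => // p2'.
    have e : p.2 = 2^-1 by apply/le_anti; rewrite p2 p2'.
    by rewrite /F' /G' e mulfV// subrr F1 G0.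
  + apply/continuous_subspaceT/cont_comp => //.
    by apply: cont_pair; first exact: cont_fst.
  + apply/continuous_subspaceT/cont_comp => //.
    apply: cont_pair; first exact: cont_fst.
    by apply: cont_sub => //; exact: cont_cst.
- by rewrite ifT ?invr_ge0// /F' mulr0 F0.
- rewrite ifF /G' /=; first by rewrite mulr1 -[2]/(1 + 1) addrK G1.
  by apply/negbTE; rewrite -ltNge invf_lt1// ltr1n.
Qed.

Lemma homotopy_equivalent_refl X : homotopy_equivalent R X X.
Proof.
have cid := @cont_id X.
by exists id, id; split => //; exact: homotopic_refl.
Qed.

Lemma homotopy_equivalent_sym X Y :
  homotopy_equivalent R X Y -> homotopy_equivalent R Y X.
Proof. by case=> f [g [? ? ? ?]]; exists g, f. Qed.

Lemma homotopy_equivalent_trans Y X Z : homotopy_equivalent R X Y ->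
  homotopy_equivalent R Y Z -> homotopy_equivalent R X Z.
Proof.
move=> [f [g [cf cg gf fg]]] [f' [g' [cf' cg' gf' fg']]].
exists (f' \o f), (g \o g'); split; try exact: cont_comp.
- exact: homotopic_trans (homotopic_comp cf cg gf') gf.
- exact: homotopic_trans (homotopic_comp cg' cf' fg) fg'.
Qed.

Definition contractible X := exists p : X, homotopic R (fun=> p) (@idfun X).

Lemma contractible_equiv X Y :
  homotopy_equivalent R X Y -> contractible Y -> contractible X.
Proof.
move=> [f [g [cf cg gf _]]] [p hp]; exists (g p).
exact: homotopic_trans (homotopic_comp cf cg hp) gf.
Qed.

End Homotopy.

(** * Geometric realizations *)

Lemma complex_eq (V : finType) (K L : complex V) :
  simplices K = simplices L -> K = L.
Proof.
case: K L => [sK nK cK] [sL nL cL] /= e; case: _ / e in nL cL *.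
by congr Complex; exact: Prop_irrelevance.
Qed.

Lemma compact_set_type (T : topologicalType) (A : set T) :
  compact A -> compact [set: A].
Proof.
move=> cA F PF _; have GA : (val @ F) A.
  by rewrite /fmap /=; apply: (filterS _ filterT) => y _; exact: set_valP.
have [p [Ap clp]] := cA _ (fmap_proper_filter _ PF) GA.
exists (SigSub (mem_set Ap)); split => // B C FB [_ [[W oW <-] Wp] WC].
have [] := clp (val @` B) W; last by move=> _ [[q Bq <-] Wq]; exists q; split => //; exact: WC.
  by rewrite /fmap /=; apply: (filterS _ FB) => y By; exists y.
exact: open_nbhs_nbhs.
Qed.

Section Points.
Variables (R : realType) (V : finType).
Implicit Types K L : complex V.

Definition coord K (x : realization R K) (v : V) : R := (val x : {ptws V -> R}) v.

Definition supp (x : V -> R) : {set V} := [set v | x v != 0]%SET.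

Lemma coord_ge0 K (x : realization R K) v : 0 <= coord x v.
Proof. by have [x0 _ _] := set_valP x; exact: x0. Qed.

Lemma coord_sum K (x : realization R K) : \sum_v coord x v = 1.
Proof. by have [_ x1 _] := set_valP x; exact: x1. Qed.

Lemma coord_supp K (x : realization R K) : supp (coord x) \in simplices K.
Proof. by have [_ _ xK] := set_valP x; exact: xK. Qed.

Lemma coord_le1 K (x : realization R K) v : coord x v <= 1.
Proof.
rewrite -(coord_sum x) (bigD1 v)//= lerDl sumr_ge0// => w _.
exact: coord_ge0.
Qed.

Lemma coord_inj K (x y : realization R K) : coord x =1 coord y -> x = y.
Proof. by move=> xy; apply: val_inj; apply/funext. Qed.

Lemma cont_coord K v : continuous (fun x : realization R K => coord x v).
Proof.
move=> x; apply: (@continuous_comp _ _ _ (fun y : realization R K => val y)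
  (fun y : {ptws V -> R} => y v)).
  exact: initial_continuous.
exact: (@proj_continuous V (fun=> R) v).
Qed.

Section Lift.
Variables (T : topologicalType) (K : complex V) (f : T -> V -> R).
Hypothesis fK : forall t, realization_set K (f t).

Definition lift t : realization R K := SigSub (mem_set (fK t)).

Lemma coord_lift t v : coord (lift t) v = f t v. Proof. by []. Qed.

Lemma cont_lift : (forall v, continuous (f ^~ v)) -> continuous lift.
Proof.
move=> cf; apply: continuous_comp_initial => t.
apply/cvg_sup => v.
exact: (@continuous_comp_initial _ _ _ (fun g : V -> R => g v) f (cf v) t).
Qed.

End Lift.

Lemma cont_realization (T : topologicalType) K (f : T -> realization R K) :
  (forall v, continuous (fun t => coord (f t) v)) -> continuous f.
Proof.
move=> cf; apply: continuous_comp_initial => t.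
apply/cvg_sup => v.
exact: (@continuous_comp_initial _ _ _ (fun g : V -> R => g v)
  (fun t => coord (f t)) (cf v) t).
Qed.

(** The support condition is closed because it amounts to one inequality per nonempty non-simplex:
    the product of its coordinates is at most 0. The surrounding cube is compact by Tychonoff. *)
Lemma realization_compact K : compact [set: realization R K].
Proof.
have cA : closed (realization_set K : set {ptws V -> R}).
  have cv v : continuous (fun x : {ptws V -> R} => x v).
    exact: (@proj_continuous V (fun=> R) v).
  have -> : (realization_set K : set {ptws V -> R}) =
      \bigcap_(v : V) [set x | 0 <= x v] `&`
      ([set x | \sum_v x v <= 1] `&` [set x | 1 <= \sum_v x v] `&`
      \bigcap_(t in [set t : {set V} | t \notin simplices K /\ t != finset.set0])
        ([set x | \prod_(v in t) x v <= 0])).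
    apply/seteqP; split=> x.
      rewrite /realization_set /= => -[x0 x1 xK]; split; first by move=> v _; exact: x0.
      split; first by split; rewrite /= x1.
      move=> t [tK t0] /=; suff [v vt xv] : exists2 v, v \in t & x v = 0.
        by rewrite (bigD1 v) //= xv mul0r.
      apply: contrapT => h; case/negP: tK; apply: complex_closed xK _ t0.
      apply/subsetP => v vt; rewrite inE; apply/eqP => xv; apply: h.
      by exists v.
    case=> x0 [[x1 x1'] xK]; split=> [v||]; first exact: x0.
      by apply/le_anti; rewrite x1.
    apply: contrapT => /negP nK.
    have sne : supp x != finset.set0.
      apply/eqP => s0; have e : \sum_v x v = 0.
        apply: big1 => v _; apply/eqP; have : v \notin supp x by rewrite s0 inE.
        by rewrite inE negbK.
      by move: x1'; rewrite /= e ler10.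
    have := xK _ (conj nK sne).
    rewrite /= leNgt prodr_gt0// => v; rewrite inE => xv.
    by rewrite lt_neqAle eq_sym xv; exact: (x0 _ I).
  apply: closedI; first by apply: closed_bigI => v _; apply: closed_le_cont => //; exact: cont_cst.
  apply: closedI.
    by apply: closedI; apply: closed_le_cont; (try exact: cont_cst); exact: cont_sum.
  apply: closed_bigI => t _; apply: closed_le_cont; last exact: cont_cst.
  exact: cont_prod.
apply: compact_set_type.
have cB : compact ([set x : V -> R | forall v, `[0, 1]%classic (x v)] : set {ptws V -> R}).
  exact: (@tychonoff V (fun=> R) (fun=> `[0, 1]%classic)
    (fun=> @segment_compact R 0 1)).
apply: (subclosed_compact cA cB).
move=> x [x0 x1 _] v /=; rewrite in_itv /= x0 /= -x1 (bigD1 v)//= lerDl.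
by rewrite sumr_ge0.
Qed.

End Points.

(** * Cone removals *)

Section Avoid.
Variable V : finType.
Implicit Types (K L : complex V) (s t : {set V}) (S : {set {set V}}).

Definition avoid_simplices K S : {set {set V}} :=
  [set t in simplices K | [forall s in S, ~~ (s \subset t)]]%SET.

Fact avoid_nonempty K S : finset.set0 \notin avoid_simplices K S.
Proof. by rewrite inE negb_and complex_nonempty. Qed.

Fact avoid_closed K S s t : s \in avoid_simplices K S -> t \subset s ->
  t != finset.set0 -> t \in avoid_simplices K S.
Proof.
rewrite !inE => /andP[sK /forall_inP sS] ts t0.
rewrite (complex_closed sK ts t0); apply/forall_inP => u uS.
by apply: contra (sS u uS) => ut; exact: fintype.subset_trans ts.
Qed.

Definition avoid K S : complex V :=
  Complex (avoid_nonempty K S) (@avoid_closed K S).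

Lemma in_avoid K S t : (t \in simplices (avoid K S)) =
  (t \in simplices K) && [forall s in S, ~~ (s \subset t)].
Proof. by rewrite inE. Qed.

Lemma avoidP K S t : reflect
  (t \in simplices K /\ forall s, s \in S -> ~~ (s \subset t))
  (t \in simplices (avoid K S)).
Proof. by rewrite in_avoid; apply: (iffP andP) => -[tK /forall_inP]. Qed.

Lemma avoid_avoid K S S' : avoid (avoid K S) S' = avoid K (S :|: S').
Proof.
apply: complex_eq; apply/setP => t; apply/avoidP/avoidP.
  by move=> [/avoidP[tK tS] tS']; split=> // s /setUP[/tS|/tS'].
move=> [tK tS]; split; last by move=> s sS; apply: tS; rewrite inE sS orbT.
by apply/avoidP; split=> // s sS; apply: tS; rewrite inE sS.
Qed.

Lemma avoid0 K : avoid K finset.set0 = K.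
Proof.
apply: complex_eq; apply/setP => t; apply/avoidP/idP => [[]//|tK].
by split=> // s; rewrite inE.
Qed.

End Avoid.

Section ConeRemoval.
Variables (R : realType) (V : finType).
Implicit Types (K L : complex V) (s t : {set V}).

Lemma in_realization K (f : V -> R) t : (forall v, 0 <= f v) ->
  \sum_v f v = 1 -> supp f \subset t -> t \in simplices K ->
  realization_set K f.
Proof.
move=> f0 f1 ft tK; split=> //; apply: complex_closed tK ft _.
apply/eqP => s0; have : \sum_v f v = 0.
  apply: big1 => v _; apply/eqP; have : v \notin supp f by rewrite s0 inE.
  by rewrite inE negbK.
by move=> e; move: f1 (oner_neq0 R); rewrite e => <-; rewrite eqxx.
Qed.

Lemma avoid_in K S (x : realization R (avoid K S)) : realization_set K (coord x).
Proof.
split; [exact: coord_ge0|exact: coord_sum|].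
by have /avoidP[] := coord_supp x.
Qed.

Variables (K : complex V) (s : {set V}) (c : V).
Hypotheses (s0 : s != finset.set0) (cs : c \notin s).
Hypothesis cK : forall t, t \in simplices K -> s \subset t ->
  c |: t \in simplices K.

Let L := avoid K [set s]%SET.

(** At a point of the realization this is positive exactly when the support contains [s]. The
    default 1 never wins wrongly, as coordinates are at most 1 and [s] is nonempty. *)
Definition depth (x : V -> R) := \big[Num.min/1]_(v in s) x v.

Lemma depth_le x v : v \in s -> depth x <= x v.
Proof. exact: bigmin_le_cond. Qed.

Lemma depth_ge0 x : (forall v, 0 <= x v) -> 0 <= depth x.
Proof. by move=> x0; apply: le_bigmin. Qed.

Lemma depth_attained x : (forall v, x v <= 1) -> exists2 v, v \in s & depth x = x v.
Proof.
move=> x1; have [w ws] := set0Pn _ s0.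
have [v vs dv] := @eq_bigmin _ _ _ 1 w (mem s) x ws (fun i _ => x1 i).
by exists v.
Qed.

(* The mass [t * depth x] is moved from every vertex of [s] to the apex. *)
Definition push (x : V -> R) (t : R) (v : V) : R :=
  x v - t * depth x * (v \in s)%:R + t * depth x * #|s|%:R * (v == c)%:R.

Lemma push0 x : push x 0 = x.
Proof. by apply/funext => v; rewrite /push !mul0r subr0 addr0. Qed.

Lemma push_in (x : realization R K) (t : R) : 0 <= t <= 1 ->
  realization_set K (push (coord x) t).
Proof.
(* With positive depth the support contains [s], so the apex may be added to it; with depth 0
   nothing moves. *)
case/andP=> t0 t1; set y := coord x; pose u := if depth y == 0 then supp y else c |: supp y.
have d0 : 0 <= depth y by apply: depth_ge0 => v; exact: coord_ge0.
have td v : v \in s -> t * depth y <= y v.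
  move=> vs; apply: le_trans (depth_le y vs).
  by rewrite -[leRHS]mul1r ler_wpM2r.
apply: (@in_realization _ _ u).
- move=> v; rewrite /push; apply: addr_ge0; last by rewrite !mulr_ge0.
  have [vs|vs] := boolP (v \in s); last by rewrite mulr0 subr0 coord_ge0.
  by rewrite mulr1 subr_ge0 td.
- rewrite big_split /= sumrB coord_sum -!big_distrr /=.
  have -> : \sum_(i : V) (i == c)%:R = 1 :> R.
    by rewrite (bigD1 c) //= eqxx big1 ?addr0// => v /negbTE ->.
  have -> : \sum_(i : V) (i \in s)%:R = #|s|%:R :> R.
    rewrite -sum1_card natr_sum [RHS]big_mkcond; apply: eq_bigr => v _.
    by case: (v \in s).
  by rewrite mulr1 addrNK.
- apply/subsetP => v; rewrite inE /push /u; case: ifP => [/eqP ->|_].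
    by rewrite mulr0 !mul0r subr0 addr0 inE.
  rewrite !inE; have [//|vc] := eqVneq v c; rewrite mulr0 addr0 /=.
  apply: contraNneq => yv; case: (boolP (v \in s)) => vs; last by rewrite mulr0 yv subr0.
  have := td v vs; rewrite yv => h.
  have -> : t * depth y = 0 by apply/le_anti; rewrite h mulr_ge0.
  by rewrite mul0r subr0.
- rewrite /u; case: eqP => [_|/eqP d]; first exact: coord_supp.
  apply: cK; first exact: coord_supp.
  apply/subsetP => v vs; rewrite inE; apply: contra_neq d => yv.
  by apply/le_anti; rewrite d0 -yv depth_le.
Qed.

Lemma push1_in (x : realization R K) : realization_set L (push (coord x) 1).
Proof.
have [p0 p1 pK] : realization_set K (push (coord x) 1).
  by apply: push_in; rewrite ler01 lexx.
split=> //; apply/avoidP; split=> // _ /set1P ->.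
(* A vertex of [s] realizing the minimum loses all its mass, and the apex, being off [s], cannot
   give it back. *)
have [v vs dv] := depth_attained (coord_le1 x).
apply/subsetPn; exists v => //; rewrite inE negbK /push vs.
have /negbTE -> : v != c by apply: contraNneq cs => <-.
by rewrite dv mulr1 mulr0 addr0 mul1r subrr.
Qed.

Lemma cont_depth : continuous (fun x : realization R K => depth (coord x)).
Proof. by apply: cont_bigmin => v _; exact: cont_coord. Qed.

(** The push is a deformation retraction: the depth vanishes on [L], so the points of [L] never
    move. *)
Lemma cone_removal :
  homotopy_equivalent R (realization R K) (realization R L).
Proof.
have cpush v (T : topologicalType) (f : T -> realization R K) (g : T -> R) :
    continuous f -> continuous g ->
    continuous (fun z => push (coord (f z)) (g z) v).
  move=> cf cg; have cd : continuous (fun z => depth (coord (f z))).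
    exact: cont_comp cf cont_depth.
  apply: cont_add; first apply: cont_sub.
  - exact: cont_comp cf (@cont_coord _ _ _ v).
  - by apply: cont_mul; [exact: cont_mul|exact: cont_cst].
  - by do ?apply: cont_mul => //; exact: cont_cst.
exists (lift push1_in), (lift (@avoid_in K [set s]%SET)); split.
- by apply: cont_lift => v; apply: cpush => //; [exact: cont_id|exact: cont_cst].
- by apply: cont_lift => v; exact: cont_coord.
- apply/homotopicP.
  have H_in (p : realization R K * R) :
      realization_set K (push (coord p.1) (1 - clamp p.2)).
    by apply: push_in; rewrite subr_ge0 clamp_le1 lerBlDr lerDl clamp_ge0.
  exists (lift H_in); split=> [|x|x].
  + apply: cont_lift => v; apply: cpush; first exact: cont_fst.
    apply: cont_sub; first exact: cont_cst.
    exact: cont_comp (@cont_snd _ _) (@clamp_continuous R).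
  + by apply: coord_inj => v; rewrite coord_lift /= clamp0 subr0.
  + by apply: coord_inj => v; rewrite coord_lift /= clamp1 subrr push0.
- have -> : lift push1_in \o lift (@avoid_in K [set s]%SET) = idfun.
    apply/funext => x; apply: coord_inj => v; rewrite !coord_lift /=.
    rewrite /push.
    suff -> : depth (coord (lift (@avoid_in K [set s]%SET) x)) = 0.
      by rewrite mulr0 !mul0r subr0 addr0.
    have /avoidP[_ /(_ s)] := coord_supp x.
    rewrite inE eqxx => /(_ isT) /subsetPn[w ws]; rewrite inE negbK => /eqP xw.
    apply/le_anti; rewrite depth_ge0 ?andbT; last exact: coord_ge0.
    by rewrite -xw; exact: depth_le.
  by apply: homotopic_refl; exact: cont_id.
Qed.

End ConeRemoval.

Section Collapse.
Variables (R : realType) (V : finType).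
Implicit Types (K L : complex V) (t : {set V}).

(** The sets are removed by increasing rank, in any order within a rank, and the induction peels off
    one of maximal rank. The last hypothesis makes each step a cone removal: the apex creates no set
    of at most the current rank, so the enlarged simplex survives the earlier removals. *)
Lemma collapse (I : finType) (s : I -> {set V}) (c : I -> V) (rk : I -> nat)
    (A : {set I}) K :
  (forall i, i \in A -> s i != finset.set0) ->
  (forall i, i \in A -> c i \notin s i) ->
  (forall i t, i \in A -> t \in simplices K -> s i \subset t ->
     (forall j, j \in A -> (rk j < rk i)%N -> ~~ (s j \subset t)) ->
     c i |: t \in simplices K /\
     forall j, j \in A -> (rk j <= rk i)%N ->
       s j \subset c i |: t -> s j \subset t) ->
  homotopy_equivalent R (realization R K) (realization R (avoid K (s @: A)%SET)).
Proof.
have [m] := ubnP #|A|; elim: m A => // m IH A Am s0 cs hK.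
have [->|[i0 i0A]] := set_0Vmem A.
  by rewrite imset0 avoid0; exact: homotopy_equivalent_refl.
have [i iA imax] := @arg_maxnP _ i0 (mem A) rk i0A.
have -> : avoid K (s @: A)%SET =
    avoid (avoid K (s @: (A :\ i))%SET) [set s i]%SET.
  by rewrite avoid_avoid -[in LHS](setD1K iA) imsetU1 setUC.
have AD j : j \in A :\ i -> j \in A by rewrite inE => /andP[].
apply: (@homotopy_equivalent_trans _ (realization R (avoid K (s @: (A :\ i))%SET))).
  apply: IH => [|j /AD/s0//|j /AD/cs//|j t jA tK st hj].
    by move: Am; rewrite (cardsD1 i) (iA : i \in A).
  have [|ctK hc] := hK j t (AD _ jA) tK st.
    move=> k kA kj; apply: hj => //; rewrite !inE kA andbT.
    by apply: contraTneq kj => ->; rewrite -leqNgt; exact/imax/AD.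
  by split=> // k /AD; exact: hc.
apply: (@cone_removal _ _ _ _ (c i)); [exact: s0|exact: cs|].
move=> t /avoidP[tK tA] st.
have [|ctK hc] := hK i t iA tK st.
  move=> j jA ji; apply: tA; apply: imset_f; rewrite !inE jA andbT.
  by apply: contraTneq ji => ->; rewrite ltnn.
apply/avoidP; split=> // _ /imsetP[j jA ->]; apply/negP.
move=> /(hc j (AD _ jA) (imax _ (AD _ jA))); apply/negP.
exact/tA/imset_f.
Qed.

Lemma cone_contractible K (p : V) : [set p]%SET \in simplices K ->
  (forall t, t \in simplices K -> p |: t \in simplices K) ->
  contractible R (realization R K).
Proof.
move=> pK cK.
have p_in : realization_set K (fun v => (v == p)%:R : R).
  apply: (@in_realization _ _ _ _ [set p]%SET) => //.
    by rewrite (bigD1 p) //= eqxx big1 ?addr0// => i /negbTE ->.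
  by apply/subsetP => v; rewrite !inE; case: (v == p) => //; rewrite eqxx.
exists (SigSub (mem_set p_in)); apply/homotopicP.
pose f (q : realization R K * R) v : R :=
  clamp q.2 * coord q.1 v + (1 - clamp q.2) * (v == p)%:R.
have f_in q : realization_set K (f q).
  have c0 := clamp_ge0 q.2; have c1 : 0 <= 1 - clamp q.2.
    by rewrite subr_ge0 clamp_le1.
  apply: (@in_realization _ _ _ _ (p |: supp (coord q.1))).
  - by move=> v; rewrite addr_ge0// mulr_ge0// coord_ge0.
  - rewrite big_split /= -!mulr_sumr coord_sum.
    by have [_ -> _] := p_in; rewrite !mulr1 addrC subrK.
  - apply/subsetP => v; rewrite !inE /f.
    case: (v == p) => //=; rewrite mulr0 addr0.
    by apply: contraNneq => ->; rewrite mulr0.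
  - by apply: cK; exact: coord_supp.
exists (lift f_in); split=> [|x|x].
- have cl : continuous (fun q : realization R K * R => clamp q.2).
    exact: cont_comp (@cont_snd _ _) (@clamp_continuous R).
  apply: cont_lift => v; apply: cont_add; apply: cont_mul => //.
  + exact: cont_comp (@cont_fst _ _) (@cont_coord _ _ _ v).
  + by apply: cont_sub => //; exact: cont_cst.
  + exact: cont_cst.
- apply: coord_inj => v; rewrite coord_lift /f /= clamp0 mul0r add0r subr0.
  by rewrite mul1r.
- by apply: coord_inj => v; rewrite coord_lift /f /= clamp1 subrr mul0r addr0 mul1r.
Qed.

End Collapse.

Section Isomorphism.
Variables (R : realType) (V W : finType) (f : V -> W).
Variables (K : complex V) (L : complex W).
Hypothesis f_inj : injective f.
Hypothesis KL : simplices L =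
  [set f @: (t : {set V}) | t in simplices K]%SET.

Let push_forward (x : V -> R) (w : W) : R := \sum_(v | f v == w) x v.

Let sum_push x : \sum_w push_forward x w = \sum_v x v.
Proof. by rewrite [RHS](partition_big f xpredT). Qed.

Let push_imf x v : push_forward x (f v) = x v.
Proof.
rewrite /push_forward (eq_bigl (pred1 v)) ?big_pred1_eq// => u /=.
by rewrite (inj_eq f_inj).
Qed.

Let fwd_in (x : realization R K) : realization_set L (push_forward (coord x)).
Proof.
apply: (@in_realization _ _ _ _ (f @: supp (coord x))%SET).
- by move=> w; apply: sumr_ge0 => v _; exact: coord_ge0.
- by rewrite sum_push coord_sum.
- apply/subsetP => w; rewrite inE; apply: contraNT => wf.
  rewrite /push_forward big1// => v /eqP fv; apply: contraNeq wf => xv.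
  by rewrite -fv; apply: imset_f; rewrite inE.
- by rewrite KL; apply: imset_f; exact: coord_supp.
Qed.

Let push_back (y : realization R L) :
  push_forward (coord y \o f) =1 coord y.
Proof.
move=> w; have [/imsetP[v _ ->]|wf] := boolP (w \in f @: [set: V])%SET.
  by rewrite push_imf.
rewrite /push_forward big1.
  apply/esym/eqP; apply: contraNT wf => yw.
  have := coord_supp y; rewrite KL => /imsetP[t _ e].
  have : w \in supp (coord y) by rewrite inE.
  by rewrite e => /imsetP[v _ ->]; apply: imset_f; rewrite inE.
by move=> v /eqP fv; case/imsetP: wf; exists v.
Qed.

Let bwd_in (y : realization R L) : realization_set K (coord y \o f).
Proof.
have := coord_supp y; rewrite KL => /imsetP[t tK e].
apply: (@in_realization _ _ _ _ t) => //.
- by move=> v; exact: coord_ge0.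
- by rewrite -sum_push (eq_bigr _ (fun w _ => push_back y w)) coord_sum.
- apply/subsetP => v; rewrite inE => yv.
  have : f v \in supp (coord y) by rewrite inE.
  by rewrite e (mem_imset _ _ f_inj).
Qed.

Lemma realization_iso : homotopy_equivalent R (realization R K) (realization R L).
Proof.
exists (lift fwd_in), (lift bwd_in); split.
- by apply: cont_lift => w; apply: cont_sum => v _; exact: cont_coord.
- by apply: cont_lift => v; exact: cont_coord.
- have -> : lift bwd_in \o lift fwd_in = idfun.
    by apply/funext => x; apply: coord_inj => v; exact: push_imf.
  exact: homotopic_refl (@cont_id _).
- have -> : lift fwd_in \o lift bwd_in = idfun.
    by apply/funext => y; apply: coord_inj => w; exact: push_back.
  exact: homotopic_refl (@cont_id _).
Qed.

End Isomorphism.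

(** * Collapsing a subspace *)

Lemma hausdorff_separated (X : topologicalType) :
  (forall x y : X, x <> y -> exists (Z : topologicalType) (f : X -> Z),
     [/\ hausdorff_space Z, continuous f & f x <> f y]) ->
  hausdorff_space X.
Proof.
move=> sep p q clpq; apply: contrapT => /sep[Z [f [hZ cf]]]; apply.
apply: hZ => A B nA nB.
by have [z [Az Bz]] := clpq _ _ (cf p A nA) (cf q B nB); exists (f z).
Qed.

Lemma hausdorff_prod (X Y : topologicalType) :
  hausdorff_space X -> hausdorff_space Y -> hausdorff_space (X * Y)%type.
Proof.
move=> hX hY; apply: hausdorff_separated => -[x y] [x' y'] ne.
have [xx|xx] := pselect (x = x'); last first.
  by exists X, fst; split=> //; exact: cont_fst.
exists Y, snd; split=> //; first exact: cont_snd.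
by move=> /= yy; apply: ne; rewrite xx yy.
Qed.

Lemma hausdorff_set_type (X : topologicalType) (A : set X) :
  hausdorff_space X -> hausdorff_space A.
Proof.
move=> hX; apply: hausdorff_separated => x y ne.
exists X, set_val; split=> //; first exact: initial_continuous.
by move=> e; apply: ne; exact: val_inj.
Qed.

Lemma cont_rV (R : realType) (T : topologicalType) m (f : T -> 'rV[R]_m) :
  (forall j, continuous (fun t => f t ord0 j)) -> continuous f.
Proof.
move=> cf t A [P Pn PA].
have : \forall u \near t, forall j, P ord0 j (f u ord0 j).
  by apply: filter_forall => j; exact: cf.
by apply: filterS => u Pu; apply: PA => i j; rewrite ord1.
Qed.

Section QuotientMap.
Variables (X Y : topologicalType) (q : X -> Y).
Hypotheses (cX : compact [set: X]) (hY : hausdorff_space Y).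
Hypotheses (cq : continuous q) (sq : forall y, exists x, q x = y).

(** A continuous surjection from a compact space to a Hausdorff one is closed, hence a quotient
    map. *)
Lemma quotient_continuous (Z : topologicalType) (g : Y -> Z) :
  continuous (g \o q) -> continuous g.
Proof.
move=> /continuous_closedP cgq; apply/continuous_closedP => C cC.
have -> : g @^-1` C = q @` ((g \o q) @^-1` C).
  apply/seteqP; split=> [y Cy|_ [x Cx <-]//].
  by have [x xy] := sq y; exists x => //=; rewrite xy.
apply: compact_closed => //; apply: continuous_compact.
  exact: continuous_subspaceT.
exact: subclosed_compact (cgq _ cC) cX _.
Qed.

End QuotientMap.

Section QuotientEquivalence.
Variables (R : realType) (X Y : topologicalType) (A : set X).
Variables (q : X -> Y) (h : X * R -> X) (p : X).
Hypotheses (cX : compact [set: X]) (hY : hausdorff_space Y).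
Hypotheses (cq : continuous q) (sq : forall y, exists x, q x = y).
Hypothesis q_inj : forall x x', q x = q x' -> x = x' \/ (A x /\ A x').
Hypothesis q_const : forall x x', A x -> A x' -> q x = q x'.
Hypotheses (ch : continuous h) (h1 : forall x, h (x, 1) = x).
Hypothesis h0 : forall x, A x -> h (x, 0) = p.
Hypothesis hA : forall x s, A x -> A (h (x, s)).

(** [Y] is [X] with [A] collapsed to a point. Read from time 1 down to 0, [h] deforms the identity
    of [X], keeps [A] inside itself and ends with a map that is constant on [A]; this end map
    factors through [q] and gives the homotopy inverse. *)
Lemma quotient_equivalent : homotopy_equivalent R X Y.
Proof.
pose sec y := sval (cid (sq y)).
have secK y : q (sec y) = y by rewrite /sec; case: cid.
have cI : compact [set: `[0, 1]%classic : set R].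
  exact: compact_set_type (@segment_compact R 0 1).
have c0 : continuous (fun x => h (x, 0)).
  by apply: cont_comp ch; apply: cont_pair; [exact: cont_id|exact: cont_const].
have h_sec x : h (sec (q x), 0) = h (x, 0).
  by have [->|[Ax Ay]] := q_inj (secK (q x)); last rewrite !h0.
exists q, (fun y => h (sec y, 0)); split=> //.
- apply: (quotient_continuous cX hY cq sq).
  by have -> : (fun y => h (sec y, 0)) \o q = (fun x => h (x, 0)) by apply/funext.
- apply/homotopicP; exists h; split=> // x /=; by rewrite h_sec.
- apply/homotopicP.
  pose clampI s : `[0, 1]%classic : set R := SigSub (mem_set (clamp_itv s)).
  (* Time is restricted to the compact interval so that the product of [q] with the identity still
     starts from a compact space and is again a quotient map. *)
  pose G (u : Y * `[0, 1]%classic) : Y := q (h (sec u.1, val u.2)).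
  have cG : continuous G.
    pose I01 : topologicalType := `[0, 1]%classic : set R.
    pose qI (u : X * I01) : Y * I01 := (q u.1, u.2).
    apply: (@quotient_continuous (X * I01)%type (Y * I01)%type qI _ _ _ _ Y G).
    + by rewrite -setXTT; exact: compact_setX.
    + apply: hausdorff_prod => //; apply: hausdorff_set_type; exact: Rhausdorff.
    + apply: cont_pair; last exact: cont_snd.
      exact: cont_comp (@cont_fst _ _) cq.
    + by move=> [y s]; have [x <-] := sq y; exists (x, s).
    + have -> : G \o qI = (fun u => q (h (u.1, val u.2))).
        apply/funext => -[x s]; rewrite /G /=.
        have [->//|[Ax Ay]] := q_inj (secK (q x)).
        by apply: q_const; exact: hA.
      apply: cont_comp cq; apply: cont_comp ch.
      apply: cont_pair; first exact: cont_fst.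
      exact: cont_comp (@cont_snd _ _) (@initial_continuous _ _ _).
  exists (fun u => G (u.1, clampI u.2)); split=> [|y|y] /=.
  + apply: cont_comp cG; apply: cont_pair; first exact: cont_fst.
    apply: cont_comp; first exact: cont_snd.
    by apply: continuous_comp_initial; exact: clamp_continuous.
  + by rewrite /G /= clamp0.
  + by rewrite /G /= clamp1 h1 secK.
Qed.

End QuotientEquivalence.

(** * Facets and spheres *)

Section Facet.
Variables (R : realType) (V : finType) (K : complex V) (m : nat).
Variable e : 'I_m.+1 -> V.
Hypothesis e_inj : injective e.

Let F : {set V} := [set e j | j in 'I_m.+1]%SET.

Hypothesis FK : F \in simplices K.
Hypothesis F_facet : forall t, t \in simplices K -> F \subset t -> t = F.

Let eF j : e j \in F. Proof. exact: imset_f. Qed.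

Let F0 : F != finset.set0.
Proof. by apply/set0Pn; exists (e ord0). Qed.

Let sumF (f : V -> R) : \sum_(v in F) f v = \sum_j f (e j).
Proof. by rewrite big_imset //= => i j _ _ /e_inj. Qed.

(* Over the open facet the map below is inverse stereographic projection
   applied to the displacements of the coordinates divided by [rho]; the
   mass [far] outside the facet keeps the denominator positive elsewhere. *)
Definition rho (x : V -> R) : R := m.+1%:R * depth F x.
Definition disp (x : V -> R) j : R := x (e j) - x (e ord0).
Definition disp2 x : R := \sum_j disp x j ^+ 2.
Definition far (x : V -> R) : R := 1 - \sum_j x (e j).
Definition den x : R := disp2 x + far x + rho x ^+ 2.

Definition facet_map (x : V -> R) : 'rV[R]_m.+1 :=
  \row_j (if j == ord0 then (disp2 x + far x - rho x ^+ 2) / den x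
          else 2 * rho x * disp x j / den x).

Implicit Types x y : realization R K.

Lemma rho_ge0 x : 0 <= rho (coord x).
Proof. by rewrite mulr_ge0// depth_ge0// => v; exact: coord_ge0. Qed.

Lemma rho_gt0P x : reflect (supp (coord x) = F) (0 < rho (coord x)).
Proof.
apply: (iffP idP) => [r0|sF].
  apply: F_facet; first exact: coord_supp.
  apply/subsetP => v vF; rewrite inE gt_eqF//; apply: lt_le_trans (depth_le _ vF).
  by move: r0; rewrite pmulr_rgt0.
rewrite pmulr_rgt0//; have [v vF ->] := depth_attained F0 (coord_le1 x).
by rewrite lt_neqAle coord_ge0 eq_sym; move: vF; rewrite -sF inE => ->.
Qed.

Lemma farE x : far (coord x) = \sum_(v | v \notin F) coord x v.
Proof. by rewrite /far -(coord_sum x) (bigID (mem F)) /= sumF addrAC subrr add0r. Qed.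

Lemma far_ge0 x : 0 <= far (coord x).
Proof. by rewrite farE; apply: sumr_ge0 => v _; exact: coord_ge0. Qed.

Lemma far_eq0 x : 0 < rho (coord x) -> far (coord x) = 0.
Proof.
by move=> /rho_gt0P sF; rewrite farE; apply: big1 => v; rewrite -sF inE negbK => /eqP.
Qed.

Lemma rho_far x : rho (coord x) * far (coord x) = 0.
Proof.
have := rho_ge0 x; rewrite le_eqVlt => /orP[/eqP <-|/far_eq0 ->]; first by rewrite mul0r.
by rewrite mulr0.
Qed.

Lemma disp2_ge0 (x : V -> R) : 0 <= disp2 x.
Proof. by apply: sumr_ge0 => j _; exact: sqr_ge0. Qed.

(** If all three summands vanished, the coordinates on the facet would be equal, with minimum 0 and
    sum 1. *)
Lemma den_gt0 x : 0 < den (coord x).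
Proof.
have d0 := disp2_ge0 (coord x); have f0 := far_ge0 x.
have r0 := rho_ge0 x.
have dge : 0 <= den (coord x).
  by apply: addr_ge0; [exact: addr_ge0|exact: sqr_ge0].
rewrite lt_neqAle dge andbT eq_sym; apply/eqP => den0.
have r2 : 0 <= rho (coord x) ^+ 2 by exact: sqr_ge0.
have : rho (coord x) ^+ 2 = 0 by move: den0; rewrite /den; lra.
have f00 : far (coord x) = 0 by move: den0; rewrite /den; lra.
have d00 : disp2 (coord x) = 0 by move: den0; rewrite /den; lra.
move=> /eqP; rewrite sqrf_eq0 mulf_eq0 pnatr_eq0 /= => /eqP dep0.
have [v vF dv] := depth_attained F0 (coord_le1 x).
have eqe j : coord x (e j) = coord x (e ord0).
  apply/eqP; rewrite -subr_eq0 -sqrf_eq0; apply/eqP.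
  by apply: (psumr_eq0P _ d00) => // i _; exact: sqr_ge0.
move/eqP: f00; rewrite subr_eq0 big1 ?oner_eq0// => j _; rewrite eqe.
by move/imsetP: vF dv => [k _ ->]; rewrite eqe dep0.
Qed.

Lemma facet_map_in x : facet_map (coord x) \in @sphere_set R m.
Proof.
apply/mem_set; rewrite /sphere_set /= (bigD1 ord0)//=.
have dn := den_gt0 x; have rf := rho_far x.
have -> : \sum_(i < m.+1 | i != ord0) facet_map (coord x) ord0 i ^+ 2 =
    4 * rho (coord x) ^+ 2 * disp2 (coord x) / den (coord x) ^+ 2.
  rewrite /disp2 mulr_sumr mulr_suml [RHS](bigD1 ord0)//= {1}/disp subrr expr0n.
  rewrite mulr0 mul0r add0r; apply: eq_bigr => i /negbTE i0.
  rewrite mxE i0; field; exact: lt0r_neq0.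
rewrite mxE eqxx.
(* The two sides differ by a multiple of [rho * far], which vanishes: where [rho] is positive, the
   support is the facet and no mass lies outside. *)
have e1 : (disp2 (coord x) + far (coord x) - rho (coord x) ^+ 2) ^+ 2 +
   4 * rho (coord x) ^+ 2 * disp2 (coord x) = den (coord x) ^+ 2.
  transitivity (den (coord x) ^+ 2 - 4 * rho (coord x) * (rho (coord x) * far (coord x))).
    by rewrite /den; ring.
  by rewrite rf mulr0 subr0.
by rewrite expr_div_n -mulrDl e1 divff// expf_neq0// lt0r_neq0.
Qed.

Definition facet_sphere x : sphere R m := SigSub (facet_map_in x).

Lemma cont_facet_sphere : continuous facet_sphere.
Proof.
apply: continuous_comp_initial; apply: cont_rV => j.
have cr : continuous (fun x => rho (coord x)).
  by apply: cont_mul; [exact: cont_cst|exact: cont_depth].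
have cd i : continuous (fun x => disp (coord x) i).
  by apply: cont_sub; exact: cont_coord.
have cd2 : continuous (fun x => disp2 (coord x)).
  by apply: cont_sum => i _; exact: cont_exp.
have cf : continuous (fun x => far (coord x)).
  by apply: cont_sub; [exact: cont_cst|apply: cont_sum => i _; exact: cont_coord].
have cr2 := @cont_exp _ _ _ 2 cr.
have cn : continuous (fun x => (den (coord x))^-1).
  apply: cont_inv; last by move=> x; exact/lt0r_neq0/den_gt0.
  by apply: cont_add => //; exact: cont_add.
rewrite /facet_sphere /=.
have [->|j0] := eqVneq j ord0.
  have -> : (fun x => facet_map (coord x) ord0 ord0) = (fun x =>
      (disp2 (coord x) + far (coord x) - rho (coord x) ^+ 2) * (den (coord x))^-1).
    by apply/funext => x; rewrite mxE eqxx.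
  by apply: cont_mul => //; apply: cont_sub => //; exact: cont_add.
have -> : (fun x => facet_map (coord x) ord0 j) = (fun x =>
    2 * rho (coord x) * disp (coord x) j * (den (coord x))^-1).
  by apply/funext => x; rewrite mxE (negbTE j0).
by do 2?apply: cont_mul => //; apply: cont_mul => //; exact: cont_cst.
Qed.

Lemma facet_sphere_base x : rho (coord x) = 0 -> facet_sphere x = sphere_base R m.
Proof.
move=> r0; apply: val_inj; apply/rowP => j; rewrite /= !mxE eqxx /=.
have dn := den_gt0 x; have [_|_] := eqVneq j ord0; last by rewrite r0 mulr0 !mul0r.
by move: dn; rewrite /den r0 expr0n /= addr0 subr0 => dn; rewrite divff// lt0r_neq0.
Qed.

Let pole x : val (facet_sphere x) ord0 ord0 = 1 - 2 * rho (coord x) ^+ 2 / den (coord x).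
Proof.
rewrite /= mxE eqxx; have dn := den_gt0 x.
have -> : disp2 (coord x) + far (coord x) = den (coord x) - rho (coord x) ^+ 2.
  by rewrite /den addrK.
by field; exact: lt0r_neq0.
Qed.

Lemma facet_sphere_nbase x : 0 < rho (coord x) -> facet_sphere x <> sphere_base R m.
Proof.
move=> r0 e0; have := pole x; rewrite e0 /= mxE !eqxx /= => /eqP.
rewrite eq_sym subr_eq -subr_eq0 opprD addNKr oppr_eq0 mulf_eq0 invr_eq0.
rewrite (gt_eqF (den_gt0 x)) orbF mulf_eq0 pnatr_eq0 sqrf_eq0 /=.
by rewrite gt_eqF.
Qed.

(* [zeta] is the point of [R^m] whose inverse stereographic image is taken. *)
Let zeta x j := disp (coord x) j / rho (coord x).

Let zeta_eq x y : 0 < rho (coord x) -> 0 < rho (coord y) ->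
  facet_sphere x = facet_sphere y -> zeta x =1 zeta y.
Proof.
have zE (u : realization R K) j : 0 < rho (coord u) -> j != ord0 ->
    zeta u j = val (facet_sphere u) ord0 j / (1 - val (facet_sphere u) ord0 ord0).
  move=> r0 j0; rewrite pole subKr /= mxE (negbTE j0) /zeta; have dn := den_gt0 u.
  by field; rewrite ?pnatr_eq0 !lt0r_neq0.
move=> rx ry exy j; have [->|j0] := eqVneq j ord0.
  by rewrite /zeta /disp !subrr !mul0r.
by rewrite !zE// exy.
Qed.

Let depth_min x : 0 < rho (coord x) ->
  (forall j, m.+1%:R^-1 <= coord x (e j) / rho (coord x)) /\
  exists j, coord x (e j) / rho (coord x) = m.+1%:R^-1.
Proof.
move=> r0; have m0 : (0 : R) < m.+1%:R by rewrite ltr0n.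
have e1 : m.+1%:R^-1 = depth F (coord x) / rho (coord x).
  have d0 : depth F (coord x) != 0.
    by move: r0; rewrite /rho; apply: contraTneq => ->; rewrite mulr0 ltxx.
  rewrite /rho; move: (lt0r_neq0 m0); move: (m.+1%:R) => N N0.
  by field; rewrite d0 N0.
split=> [j|]; first by rewrite e1 ler_pM2r ?invr_gt0// depth_le.
have [v /imsetP[j _ ->] dv] := depth_attained F0 (coord_le1 x).
by exists j; rewrite e1 dv.
Qed.

(** The sphere point determines [zeta], that is, the ratios of the coordinates to [rho] up to a
    common additive constant. The minimum of these ratios is always [m.+1%:R^-1], which fixes the
    constant, and total mass 1 then fixes [rho]. *)
Lemma facet_sphere_inj x y : 0 < rho (coord x) -> 0 < rho (coord y) ->
  facet_sphere x = facet_sphere y -> x = y.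
Proof.
move=> rx ry exy; have zxy := zeta_eq rx ry exy.
have cE (u : realization R K) j : 0 < rho (coord u) ->
    coord u (e j) / rho (coord u) = coord u (e ord0) / rho (coord u) + zeta u j.
  by move=> r0; rewrite /zeta /disp; field; exact: lt0r_neq0.
have le0 (u w : realization R K) : 0 < rho (coord u) -> 0 < rho (coord w) -> zeta u =1 zeta w ->
    coord u (e ord0) / rho (coord u) <= coord w (e ord0) / rho (coord w).
  move=> ru rw uw; have [_ [j uj]] := depth_min ru; have [wj _] := depth_min rw.
  by have := wj j; rewrite -uj (cE u j ru) (cE w j rw) uw lerD2r.
have e0 : coord x (e ord0) / rho (coord x) = coord y (e ord0) / rho (coord y).
  by apply/le_anti; rewrite !le0.
have ej j : coord x (e j) / rho (coord x) = coord y (e j) / rho (coord y).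
  by rewrite (cE x j rx) (cE y j ry) e0 zxy.
have s1 (u : realization R K) : 0 < rho (coord u) -> \sum_j coord u (e j) = 1.
  by move=> ru; have /eqP := far_eq0 ru; rewrite subr_eq0 => /eqP <-.
have er : rho (coord x) = rho (coord y).
  apply: invr_inj; rewrite -[LHS]mul1r -[RHS]mul1r -{1}(s1 _ rx) -(s1 _ ry).
  by rewrite !mulr_suml; apply: eq_bigr.
apply: coord_inj => v; have [/imsetP[j _ ->]|vF] := boolP (v \in F).
  by have := ej j; rewrite er => /mulIf; apply; rewrite invr_eq0 lt0r_neq0.
have z (u : realization R K) : 0 < rho (coord u) -> coord u v = 0.
  by move=> /rho_gt0P sF; move: vF; rewrite -sF inE negbK => /eqP.
by rewrite !z.
Qed.

Lemma facet_sphere_surj (w : sphere R m) : w <> sphere_base R m ->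
  exists2 x, 0 < rho (coord x) & facet_sphere x = w.
Proof.
move=> wN; pose t : R := val w ord0 ord0; pose u : R := 1 - t.
have w1 : t ^+ 2 + \sum_(j < m.+1 | j != ord0) val w ord0 j ^+ 2 = 1.
  by have := set_valP w; rewrite /sphere_set /= (bigD1 ord0).
pose W j : R := if j == ord0 then 0 else val w ord0 j.
have W2 : \sum_j W j ^+ 2 = 1 - t ^+ 2.
  rewrite -w1 [LHS](bigD1 ord0)//= /W eqxx expr0n add0r addrC addKr.
  by apply: eq_bigr => j /negbTE ->.
(* A pole coordinate equal to 1 would make all others vanish, and [w] would be the base point. *)
have u0 : 0 < u.
  have t1 : t <= 1.
    rewrite leNgt; apply/negP => t1; have : 1 < t ^+ 2 by rewrite expr_gt1// ltW// (lt_trans ltr01).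
    have : 0 <= \sum_j W j ^+ 2 by apply: sumr_ge0 => j _; exact: sqr_ge0.
    by rewrite W2 subr_ge0 leNgt => /negbTE ->.
  rewrite subr_gt0 lt_neqAle t1 andbT; apply/eqP => te; apply: wN.
  apply: val_inj; apply/rowP => j; rewrite [RHS]mxE eqxx /=.
  have [->|j0] := eqVneq j ord0; first by rewrite -[LHS]/t te.
  have W20 : \sum_j W j ^+ 2 = 0 by rewrite W2 te expr1n subrr.
  have Wj : W j ^+ 2 = 0.
    by apply: (psumr_eq0P _ W20) => // i _; exact: sqr_ge0.
  by move/eqP: Wj; rewrite sqrf_eq0 /W (negbTE j0) => /eqP.
pose j0 := [arg min_(j < (ord0 : 'I_m.+1)) W j]%O.
have Wmin j : W j0 <= W j.
  by rewrite /j0; case: arg_minP => // i _; apply.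
have q0 : (0 : R) < m.+1%:R by rewrite ltr0n.
(* By [depth_min] the ratio of the [j]-th coordinate to [rho] must be
   [1 / (m+1) + (W j - W j0) / u]. Clearing [u] gives the numerators of [c], and [T] is their
   sum. *)
pose T := u + \sum_j (W j - W j0).
have T0 : 0 < T by rewrite ltr_pwDl// sumr_ge0// => j _; rewrite subr_ge0.
pose c j := (u / m.+1%:R + W j - W j0) / T.
have c0 j : 0 < c j.
  by rewrite divr_gt0// -addrA ltr_pwDl ?divr_gt0// subr_ge0.
pose f v : R := \sum_(j | e j == v) c j.
have fe j : f (e j) = c j.
  by rewrite /f (eq_bigl (pred1 j)) ?big_pred1_eq// => i /=; rewrite (inj_eq e_inj).
have c1 : \sum_j c j = 1.
  rewrite -mulr_suml; under eq_bigr do rewrite -addrA.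
  rewrite big_split /= sumr_const card_ord -[(_ / _) *+ _]mulr_natr.
  by rewrite divfK ?lt0r_neq0// divff// lt0r_neq0.
have f_in : realization_set K f.
  apply: (@in_realization _ _ _ _ F) => //.
  - by move=> v; apply: sumr_ge0 => j _; exact: ltW.
  - by rewrite -c1 [RHS](partition_big e xpredT).
  - apply/subsetP => v; rewrite inE; apply: contraNT => vF.
    rewrite /f big1// => j /eqP ev; case/negP: vF; rewrite -ev; exact: eF.
pose x : realization R K := SigSub (mem_set f_in).
have xE j : coord x (e j) = c j by exact: fe.
have dE : depth F (coord x) = u / m.+1%:R / T.
  apply/le_anti/andP; split.
    have := depth_le (coord x) (eF j0); rewrite xE /c.
    by rewrite -addrA subrr addr0.
  have [v /imsetP[j _ ->] ->] := depth_attained F0 (coord_le1 x).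
  by rewrite xE ler_pM2r ?invr_gt0// -addrA lerDl subr_ge0.
have rE : rho (coord x) = u / T.
  rewrite /rho dE; move: (lt0r_neq0 q0); move: (m.+1%:R) => N N0.
  by field; rewrite N0 lt0r_neq0.
have r0 : 0 < rho (coord x) by rewrite rE divr_gt0.
have zE j : disp (coord x) j = W j / T.
  rewrite /disp !xE /c /W eqxx; move: (lt0r_neq0 q0); move: (m.+1%:R) => N N0.
  by field; rewrite N0 lt0r_neq0.
have d2E : disp2 (coord x) = (1 - t ^+ 2) / T ^+ 2.
  rewrite -W2 mulr_suml; apply: eq_bigr => j _.
  by rewrite zE expr_div_n.
have denE : den (coord x) = 2 * u / T ^+ 2.
  rewrite /den far_eq0// d2E rE /u; field; exact: lt0r_neq0.
exists x => //; apply: val_inj; apply/rowP => j.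
have un0 : 1 - t != 0 by exact: lt0r_neq0.
rewrite /= mxE; have [->|jN] := eqVneq j ord0.
  rewrite far_eq0// denE d2E rE -/t /u.
  by field; rewrite un0 lt0r_neq0.
rewrite denE rE zE /W (negbTE jN) /u.
by field; rewrite un0 lt0r_neq0.
Qed.

End Facet.

Section Totalize.
Variables (R : realType) (V : finType) (K : complex V).

(* [d] is the junk value taken outside the realization. *)
Definition tot (d : realization R K) (f : V -> R) : realization R K :=
  if pselect (realization_set K f) is left fK then SigSub (mem_set fK) else d.

Lemma coord_tot d f v : realization_set K f -> coord (tot d f) v = f v.
Proof. by rewrite /tot; case: pselect. Qed.

Lemma cont_tot (T : topologicalType) (D : set T) d (f : T -> V -> R) :
  (forall t, D t -> realization_set K (f t)) ->
  (forall v, continuous (fun t => f t v)) ->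
  {within D, continuous (fun t => tot d (f t))}.
Proof.
move=> fK cf; apply: (@cont_realization R V (subspace D)) => v.
apply: (@subspace_eq_continuous _ D _ (fun t => f t v)).
  by move=> t /set_mem Dt; rewrite /= coord_tot//; exact: fK.
exact: continuous_subspaceT.
Qed.

End Totalize.

(** * Collapsing the complement of several open facets onto a wedge of spheres *)

Section Facets.
Variables (R : realType) (V : finType) (K : complex V) (ms : seq nat).
Variable F : 'I_(size ms) -> {set V}.
Hypothesis F_inj : injective F.
Hypothesis FK : forall i, F i \in simplices K.
Hypothesis F_facet : forall i t, t \in simplices K -> F i \subset t -> t = F i.
Hypothesis F_card : forall i, #|F i| = (nth 0%N ms i).+1.
Variable i0 : 'I_(size ms).

Let L := avoid K [set F i | i in 'I_(size ms)]%SET.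

Hypothesis L_contr : contractible R (realization R L).

Let e (i : 'I_(size ms)) : 'I_(nth 0%N ms i).+1 -> V := fun j => enum_val (cast_ord (esym (F_card i)) j).

Let e_inj i : injective (@e i).
Proof. by move=> j k /enum_val_inj /cast_ord_inj. Qed.

Let eE i : [set @e i j | j in 'I_(nth 0%N ms i).+1]%SET = F i.
Proof.
apply/setP => v; apply/imsetP/idP => [[j _ ->]|vF]; first exact: enum_valP.
exists (cast_ord (F_card i) (enum_rank_in vF v)) => //.
by rewrite /e cast_ordK enum_rankK_in.
Qed.

Implicit Types x y : realization R K.

Let dp i x : R := depth (F i) (coord x).
Let ro i x : R := #|F i|%:R * dp i x.

Let roE i x : rho (@e i) (coord x) = ro i x.
Proof. by rewrite /rho eE -F_card. Qed.

Let eFK i : [set @e i j | j in 'I_(nth 0%N ms i).+1]%SET \in simplices K.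
Proof. by rewrite eE. Qed.

Let eF_facet i t : t \in simplices K ->
  [set @e i j | j in 'I_(nth 0%N ms i).+1]%SET \subset t ->
  t = [set @e i j | j in 'I_(nth 0%N ms i).+1]%SET.
Proof. by rewrite eE; exact: F_facet. Qed.

Let phi (i : 'I_(size ms)) x : sphere R (nth 0%N ms i) :=
  facet_sphere (@e_inj i) (@eF_facet i) x.

Let W := wedge_spheres R ms.

Let lift_ (i : 'I_(size ms)) : sphere R (nth 0%N ms i) -> W :=
  @wedge_lift _ _ (fun i : 'I_(size ms) => sphere_base R (nth 0%N ms i)) i.

Let base : W := lift_ (sphere_base R (nth 0%N ms i0)).

Let lift_base (i : 'I_(size ms)) : lift_ (sphere_base R (nth 0%N ms i)) = base.
Proof.
pose p (i : 'I_(size ms)) := sphere_base R (nth 0%N ms i).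
exact: (@wedge_liftE _ _ p i0 (p i0) i (p i)).
Qed.

(** The canonical map from the wedge to the product separates the spheres: its [i]-th component
    sends every other sphere to the base point. *)
Let lift_inj (i j : 'I_(size ms)) (a : sphere R (nth 0%N ms i)) (b : sphere R (nth 0%N ms j)) :
  a <> sphere_base R _ -> lift_ a = lift_ b ->
  existT (fun i : 'I_(size ms) => sphere R (nth 0%N ms i) : Type) i a =
  existT _ j b.
Proof.
move=> a0 /(congr1 (@wedge_prod _ _ _)).
rewrite /wedge_prod /lift_ !wedge_lift_funE; try exact: wedge_prod_pointE.
move=> /(congr1 (fun f => f i)); rewrite dfwithin.
have [ij|ij] := eqVneq j i; last by rewrite dfwithout// => /a0.
by case: _ / ij a a0 => a a0; rewrite dfwithin => ->.
Qed.

Let dp_ge0 i x : 0 <= dp i x.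
Proof. by apply: depth_ge0 => v; exact: coord_ge0. Qed.

Let ro_ge0 i x : 0 <= ro i x.
Proof. by rewrite mulr_ge0. Qed.

Let ro_gt0P i x : reflect (supp (coord x) = F i) (0 < ro i x).
Proof.
have := rho_gt0P (@eF_facet i) x; rewrite roE eE; exact.
Qed.

Let ro_unique i j x : 0 < ro i x -> j != i -> ro j x = 0.
Proof.
move=> /ro_gt0P si ji; apply/eqP; apply: contraNT ji => rj.
have /ro_gt0P sj : 0 < ro j x by rewrite lt_neqAle ro_ge0 eq_sym rj.
by apply/eqP/F_inj; rewrite -si -sj.
Qed.

Let Phi x : W := if [pick i | 0 < ro i x] is Some i then lift_ (phi i x) else base.

Let Phi_in i x : 0 < ro i x -> Phi x = lift_ (phi i x).
Proof.
rewrite /Phi => ri; case: pickP => [j rj|/(_ i)]; last by rewrite ri.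
have [->//|ji] := eqVneq j i.
by move: rj; rewrite (ro_unique ri ji) ltxx.
Qed.

Let A := [set x | forall i, ro i x = 0].

Let A_or x : A x \/ exists i, 0 < ro i x.
Proof.
have [/forallP h|] := boolP [forall i, ro i x == 0].
  by left=> i; apply/eqP.
by rewrite negb_forall => /existsP[i ri]; right; exists i; rewrite lt_neqAle ro_ge0 eq_sym ri.
Qed.

Let Phi_out x : A x -> Phi x = base.
Proof.
by rewrite /Phi => Ax; case: pickP => // i; rewrite Ax ltxx.
Qed.

Let phi_base i x : ro i x = 0 -> phi i x = sphere_base R _.
Proof. by rewrite -roE => h; exact: facet_sphere_base. Qed.

Let phi_nbase i x : 0 < ro i x -> phi i x <> sphere_base R _.
Proof. by rewrite -roE => h; exact: facet_sphere_nbase. Qed.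

Let cont_phi i : continuous (phi i).
Proof. exact: cont_facet_sphere. Qed.

Let cont_lift_ i : continuous (@lift_ i).
Proof. by move=> x; exact: wedge_lift_continuous. Qed.

Let cont_dp i : continuous (dp i).
Proof. exact: cont_depth. Qed.

Let cont_ro i : continuous (ro i).
Proof. by apply: cont_mul; [exact: cont_cst|exact: cont_dp]. Qed.

(** Near a point of an open facet [Phi] is one of the sphere maps. At a point of [A] all sphere maps
    take the base value, so a common neighbourhood for the finitely many of them works, whichever
    applies nearby. *)
Let cont_Phi : continuous Phi.
Proof.
move=> x U; have cl i : continuous (fun y => lift_ (phi i y)).
  exact: cont_comp (@cont_phi i) (@cont_lift_ i).
have [Ax|[i ri]] := A_or x.
  rewrite (Phi_out Ax) => nU.
  have : nbhs x [set y | forall i, U (lift_ (phi i y))].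
    apply: (@filter_forall _ _ (fun i y => U (lift_ (phi i y))) (nbhs x) _) => i.
    apply: (cl i x U).
    by rewrite phi_base ?lift_base.
  apply: filterS => y hy; rewrite /= .
  have [Ay|[i ri]] := A_or y; last by rewrite (Phi_in ri).
  by rewrite (Phi_out Ay) -(lift_base i0) -(phi_base (Ay i0)).
rewrite (Phi_in ri) => nU.
have : nbhs x [set y | 0 < ro i y].
  apply: (@cont_ro i x [set r | 0 < r]); exact: (lt_nbhsr ri).
move=> nr; have nP : nbhs x [set y | U (lift_ (phi i y))] := cl i x U nU.
have : nbhs x ([set y | 0 < ro i y] `&` [set y | U (lift_ (phi i y))]).
  exact: filterI.
apply: filterS => y [ry Uy].
by rewrite /= (Phi_in ry).
Qed.

Let Phi_inj x y : Phi x = Phi y -> x = y \/ (A x /\ A y).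
Proof.
wlog [i ri] : x y / exists i, 0 < ro i x.
  move=> h; have [Ax|rx] := A_or x; last exact: h.
  have [Ay|ry] := A_or y; first by right.
  by move=> xy; have [->|[? ?]] := h _ _ ry (esym xy); [left|right].
rewrite (Phi_in ri); have [Ay|[j rj]] := A_or y.
  rewrite (Phi_out Ay) -(lift_base i) => /(lift_inj (phi_nbase ri)) /eqP.
  by rewrite eq_Tagged /= => /eqP /(phi_nbase ri).
rewrite (Phi_in rj) => /(lift_inj (phi_nbase ri)) E; left.
have ij := congr1 (@projT1 _ _) E; rewrite /= in ij.
case: _ / ij rj E => rj /eqP; rewrite eq_Tagged /= => /eqP E.
by move: ri rj E; rewrite -!roE; exact: facet_sphere_inj.
Qed.

Let sphere_hausdorff m : hausdorff_space (sphere R m).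
Proof.
apply: hausdorff_set_type; apply: hausdorff_separated => x y ne.
have [j xy] : exists j, x ord0 j <> y ord0 j.
  by apply: contrapT => /forallNP h; apply: ne; apply/rowP => j; apply: contrapT; exact: h.
exists R, (fun z : 'rV[R]_m.+1 => z ord0 j); split=> //.
exact: coord_continuous.
Qed.

Let cardF_gt0 i : (0 : R) < #|F i|%:R.
Proof. by rewrite ltr0n F_card. Qed.

Let ro_dp i x : ro i x = 0 -> dp i x = 0.
Proof. by move/eqP; rewrite mulf_eq0 gt_eqF// => /eqP. Qed.

Let sum_out x (G : 'I_(size ms) -> R) : A x ->
  (forall i, ro i x = 0 -> G i = 0) -> \sum_i G i = 0.
Proof. by move=> Ax h; apply: big1 => i _; exact: h. Qed.

Let sum_in i x (G : 'I_(size ms) -> R) : 0 < ro i x ->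
  (forall i, ro i x = 0 -> G i = 0) -> \sum_i G i = G i.
Proof.
move=> ri h; rewrite (bigD1 i)//= big1 ?addr0// => j ji.
by apply: h; exact: ro_unique ri ji.
Qed.

(** In the open facet [F i] a point splits into the mass [ro i] spread evenly over [F i], which is
    [Bv], and a rest supported on a proper face. Thus [rs] is a radial coordinate, 0 on [A] and 1 at
    the barycentres, and [yv] is the radial projection to the boundary; the maximum matters only
    where [rs] exceeds [2^-1] and keeps the division continuous. The map [hv] stretches the part
    [1 - d <= rs] of a facet radially over the whole facet. *)
Let Bv x v : R := \sum_i dp i x * (v \in F i)%:R.
Let rs x : R := \sum_i ro i x.
Let yv x v : R := (coord x v - Bv x v) / Num.max (1 - rs x) 2^-1.
Let hv x (d : R) v : R := (coord x v - Bv x v) / d +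
  \sum_i Num.max 0 (ro i x - (1 - d)) / d / #|F i|%:R * (v \in F i)%:R.

Let Bv_le x v : Bv x v <= coord x v.
Proof.
have h i : ro i x = 0 -> dp i x * (v \in F i)%:R = 0 by move/ro_dp ->; rewrite mul0r.
have [Ax|[i ri]] := A_or x; first by rewrite /Bv (sum_out Ax h) coord_ge0.
rewrite /Bv (sum_in ri h); case: (boolP (v \in F i)) => vF.
  by rewrite mulr1 depth_le.
by rewrite mulr0 coord_ge0.
Qed.

Let Bv_ge0 x v : 0 <= Bv x v.
Proof. by apply: sumr_ge0 => i _; rewrite mulr_ge0. Qed.

Let rs_ge0 x : 0 <= rs x.
Proof. exact: sumr_ge0. Qed.

Let sum_mem i : \sum_v (v \in F i)%:R = #|F i|%:R :> R.
Proof.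
rewrite -sum1_card natr_sum [RHS]big_mkcond; apply: eq_bigr => v _.
by case: (v \in F i).
Qed.

Let Bv_sum x : \sum_v Bv x v = rs x.
Proof.
rewrite exchange_big /=; apply: eq_bigr => i _.
by rewrite -mulr_sumr sum_mem mulrC.
Qed.

Let yv_in x : rs x <= 2^-1 -> realization_set L (yv x).
Proof.
move=> rx; have M : Num.max (1 - rs x) 2^-1 = 1 - rs x.
  by apply: max_l; rewrite lerBrDr -lerBrDl; apply: le_trans rx _; lra.
have M0 : 0 < 1 - rs x by rewrite subr_gt0; apply: le_lt_trans rx _; lra.
have sub : supp (yv x) \subset supp (coord x).
  apply/subsetP => v; rewrite !inE; apply: contraNneq => xv.
  have := Bv_le x v; have := Bv_ge0 x v; rewrite /yv xv => b0 b1.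
  by have -> : Bv x v = 0 by [apply/le_anti; rewrite b0 b1]; rewrite subrr mul0r.
have [y0 y1 yK] : realization_set K (yv x).
  apply: (in_realization _ _ sub); last exact: coord_supp.
    move=> v; rewrite /yv M; apply: divr_ge0; last exact: ltW.
    by rewrite subr_ge0 Bv_le.
  by rewrite -mulr_suml sumrB coord_sum Bv_sum M divff// lt0r_neq0.
split=> //; apply/avoidP; split=> // _ /imsetP[i _ ->]; apply/negP => Fy.
have sx := F_facet (coord_supp x) (fintype.subset_trans Fy sub).
have /ro_gt0P ri := sx.
have F0 : F i != finset.set0 by rewrite -card_gt0 F_card.
have [v vF dv] := depth_attained F0 (coord_le1 x).
have := subsetP Fy v vF; rewrite inE => /negP; apply; apply/eqP.
have h j : ro j x = 0 -> dp j x * (v \in F j)%:R = 0 by move/ro_dp ->; rewrite mul0r.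
by rewrite /yv /Bv (sum_in ri h) vF mulr1 /dp dv subrr mul0r.
Qed.

Let hv_in x (d : R) : 2^-1 <= d -> d <= 1 -> 1 - d <= rs x ->
  realization_set K (hv x d).
Proof.
move=> d2 d1 rd; have d0 : 0 < d by apply: lt_le_trans d2; rewrite invr_gt0.
have m0 i : ro i x = 0 -> Num.max 0 (ro i x - (1 - d)) = 0.
  by move=> ->; rewrite max_l// sub0r oppr_le0 subr_ge0.
apply: (@in_realization _ _ _ _ (supp (coord x))); last exact: coord_supp.
- move=> v; apply: addr_ge0; first by rewrite divr_ge0 ?subr_ge0 ?Bv_le// ltW.
  apply: sumr_ge0 => i _; apply: mulr_ge0 => //; apply: divr_ge0 => //.
  by apply: divr_ge0; [rewrite le_max lexx|exact: ltW].
- rewrite big_split /= -mulr_suml sumrB coord_sum Bv_sum exchange_big /=.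
  have -> : \sum_(i < size ms) \sum_v
      Num.max 0 (ro i x - (1 - d)) / d / #|F i|%:R * (v \in F i)%:R =
      \sum_i Num.max 0 (ro i x - (1 - d)) / d.
    apply: eq_bigr => i _; rewrite -mulr_sumr sum_mem divfK// lt0r_neq0//.
  have h i : ro i x = 0 -> Num.max 0 (ro i x - (1 - d)) / d = 0.
    by move=> /m0 ->; rewrite mul0r.
  have [Ax|[i ri]] := A_or x.
    (* Outside the open facets the hypothesis [1 - d <= rs x] forces [d = 1]. *)
    have r0 : rs x = 0 by rewrite /rs (sum_out Ax).
    rewrite (sum_out Ax h) r0 subr0 addr0.
    have -> : d = 1 by apply/le_anti; rewrite d1 -subr_le0 -r0.
    by rewrite divr1.
  have r1 : rs x = ro i x by rewrite /rs (sum_in ri).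
  rewrite (sum_in ri h) max_r; last by rewrite -r1 subr_ge0.
  by rewrite r1; field; exact: lt0r_neq0.
- apply/subsetP => v; rewrite !inE; apply: contraNneq => xv.
  have := Bv_le x v; have := Bv_ge0 x v; rewrite /hv xv => b0 b1.
  have -> : Bv x v = 0 by apply/le_anti; rewrite b0 b1.
  rewrite subrr mul0r add0r big1// => i _.
  have := ro_ge0 i x; rewrite le_eqVlt => /orP[/eqP/esym/m0 ->|/ro_gt0P sx].
    by rewrite !mul0r.
  by rewrite -sx inE xv eqxx mulr0.
Qed.

Let cont_Bv v : continuous (fun x => Bv x v).
Proof.
by apply: cont_sum => i _; apply: cont_mul; [exact: cont_dp|exact: cont_cst].
Qed.

Let cont_rs : continuous rs.
Proof. by apply: cont_sum => i _; exact: cont_ro. Qed.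

Let cont_yv v : continuous (fun x => yv x v).
Proof.
apply: cont_mul; first by apply: cont_sub; [exact: cont_coord|exact: cont_Bv].
apply: cont_inv.
  by apply: cont_max; [apply: cont_sub; [exact: cont_cst|exact: cont_rs]|exact: cont_cst].
by move=> x; rewrite lt0r_neq0// lt_max invr_gt0 ltr0n orbT.
Qed.

(** The collar [rs <= 1 - dd s] has width [2^-1] at time 0, where [yv] is still a radial projection,
    and has shrunk onto [A] at time 1. *)
Let dd (s : R) : R := (1 + clamp s) / 2.

Let dd_ge s : 2^-1 <= dd s.
Proof. by rewrite /dd -[leLHS]mul1r ler_pM2r ?invr_gt0// lerDl clamp_ge0. Qed.

Let dd_le s : dd s <= 1.
Proof. by rewrite /dd; have := clamp_le1 s; lra. Qed.

Let dd1 : dd 1 = 1. Proof. by rewrite /dd clamp1 divff. Qed.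

Let cont_dd : continuous dd.
Proof.
apply: cont_mul; last exact: cont_cst.
by apply: cont_add; [exact: cont_cst|exact: clamp_continuous].
Qed.

Let cont_hv v : continuous (fun z : realization R K * R => hv z.1 (dd z.2) v).
Proof.
have cd : continuous (fun z : realization R K * R => dd z.2).
  exact: cont_comp (@cont_snd _ _) cont_dd.
have cdV : continuous (fun z : realization R K * R => (dd z.2)^-1).
  apply: cont_inv => // z; rewrite lt0r_neq0//.
  by apply: lt_le_trans (dd_ge _); rewrite invr_gt0.
have c1 (f : realization R K -> R) : continuous f ->
    continuous (fun z : realization R K * R => f z.1).
  by move=> cf; exact: cont_comp (@cont_fst _ _) cf.
apply: cont_add.
  apply: cont_mul => //; apply: (c1 (fun x => coord x v - Bv x v)).
  by apply: cont_sub; [exact: cont_coord|exact: cont_Bv].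
apply: cont_sum => i _; apply: cont_mul; last exact: cont_cst.
apply: cont_mul; last exact: cont_cst.
apply: cont_mul => //; apply: cont_max; first exact: cont_cst.
apply: cont_sub; first exact: (c1 (ro i)).
by apply: cont_sub => //; exact: cont_cst.
Qed.

Let incl : realization R L -> realization R K := lift (@avoid_in R V K _).

Let cont_incl : continuous incl.
Proof. by apply: cont_lift => v; exact: cont_coord. Qed.

Let A_incl z : A (incl z).
Proof.
move=> i; apply/eqP; apply/negPn/negP => ri.
have /ro_gt0P sF : 0 < ro i (incl z) by rewrite lt_neqAle ro_ge0 eq_sym ri.
have /avoidP[_ /(_ (F i))] := coord_supp z.
by rewrite imset_f// => /(_ isT); rewrite -sF fintype.subxx.
Qed.

Lemma wedge_of_facets : homotopy_equivalent R (realization R K) W.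
Proof.
have [p /homotopicP[H [cH H0 H1]]] := L_contr.
pose yt x : realization R L := tot p (yv x).
(* The time at which [H] is read grows from [clamp s] on [A] to 1 on the inner edge of the collar.
   There [H] is the identity, so [h1] matches the stretched facet [h2]. *)
pose h1 (z : realization R K * R) := incl (H (yt z.1, 2 * dd z.2 - 1 + 2 * rs z.1)).
pose h2 (z : realization R K * R) := tot (incl p) (hv z.1 (dd z.2)).
pose h z := if rs z.1 <= 1 - dd z.2 then h1 z else h2 z.
have yt_out x : A x -> incl (yt x) = x.
  move=> Ax; have r0 : rs x = 0 by rewrite /rs (sum_out Ax).
  apply: coord_inj => v; rewrite coord_lift coord_tot; last first.
    by apply: yv_in; rewrite r0 invr_ge0.
  rewrite /yv r0 subr0 max_l; last by lra.
  rewrite /Bv (sum_out Ax) ?subr0 ?divr1// => i /ro_dp ->.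
  by rewrite mul0r.
have h_out x s : A x -> h (x, s) = incl (H (yt x, clamp s)).
  move=> Ax; have r0 : rs x = 0 by rewrite /rs (sum_out Ax).
  rewrite /h /= r0 subr_ge0 dd_le /h1 /= r0 mulr0 addr0.
  by have -> : 2 * dd s - 1 = clamp s by rewrite /dd; field.
have crs : continuous (fun z : realization R K * R => rs z.1).
  exact: cont_comp (@cont_fst _ _) cont_rs.
have cdd : continuous (fun z : realization R K * R => dd z.2).
  exact: cont_comp (@cont_snd _ _) cont_dd.
have c1dd : continuous (fun z : realization R K * R => 1 - dd z.2).
  by apply: cont_sub => //; exact: cont_cst.
have ch : continuous h.
  apply: (@continuous_paste _ _ [set z | rs z.1 <= 1 - dd z.2]
    [set z | 1 - dd z.2 <= rs z.1] h h1 h2).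
  - exact: closed_le_cont.
  - exact: closed_le_cont.
  - by move=> z /=; case: (leP (rs z.1) (1 - dd z.2)) => [|/ltW]; [left|right].
  - by move=> z /set_mem /=; rewrite /h => ->.
  - move=> z /set_mem /= zr; rewrite /h; case: ifP => // zr'.
    have re : rs z.1 = 1 - dd z.2 by apply/le_anti; rewrite zr zr'.
    have d2 := dd_ge z.2; have d1 := dd_le z.2.
    rewrite /h1 re.
    have -> : 2 * dd z.2 - 1 + 2 * (1 - dd z.2) = 1 by ring.
    rewrite H1; apply: coord_inj => v; rewrite coord_lift !coord_tot; first last.
    + by apply: yv_in; rewrite re; lra.
    + exact: hv_in.
    rewrite /yv /hv re subKr max_l// big1 ?addr0// => i _.
    rewrite max_l ?mul0r// subr_le0 -re /rs (bigD1 i)//= lerDl.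
    exact: sumr_ge0.
  - set D := [set z | _].
    pose f1 : subspace D -> realization R L * R :=
      fun z => (yt z.1, 2 * dd z.2 - 1 + 2 * rs z.1).
    have cf1 : continuous f1.
      apply: cont_pair.
        apply: (@cont_tot _ _ _ _ D p (fun z => yv z.1)) => [z /= zD|v].
          by apply: yv_in; apply: le_trans zD _; have := dd_ge z.2; lra.
        exact: cont_comp (@cont_fst _ _) (@cont_yv v).
      apply: continuous_subspaceT; apply: cont_add.
        by apply: cont_sub; [apply: cont_mul => //; exact: cont_cst|exact: cont_cst].
      by apply: cont_mul => //; exact: cont_cst.
    have cH1 : continuous (fun z : subspace D => H (f1 z)) by exact: cont_comp cf1 cH.
    by have := @cont_comp (subspace D) _ _ _ incl cH1 cont_incl.
  - apply: cont_tot => [z /= zr|v]; last exact: cont_hv.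
    exact: hv_in (dd_ge _) (dd_le _) zr.
apply: (@quotient_equivalent R (realization R K) W A Phi h (incl p)) => //.
- exact: realization_compact.
- apply: wedge_hausdorff => i; exact: sphere_hausdorff.
- move=> w.
  have [z0 Az0] : exists z, A z by exists (incl p); exact: A_incl.
  have [i [a <-]] : exists (i : 'I_(size ms)) (a : sphere R (nth 0%N ms i)), lift_ a = w.
    have : (\bigcup_(i : 'I_(size ms)) (@lift_ i) @` [set: sphere R (nth 0%N ms i)]) w.
      by rewrite wedgeTE.
    by move=> [i _ [a _ <-]]; exists i, a.
  have [->|/eqP a0] := eqVneq a (sphere_base R (nth 0%N ms i)).
    by exists z0; rewrite lift_base Phi_out.
  have [x rx xa] := facet_sphere_surj (@e_inj i) (eFK i) (@eF_facet i) a0.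
  by exists x; rewrite (@Phi_in i) -?roE// /phi xa.
- by move=> x x' Ax Ax'; rewrite !Phi_out.
- move=> x; rewrite /h /= dd1 subrr; case: ifP => rx.
    have r0 : rs x = 0 by apply/le_anti; rewrite rx rs_ge0.
    have Ax : A x.
      move=> i; have /eqP := r0; rewrite /rs psumr_eq0// => /allP /(_ i).
      by rewrite mem_index_enum => /(_ isT) /eqP.
    by have := h_out x 1 Ax; rewrite /h /= dd1 subrr rx clamp1 H1 yt_out.
  apply: coord_inj => v; rewrite coord_tot /=; last first.
    by rewrite dd1; apply: hv_in => //; [lra|rewrite subrr].
  rewrite /hv dd1 subrr divr1 /Bv.
  suff -> : \sum_i Num.max 0 (ro i x - 0) / 1 / #|F i|%:R * (v \in F i)%:R =
      \sum_i dp i x * (v \in F i)%:R by rewrite subrK.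
  apply: eq_bigr => i _; rewrite subr0 max_r// divr1 /ro [_ * dp i x]mulrC mulfK//.
  exact: lt0r_neq0.
- by move=> x Ax; rewrite h_out// clamp0 H0.
- by move=> x s Ax; rewrite h_out//; exact: A_incl.
Qed.

End Facets.

Local Close Scope classical_set_scope.

(** * Strips of triangles *)

Lemma wedge_of_facet_seq (R : realType) (V : finType) (K : complex V)
    (Fs : seq {set V}) : uniq Fs -> Fs != [::] ->
  (forall F, F \in Fs -> F \in simplices K) ->
  (forall F t, F \in Fs -> t \in simplices K -> F \subset t -> t = F) ->
  contractible R (realization R (avoid K [set F in Fs]%SET)) ->
  homotopy_equivalent R (realization R K)
    (wedge_spheres R [seq #|(F : {set V})|.-1 | F <- Fs]).
Proof.
move=> uFs Fs0 FK Fmax Lc; set ms := map _ _.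
have sz : size ms = size Fs by rewrite size_map.
pose F (i : 'I_(size ms)) := nth finset.set0 Fs i.
have inF i : F i \in Fs by rewrite mem_nth// -sz.
have ms0 : (0 < size ms)%N by rewrite sz; case: (Fs) Fs0.
apply: (@wedge_of_facets _ _ _ _ F) => [i j /eqP|i|i t|i||].
- by rewrite nth_uniq -?sz// => /eqP /val_inj.
- exact: FK.
- exact: Fmax.
- rewrite (nth_map finset.set0) -?sz// prednK// card_gt0.
  by apply: contraNneq (complex_nonempty K) => <-; exact: FK (inF i).
- exact: Ordinal ms0.
- have -> : [set F i | i in 'I_(size ms)]%SET = [set F in Fs]%SET; last by [].
  apply/setP => G; rewrite inE; apply/imsetP/idP => [[i _ ->]|GFs]; first exact: inF.
  have GI : (index G Fs < size ms)%N by rewrite sz index_mem.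
  by exists (Ordinal GI) => //; rewrite /F nth_index.
Qed.

Lemma ordS_val n (i : 'I_n) : (ordS i : nat) = if i.+1 == n then 0%N else i.+1.
Proof.
rewrite /=; case: eqP => [->|ne]; first by rewrite modnn.
by rewrite modn_small// ltn_neqAle; apply/andP; split; [exact/eqP|exact: ltn_ord].
Qed.

Lemma ordS_neq n (i : 'I_n) : (2 <= n)%N -> (ordS i == i) = false.
Proof.
move=> n2; apply/eqP => /(congr1 (@nat_of_ord n)); rewrite ordS_val.
by have := ltn_ord i; case: ifP; lia.
Qed.

Section Strip.
Variables (R : realType) (n : nat) (a0 : 'I_n) (K : complex (bool * 'I_n)%type).
Hypothesis n3 : (3 <= n)%N.

Let c (a : 'I_n) : bool * 'I_n := (true, a).
Let d (a : 'I_n) : bool * 'I_n := (false, a).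

Hypothesis K_mixed : forall t a e, t \in simplices K -> c a \in t -> d e \in t ->
  e = a \/ e = ordS a.
Hypothesis K_upper : forall a, [set c a; c (ordS a); d (ordS a)] \in simplices K.
Hypothesis K_lower : forall a, [set c a; d a; d (ordS a)] \in simplices K.
Hypothesis K_cone : forall t b, t \in simplices K ->
  (forall e, (~~ b, e) \notin t) -> (b, a0) |: t \in simplices K.

Let T0 : {set bool * 'I_n} := [set c a0; d a0; d (ordS a0)].

(** The number of steps of [ordS] from [a0] to [a]: the position along the annulus cut at [a0]. *)
Let u (a : 'I_n) : nat := if (a0 <= a)%N then (a - a0)%N else (a + n - a0)%N.

Let uS a : ordS a != a0 -> u (ordS a) = (u a).+1.
Proof.
move=> h; have hv : (ordS a : nat) <> a0 by move=> e; case/eqP: h; exact: val_inj.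
move: hv; rewrite /u ordS_val; have := ltn_ord a; have := ltn_ord a0.
by repeat case: ifP; lia.
Qed.

Let neS (a : 'I_n) : (ordS a == a) = false.
Proof. exact/ordS_neq/ltnW. Qed.

(** For [i] in [I0] these are the mixed edges other than the one joining [c a0] and [d a0], each
    with the third vertex [ap i] of the next triangle around the annulus. Removing [T0] frees the
    edge of rank 0; each triangle removed with its edge frees the following edge, and [rk] lists the
    edges in this order. *)
Let st (i : bool * 'I_n) : {set bool * 'I_n} :=
  if i.1 then [set c i.2; d (ordS i.2)] else [set c i.2; d i.2].
Let ap (i : bool * 'I_n) : bool * 'I_n :=
  if i.1 then c (ordS i.2) else d (ordS i.2).
Let rk (i : bool * 'I_n) : nat := if i.1 then (u i.2).*2 else (u i.2).*2.-1.
Let I0 : {set bool * 'I_n} := [set~ (false, a0)].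

Let K1 := avoid K [set T0]%SET.

Let stP i (t : {set bool * 'I_n}) : (st i \subset t) =
  (c i.2 \in t) && (d (if i.1 then ordS i.2 else i.2) \in t).
Proof. by rewrite /st; case: ifP => _; rewrite subUset !sub1set. Qed.

Let T0P (t : {set bool * 'I_n}) :
  (T0 \subset t) = [&& c a0 \in t, d a0 \in t & d (ordS a0) \in t].
Proof. by rewrite !subUset !sub1set andbA. Qed.

Let u_gt0 a : a != a0 -> (0 < u a)%N.
Proof.
move=> h; have hv : (a : nat) <> a0 by move=> e; case/eqP: h; exact: val_inj.
move: hv; rewrite /u; have := ltn_ord a; have := ltn_ord a0.
by case: ifP; lia.
Qed.

(** At the turn of an edge the triangle before it is gone, so every simplex containing the edge lies
    in the triangle after it. *)
Let strip_step i t : i \in I0 -> t \in simplices K1 -> st i \subset t ->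
  (forall j, j \in I0 -> (rk j < rk i)%N -> ~~ (st j \subset t)) ->
  ap i |: t \in simplices K1 /\
  forall j, j \in I0 -> (rk j <= rk i)%N -> st j \subset ap i |: t -> st j \subset t.
Proof.
case: i => -[] a iI /avoidP[tK /(_ T0)]; rewrite inE eqxx => /(_ isT) tT.
  rewrite stP /= => /andP[ca dSa] low.
  have da : d a \notin t.
    have [aa|aa] := eqVneq a a0.
      by move: tT; rewrite T0P -aa ca dSa andbT.
    have := low (false, a); rewrite stP /= ca; apply.
      by rewrite !inE xpair_eqE.
    by rewrite /rk /=; have := u_gt0 aa; lia.
  have tc x : c x \in t -> x = a \/ x = ordS a.
    by move=> cx; have [->|/ordS_inj ->] := K_mixed tK cx dSa; [right|left].
  have td y : d y \in t -> y = ordS a.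
    by move=> dy; have [ya|//] := K_mixed tK ca dy; rewrite -ya dy in da.
  have -> : ap (true, a) |: t = [set c a; c (ordS a); d (ordS a)].
    apply/setP => -[b x]; rewrite !inE /ap /=; apply/orP/idP.
      case=> [->|]; first by rewrite orbT.
      case: b => [/tc[]->|/td ->]; by rewrite eqxx ?orbT.
    case/orP => [/orP[]|] /eqP ->; by [right|left].
  split.
    apply/avoidP; split=> // _ /set1P ->; apply/negP; rewrite T0P => /and3P[_].
    rewrite !inE /= !xpair_eqE /= => /eqP e1 /eqP e2.
    by move: (neS a0); rewrite e2 -e1 eqxx.
  move=> -[[] x] jI; rewrite /rk /= !stP /= !inE !xpair_eqE /= ?orbF => xr.
    by case/andP=> _ /eqP /ordS_inj ->; rewrite ca dSa.
  case/andP=> _ /eqP xe; move: jI xr; rewrite !inE xpair_eqE /= xe => xa.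
  by rewrite uS//; lia.
rewrite stP /= => /andP[ca da] low.
have aa : a != a0 by move: iI; rewrite !inE xpair_eqE.
have tc x : c x \in t -> x = a.
  move=> cx; have [->//|ax] := K_mixed tK cx da.
  have := low (true, x); rewrite stP /= cx -ax da /= !inE xpair_eqE /=.
  have uE : u a = (u x).+1 by rewrite ax uS// -ax.
  rewrite /rk /= uE => /(_ isT) h.
  by have /h : ((u x).*2 < (u x).+1.*2.-1)%N by lia.
have td y : d y \in t -> y = a \/ y = ordS a by exact: K_mixed tK ca.
have -> : ap (false, a) |: t = [set c a; d a; d (ordS a)].
  apply/setP => -[b x]; rewrite !inE /ap /=; apply/orP/idP.
    case=> [->|]; first by rewrite orbT.
    case: b => [/tc ->|/td[] ->]; by rewrite eqxx ?orbT.
  case/orP => [/orP[]|] /eqP ->; by [right|left].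
split.
  apply/avoidP; split=> // _ /set1P ->; apply/negP; rewrite T0P => /and3P[+ _ _].
  by rewrite !inE /= !xpair_eqE /= !orbF eq_sym (negbTE aa).
move=> -[[] x] jI; rewrite /rk /= !stP /= !inE !xpair_eqE /= ?orbF => xr.
  by case/andP=> /eqP xa _; move: xr; rewrite xa; have := u_gt0 aa; lia.
by case/andP=> /eqP -> _; rewrite ca da.
Qed.

Let K2 := avoid K1 (st @: I0).

Let K2_mono t a e : t \in simplices K2 -> c a \in t -> d e \in t ->
  a = a0 /\ e = a0.
Proof.
move=> /avoidP[/avoidP[tK _] tS] ca de.
have [ea|ea] := K_mixed tK ca de; last first.
  have /tS : st (true, a) \in st @: I0 by apply: imset_f; rewrite !inE xpair_eqE.
  by rewrite stP /= ca -ea de.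
have [aa|aa] := eqVneq a a0; first by rewrite ea aa.
have /tS : st (false, a) \in st @: I0 by apply: imset_f; rewrite !inE xpair_eqE.
by rewrite stP /= ca -ea de.
Qed.

Let I1 : {set bool * 'I_n} := [set i | i.2 != a0].

Let K2_avoid b t : t \in simplices K -> (forall e, (~~ b, e) \notin t) ->
  t \in simplices K2.
Proof.
move=> tK tb; apply/avoidP; split.
  apply/avoidP; split=> // _ /set1P ->; rewrite T0P.
  by case: b tb => tb; have := tb a0; rewrite /= => /negbTE; rewrite /c /d => ->; rewrite ?andbF.
move=> _ /imsetP[i _ ->]; rewrite stP.
by case: b tb => tb; rewrite /c /d (negbTE (tb _)) ?andbF.
Qed.

Lemma strip_contractible : contractible R (realization R (avoid K [set T0]%SET)).
Proof.
apply: (contractible_equiv (Y := realization R K2)).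
  apply: (collapse R (c := ap) (rk := rk)) => [i iI|i iI|]; last exact: strip_step.
    by apply/set0Pn; exists (c i.2); rewrite /st; case: ifP; rewrite !inE eqxx.
  rewrite /ap /st; case: ifP => _; rewrite !inE !xpair_eqE /= ?orbF ?neS//.
(* The only mixed simplex left is the edge over [a0]. Simplices through any other vertex are
   one-coloured, so [K_cone] lets all these vertices be removed. *)
apply: (contractible_equiv (Y := realization R (avoid K2 ((fun i => [set i]%SET) @: I1)))).
  apply: (collapse R (c := fun i => (i.1, a0)) (rk := fun=> 0%N)).
  - by move=> i _; apply/set0Pn; exists i; rewrite inE.
  - by move=> -[b a]; rewrite !inE /= xpair_eqE eqxx eq_sym.
  - move=> [b a] t; rewrite inE /= sub1set => aa tK2 bt _.
    have tb e : (~~ b, e) \notin t.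
      apply/negP => be; case: b bt be => /= bt be.
        by have [aE _] := K2_mono tK2 bt be; rewrite aE eqxx in aa.
      by have [_ aE] := K2_mono tK2 be bt; rewrite aE eqxx in aa.
    have tK : t \in simplices K by move: tK2 => /avoidP[/avoidP[]].
    split.
      apply: (@K2_avoid b); first exact: K_cone.
      move=> e; rewrite !inE negb_or tb andbT xpair_eqE.
      by case: (b).
    move=> [b' a'] a'I _; rewrite inE in a'I; rewrite !sub1set in_setU1.
    by rewrite xpair_eqE (negbTE a'I) andbF.
set K3 := avoid _ _.
have K3P t : t \in simplices K3 -> t \subset [set c a0; d a0].
  move=> /avoidP[_ tS]; apply/subsetP => -[b a] at_.
  have : [set (b, a)]%SET \notin (fun i : bool * 'I_n => [set i]%SET) @: I1.
    by apply/negP => /tS; rewrite sub1set at_.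
  have [->|aa] := eqVneq a a0; first by rewrite !inE !xpair_eqE eqxx; case: (b).
  by rewrite imset_f// inE.
have cdK : [set c a0; d a0] \in simplices K3.
  have cdK : [set c a0; d a0] \in simplices K.
    apply: complex_closed (K_lower a0) _ _.
      by apply/subsetP => x; rewrite !inE => /orP[] ->; rewrite ?orbT.
    by apply/set0Pn; exists (c a0); rewrite !inE eqxx.
  apply/avoidP; split; last first.
    move=> _ /imsetP[[b a] aa ->]; rewrite inE /= in aa.
    by rewrite sub1set !inE !xpair_eqE (negbTE aa) !andbF.
  apply/avoidP; split.
    apply/avoidP; split=> // _ /set1P ->; rewrite T0P !inE !xpair_eqE /=.
    by rewrite neS !andbF.
  move=> _ /imsetP[[b a] ba ->]; rewrite !inE xpair_eqE /= in ba.
  rewrite stP !inE !xpair_eqE /= orbF; apply/negP => /andP[/eqP aE].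
  by rewrite aE in ba *; case: b ba => /=; rewrite ?eqxx// neS.
apply: (@cone_contractible R _ _ (c a0)).
  apply: complex_closed cdK _ _; first by apply/subsetP => x; rewrite !inE => ->.
  by apply/set0Pn; exists (c a0); rewrite inE.
move=> t tK3; apply: complex_closed cdK _ _.
  by apply/subsetP => x; rewrite !inE => /orP[->//|/(subsetP (K3P t tK3))]; rewrite !inE.
by apply/set0Pn; exists (c a0); rewrite !inE eqxx.
Qed.

End Strip.

Local Close Scope ring_scope.
Local Open Scope nat_scope.

(** * The two-coloured complex X *)

Section Residues.
Variables (P : nat -> bool) (k : nat).
Hypothesis PJ : forall j, (j < k)%N -> P (3 * j) -> ~~ P (3 * j + 2).
Hypothesis Pgap : forall p, (p.+1 < 3 * k)%N -> P p || P p.+1.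

(* A set without two consecutive gaps that misses [3 * j] or [3 * j + 2] for
   every [j < k] contains the residues 0 and 1, or 1 and 2, or changes from the
   latter to the former in a single block [j]; [chain_pred j] is its content in
   the last case. *)
Definition chain_pred (j p : nat) : bool :=
  (p < 3 * k)%N && [|| p %% 3 == 1, (p < 3 * j) && (p %% 3 == 2) |
    (3 * j + 3 <= p) && (p %% 3 == 0)]%N.

(** A missing middle would force both ends of the block to be present, against [PJ]. *)
Lemma middle_in j : (j < k)%N -> P (3 * j + 1).
Proof.
move=> jk; have h1 : (3 * j).+1 < 3 * k by lia.
have h2 : (3 * j + 1).+1 < 3 * k by lia.
have := Pgap h1; have := Pgap h2; have := PJ jk.
have -> : (3 * j + 1).+1 = (3 * j + 2)%N by lia.
have -> : (3 * j).+1 = (3 * j + 1)%N by lia.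
by case: (P (3 * j + 1)) => //; case: (P (3 * j)) => //; case: (P (3 * j + 2)) => // /(_ isT).
Qed.

Let step j : (j.+1 < k)%N -> ~~ P (3 * j + 2) -> P (3 * j.+1).
Proof.
move=> jk nP; have h : (3 * j + 2).+1 < 3 * k by lia.
by have := Pgap h; rewrite (negbTE nP) /=; congr P; lia.
Qed.

(** A block without residue 2 forces residue 0 in the next block, which then lacks residue 2 in
    turn. *)
Lemma left_run i j : (i <= j < k)%N -> ~~ P (3 * i + 2) ->
  ~~ P (3 * j + 2) /\ ((i < j)%N -> P (3 * j)).
Proof.
elim: j => [|j IH] ij nP.
  by have i0 : i = 0 by [lia]; rewrite i0 in nP *; split.
case: (ltngtP i j.+1) => [ij1|?|ij1]; [|lia|].
  have [nj _] := IH ltac:(lia) nP.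
  have Pj : P (3 * j.+1) by apply: step => //; lia.
  by split=> // ; apply: PJ => //; lia.
by rewrite -ij1.
Qed.

Lemma residues_left : P 0 -> forall p, (p < 3 * k)%N -> p %% 3 != 2 -> P p.
Proof.
move=> P0; have h j : (j < k)%N -> P (3 * j).
  case: j => // j jk; have k0 : 0 < k by lia.
  have [_] := @left_run 0 j.+1 ltac:(lia) (PJ k0 P0).
  by apply; lia.
move=> p pk p2; have [p0|p0] := eqVneq (p %% 3) 0.
  by have -> : p = (3 * (p %/ 3))%N by [lia]; apply: h; lia.
by have -> : p = (3 * (p %/ 3) + 1)%N by [lia]; apply: middle_in; lia.
Qed.

Lemma residues_right :
  (forall p, (p < 3 * k)%N -> p %% 3 != 0 -> P p) \/
  exists2 j, (j < k)%N & ~~ P (3 * j + 2) /\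
    forall p, chain_pred j p -> P p.
Proof.
have [allR|] := boolP [forall j : 'I_k, P (3 * j + 2)].
  left=> p pk p0; have [p1|p1] := eqVneq (p %% 3) 1.
    by have -> : p = (3 * (p %/ 3) + 1)%N by [lia]; apply: middle_in; lia.
  have jk : (p %/ 3 < k)%N by lia.
  have := forallP allR (Ordinal jk) => /=.
  by congr P; lia.
rewrite negb_forall => /existsP[j0 nP0].
have ex : exists j, (j < k)%N && ~~ P (3 * j + 2) by exists j0; rewrite nP0 ltn_ord.
(* The least such block is the place of the switch: all earlier blocks contain residue 2, and
   [left_run] governs the later ones. *)
case: (ex_minnP ex) => j /andP[jk nPj] jmin.
right; exists j => //; split=> // p /andP[pk] /or3P[/eqP p1|/andP[pj /eqP p2]|/andP[pj /eqP p0]].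
- by have -> : p = (3 * (p %/ 3) + 1)%N by [lia]; apply: middle_in; lia.
- apply: contraT => nPp; have := jmin (p %/ 3).
  have -> : (3 * (p %/ 3) + 2)%N = p by lia.
  by rewrite nPp andbT => h; have := h ltac:(lia); lia.
- have [_] := @left_run j (p %/ 3) ltac:(lia) nPj.
  by have -> : (3 * (p %/ 3))%N = p by [lia]; apply; lia.
Qed.

Lemma chain_last j : (j < k)%N -> ~~ P (3 * j + 2) -> ~~ P (3 * k).-1.
Proof.
move=> jk nP; have [nl _] := @left_run j k.-1 ltac:(lia) nP.
by move: nl; congr (~~ P _); lia.
Qed.

End Residues.

Section Arrows.
Variables (n : nat).
Hypothesis n6 : (6 <= n)%N.
Implicit Types (t : {set bool * 'I_n}) (b : bool).

(* What two collapses of [Delta] below leave, with the [false] arrows shifted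
   by two: the mixed simplices triangulate an annulus, and the simplices of
   one colour are the sets with two consecutive gaps. *)
Definition X_simplices : {set {set bool * 'I_n}} := [set t : {set bool * 'I_n} |
  [&& t != set0,
    [forall a, forall e, ((true, a) \in t) && ((false, e) \in t) ==>
       (e == a) || (e == ordS a)] &
    [forall b, exists i, ((b, i) \notin t) && ((b, ordS i) \notin t)]]].

Lemma XP t : reflect [/\ t != set0,
    forall a e, (true, a) \in t -> (false, e) \in t -> e = a \/ e = ordS a &
    forall b, exists i, (b, i) \notin t /\ (b, ordS i) \notin t]
  (t \in X_simplices).
Proof.
rewrite inE; apply: (iffP and3P) => -[t0 tm tg]; split=> //.
- move=> a e ta te; have /forallP/(_ a)/forallP/(_ e) := tm.
  by rewrite ta te /= => /orP[] /eqP; [left|right].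
- by move=> b; have /forallP/(_ b)/existsP[i /andP[]] := tg; exists i.
- apply/forallP => a; apply/forallP => e; apply/implyP => /andP[ta te].
  by apply/orP; case: (tm a e ta te) => ->; [left|right].
- by apply/forallP => b; apply/existsP; have [i [h h']] := tg b; exists i; rewrite h.
Qed.

Fact X_nonempty : set0 \notin X_simplices.
Proof. by rewrite inE eqxx. Qed.

Fact X_closed (s t : {set bool * 'I_n}) : s \in X_simplices -> t \subset s ->
  t != set0 -> t \in X_simplices.
Proof.
move=> /XP[_ sm sg] /subsetP ts t0; apply/XP; split=> // [a e /ts ta /ts te|b].
  exact: sm.
by have [i [h h']] := sg b; exists i; split; [apply: contra h|apply: contra h']; exact: ts.
Qed.

Definition X : complex (bool * 'I_n)%type := Complex X_nonempty X_closed.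

Let n0 : (0 < n)%N. Proof. by lia. Qed.

Definition o (p : nat) : 'I_n := Ordinal (ltn_pmod p n0).

Lemma oE (i : 'I_n) : o i = i.
Proof. by apply: val_inj; rewrite /= modn_small. Qed.

Lemma ordS_o p : ordS (o p) = o p.+1.
Proof. by apply: val_inj; rewrite /= -addn1 modnDml addn1. Qed.

Lemma o_eq p q : (p < n)%N -> (q < n)%N -> (o p == o q) = (p == q).
Proof. by move=> pn qn; rewrite -val_eqE /= !modn_small. Qed.

Lemma o_n : o n = o 0.
Proof. by apply: val_inj; rewrite /= modnn mod0n. Qed.

Lemma ordS_cases (i : 'I_n) :
  (i.+1 = n /\ (ordS i : nat) = 0) \/ (i.+1 < n /\ (ordS i : nat) = i.+1).
Proof.
by rewrite ordS_val; have := ltn_ord i; case: eqP => ? ?; [left|right]; split=> //; lia.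
Qed.

(** The positions two and three steps after [a] are free, the cycle being long enough. *)
Lemma gap_of_pair a b t :
  (forall i, (b, i) \in t -> i = a \/ i = ordS a) ->
  exists i, (b, i) \notin t /\ (b, ordS i) \notin t.
Proof.
move=> ht; exists (ordS (ordS a)).
have := ordS_cases a; have := ordS_cases (ordS a).
have := ordS_cases (ordS (ordS a)); have vi (i j : 'I_n) : i = j -> (i : nat) = j by move=> ->.
by move=> h3 h2 h1; split; apply/negP => /ht[] /vi; lia.
Qed.

(** A vertex of the other colour is compatible only with two cyclically consecutive vertices of
    colour [b]. *)
Lemma X_far t b p q : t \in simplices X -> (p + 2 <= q)%N -> (q + 2 <= p + n)%N ->
  (q < n)%N -> (b, o p) \in t -> (b, o q) \in t -> forall e, (~~ b, e) \notin t.
Proof.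
move=> /XP[_ tm _] pq qp qn tp tq e; apply/negP => te.
have pn : p < n by lia.
have vp : (o p : nat) = p by rewrite /= modn_small.
have vq : (o q : nat) = q by rewrite /= modn_small.
have := ordS_cases (o p); have := ordS_cases (o q); have := ordS_cases e; rewrite vp vq => ce cq cp.
have vi (i j : 'I_n) : i = j -> (i : nat) = j by move=> ->.
case: b tp tq te => /= tp tq te.
  have := tm _ _ tp te; have := tm _ _ tq te.
  by do 2![case=> /vi; rewrite ?vp ?vq => ?]; lia.
have := tm _ _ te tp; have := tm _ _ te tq.
by do 2![case=> /vi; rewrite ?vp ?vq => ?]; lia.
Qed.

Lemma X_add t b q : t \in simplices X -> (forall e, (~~ b, e) \notin t) ->
  (exists p, (b, o p) \notin (b, o q) |: t /\ (b, o p.+1) \notin (b, o q) |: t) ->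
  (b, o q) |: t \in simplices X.
Proof.
move=> /XP[_ tm tg] tb [p [gp gp']]; apply/XP; split.
- by apply/set0Pn; exists (b, o q); rewrite setU11.
- move=> a e; rewrite !in_setU1 !xpair_eqE.
  by case: (b) tb => tb /=; rewrite /= ?(negbTE (tb _)) ?orbF.
- move=> b'; have [->|bb] := eqVneq b' b.
    by exists (o p); rewrite ordS_o.
  have -> : b' = ~~ b by case: (b') (b) bb => -[].
  by exists (o 0); rewrite !in_setU1 !xpair_eqE !negb_or !tb; case: (b).
Qed.

Definition bset b (P : pred nat) : {set bool * 'I_n} :=
  [set v : bool * 'I_n | (v.1 == b) && P v.2].

Lemma in_bset b b' (P : pred nat) p : (p < n)%N ->
  ((b', o p) \in bset b P) = (b' == b) && P p.
Proof. by move=> pn; rewrite inE /= modn_small. Qed.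

Lemma bset_sub b (P : pred nat) t :
  (bset b P \subset t) <-> (forall p, (p < n)%N -> P p -> (b, o p) \in t).
Proof.
split=> [/subsetP h p pn Pp|h]; first by apply: h; rewrite in_bset// eqxx.
apply/subsetP => -[b' i]; rewrite inE /= => /andP[/eqP -> Pi].
by rewrite -(oE i); apply: h.
Qed.

(* No mixed simplex contains a far set. *)
Definition far_set (s : {set bool * 'I_n}) := exists b p q,
  [/\ (p + 2 <= q)%N, (q + 2 <= p + n)%N, (q < n)%N, (b, o p) \in s & (b, o q) \in s].

Lemma far_mixed s t a e : far_set s -> t \in simplices X -> (true, a) \in t ->
  (false, e) \in t -> ~~ (s \subset t).
Proof.
move=> [b [p [q [pq qp qn sp sq]]]] tX ta te; apply/negP => /subsetP st.
have := X_far tX pq qp qn (st _ sp) (st _ sq).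
case: b sp sq => _ _ h; first by have := h e; rewrite te.
by have := h a; rewrite ta.
Qed.

Lemma upper_in a : [set (true, a); (true, ordS a); (false, ordS a)] \in simplices X.
Proof.
apply/XP; split.
- by apply/set0Pn; exists (true, a); rewrite !inE eqxx.
- move=> x y; rewrite !inE !xpair_eqE /= !orbF => /orP[] /eqP -> /eqP ->; by [right|left].
- move=> b; apply: (@gap_of_pair a) => i; rewrite !inE !xpair_eqE.
  case: b => /=; rewrite ?orbF; first by case/orP => /eqP ->; [left|right].
  by move/eqP ->; right.
Qed.

Lemma lower_in a : [set (true, a); (false, a); (false, ordS a)] \in simplices X.
Proof.
apply/XP; split.
- by apply/set0Pn; exists (true, a); rewrite !inE eqxx.
- move=> x y; rewrite !inE !xpair_eqE /= !orbF => /eqP -> /orP[] /eqP ->; by [left|right].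
- move=> b; apply: (@gap_of_pair a) => i; rewrite !inE !xpair_eqE.
  case: b => /=; rewrite ?orbF; last by case/orP => /eqP ->; [left|right].
  by move/eqP ->; left.
Qed.

Lemma lower_facet t a : t \in simplices X ->
  [set (true, a); (false, a); (false, ordS a)] \subset t ->
  t = [set (true, a); (false, a); (false, ordS a)].
Proof.
move=> /XP[_ tm _]; rewrite !subUset !sub1set => /andP[/andP[ta ta'] tS].
apply/setP => -[b i]; rewrite !inE; apply/idP/idP => [it|].
  case: b it => it; rewrite !xpair_eqE /= ?orbF.
    have [ai|ai] := tm _ _ it ta'; first by rewrite ai.
    have [si|/ordS_inj ->//] := tm _ _ it tS.
    have := congr1 (@nat_of_ord n) ai; have := congr1 (@nat_of_ord n) si.
    by have := ordS_cases a; have := ordS_cases i; lia.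
  by case: (tm _ _ ta it) => ->; rewrite eqxx ?orbT.
by case/orP => [/orP[]|] /eqP ->.
Qed.

End Arrows.

(** * Reduction of the blocks of three consecutive vertices *)

Section Blocks.
Variables (R : realType) (n k : nat).
Hypotheses (n6 : 6 <= n) (k2 : 2 <= k) (kn : 3 * k <= n).
Implicit Types (t : {set bool * 'I_n}) (b : bool).

Local Notation o := (o n6).
Local Notation X := (X n).
Local Notation bset := (@bset n).

Definition jset (i : bool * 'I_k) : {set bool * 'I_n} :=
  [set (i.1, o (3 * i.2)); (i.1, o (3 * i.2 + 2))].

Definition Z : complex (bool * 'I_n)%type := avoid X (jset @: [set: bool * 'I_k]).

Let lt3 (j : 'I_k) : 3 * j + 2 < n.
Proof. by have := ltn_ord j; lia. Qed.

Lemma ZP t : (t \in simplices Z) <-> t \in simplices X /\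
  forall b j, j < k -> (b, o (3 * j)) \in t -> (b, o (3 * j + 2)) \notin t.
Proof.
split=> [/avoidP[tX h]|[tX h]].
  split=> // b j jk t1; apply/negP => t2.
  have := h (jset (b, Ordinal jk)); rewrite imset_f ?inE// => /(_ isT).
  by rewrite subUset !sub1set /= t1 t2.
apply/avoidP; split=> // _ /imsetP[[b j] _ ->]; rewrite subUset !sub1set /=.
by apply/negP => /andP[t1]; apply/negP/h.
Qed.

Lemma jset_far i : far_set n6 (jset i).
Proof.
have := lt3 i.2; exists i.1, (3 * i.2), (3 * i.2 + 2); split; try lia.
  by rewrite /jset !inE eqxx.
by rewrite /jset !inE eqxx orbT.
Qed.

Lemma Z_mixed t a e : t \in simplices X -> (true, a) \in t -> (false, e) \in t ->
  t \in simplices Z.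
Proof.
move=> tX ta te; apply/avoidP; split=> // _ /imsetP[i _ ->].
exact: far_mixed (jset_far i) tX ta te.
Qed.

(** Adding the middle vertex of a block cannot destroy a pair of gaps: both its neighbours are in
    the simplex, so it belongs to no such pair. Middle vertices lie in no [jset], hence a constant
    rank suffices. *)
Lemma X_Z : homotopy_equivalent R (realization R X) (realization R Z).
Proof.
apply: (collapse R (c := fun i : bool * 'I_k => (i.1, o (3 * i.2 + 1)))
  (rk := fun=> 0)).
- by move=> i _; apply/set0Pn; exists (i.1, o (3 * i.2)); rewrite !inE eqxx.
- move=> [b j] _; have := lt3 j => h /=.
  by rewrite !inE !xpair_eqE eqxx !o_eq /=; lia.
- move=> [b j] t _ tX /=; rewrite subUset !sub1set /= => /andP[t0 t2] _.
  have h := lt3 j.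
  have tb : forall e, (~~ b, e) \notin t.
    by apply: (@X_far n n6 t b (3 * j) (3 * j + 2)) => //; lia.
  split.
    apply: X_add => //; have /XP[_ _ /(_ b)[i [gi gi']]] := tX.
    exists i; rewrite -ordS_o oE !in_setU1 !negb_or gi gi' !andbT !xpair_eqE eqxx /=.
    split; apply/negP => /eqP ie; move: gi gi'; rewrite ie.
      by rewrite ordS_o -addnS t2.
    have -> : i = o (3 * j); last by rewrite t0.
    by apply: (@ordS_inj n); rewrite ie ordS_o addn1.
  move=> [b' j'] _ _; rewrite /jset /= !subUset !sub1set !in_setU1 !xpair_eqE.
  have h' := lt3 j'.
  by rewrite !o_eq; lia.
Qed.

Lemma Z_add t b q : t \in simplices Z -> (forall e, (~~ b, e) \notin t) ->
  (exists p, (b, o p) \notin (b, o q) |: t /\ (b, o p.+1) \notin (b, o q) |: t) ->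
  (forall j, j < k -> q = 3 * j -> (b, o (3 * j + 2)) \notin t) ->
  (forall j, j < k -> q <> 3 * j + 2) -> q < n ->
  (b, o q) |: t \in simplices Z.
Proof.
move=> /ZP[tX tJ] tb g q0 q2 qn; apply/ZP; split; first exact: X_add.
move=> b' j jk; rewrite !in_setU1 !xpair_eqE negb_or.
have [h h'] : 3 * j + 2 < n /\ 3 * j < n by lia.
rewrite !o_eq//; have [->|bb] := eqVneq b' b; rewrite /=; last exact: tJ.
have /eqP/negbTE q2' : 3 * j + 2 <> q by move=> e; apply: (q2 j jk).
rewrite q2' /=; case: eqP => [e _|_]; last exact: tJ.
by apply: q0.
Qed.

(** For a vertex that is no block end, the one obstruction is the loss of the last pair of gaps; the
    second alternative then supplies the hypotheses [Pgap] and [PJ] on residues. *)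
Lemma Z_nogap t b q : t \in simplices Z -> (forall e, (~~ b, e) \notin t) -> q < n ->
  (forall j, j < k -> q <> 3 * j) -> (forall j, j < k -> q <> 3 * j + 2) ->
  (b, o q) |: t \in simplices Z \/
  (forall p, ((b, o p) \in (b, o q) |: t) || ((b, o p.+1) \in (b, o q) |: t)) /\
  (forall j, j < k -> (b, o (3 * j)) \in (b, o q) |: t ->
     (b, o (3 * j + 2)) \notin (b, o q) |: t).
Proof.
move=> tZ tb qn q0 q2.
have [g|g] := pselect (exists p, (b, o p) \notin (b, o q) |: t /\ (b, o p.+1) \notin (b, o q) |: t).
  by left; apply: Z_add => // j jk /q0.
right; split.
  move=> p; apply: contrapT => /negP; rewrite negb_or => /andP[h h'].
  by apply: g; exists p.
have /ZP[_ tJ] := tZ.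
move=> j jk; rewrite !in_setU1 !xpair_eqE eqxx /= !o_eq; try lia.
case: eqP => [e|_]; first by case: (q0 j jk).
by case: eqP => [e|_ /tJ]; [case: (q2 j jk)|exact].
Qed.

Lemma card_bset b (P : pred nat) :
  #|bset b P| = \sum_(0 <= i < n) nat_of_bool (P i).
Proof.
have -> : bset b P = [set (b, i) | i in [set i : 'I_n | P i]].
  apply/setP => -[b' i]; rewrite inE /=; apply/andP/imsetP => [[/eqP -> Pi]|[j]].
    by exists i; rewrite ?inE.
  by rewrite inE => Pj [-> ->]; rewrite eqxx.
rewrite card_imset; last by move=> i j [].
rewrite -sum1_card big_mkord big_mkcond; apply: eq_bigr => i _.
by rewrite inE; case: (P i).
Qed.

Lemma sum_residue (P : pred nat) q : q < 3 ->
  (forall i, P i = (i < 3 * k) && (i %% 3 != q)) ->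
  \sum_(0 <= i < n) nat_of_bool (P i) = 2 * k.
Proof.
move=> q3 PE; rewrite (big_cat_nat (n := 3 * k))//= [X in _ + X]big_nat_cond.
rewrite [X in _ + X]big1; last by move=> i; rewrite PE; lia.
rewrite addn0 (eq_big_nat _ _ (F2 := fun i => nat_of_bool (i %% 3 != q))); last first.
  by move=> i ik; rewrite PE; congr nat_of_bool; lia.
elim: (k) => [|j IH]; first by rewrite big_geq.
have -> : 3 * j.+1 = (3 * j).+3 by lia.
by rewrite !big_nat_recr //= IH; lia.
Qed.

Lemma card_residue b q : q < 3 ->
  #|bset b (fun i => (i < 3 * k) && (i %% 3 != q))| = 2 * k.
Proof. by move=> q3; rewrite card_bset (@sum_residue _ q). Qed.

Lemma card_residue1 b q : q < 3 -> q != 1 ->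
  #|bset b (fun i => [&& i < 3 * k, i != 1 & i %% 3 != q])| =
  (2 * k).-1.
Proof.
move=> q3 q1; rewrite -(card_residue b q3) (cardsD1 (b, o 1) (bset b (fun i => (i < 3 * k) && (i %% 3 != q)))).
rewrite in_bset ?eqxx; last by lia.
have -> /= : (1 < 3 * k) && (1 %% 3 != q) by lia.
congr (#|pred_of_set _|); apply/setP => -[b' i].
rewrite -(oE n6 i) !inE xpair_eqE o_eq//; last by lia.
rewrite /= !(modn_small (ltn_ord i)).
by case: (b' == b) => /=; rewrite ?andbF//; lia.
Qed.

(* The facets are wedge spheres once the rest collapses onto the strip. *)
Lemma strip_wedge (K : complex (bool * 'I_n)%type) (a0 : 'I_n) (Fs : seq {set bool * 'I_n}) :
  (forall t, t \in simplices K -> t \in simplices X) ->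
  (forall t a e, t \in simplices X -> (true, a) \in t -> (false, e) \in t ->
     t \in simplices K) ->
  uniq Fs -> (forall F, F \in Fs -> F \in simplices K) ->
  (forall F, F \in Fs -> far_set n6 F) ->
  (forall F t, F \in Fs -> t \in simplices K -> F \subset t -> t = F) ->
  forall S : {set {set bool * 'I_n}},
  (forall s, s \in S -> far_set n6 s) ->
  homotopy_equivalent R
    (realization R (avoid K ([set [set (true, a0); (false, a0); (false, ordS a0)]]
                             :|: [set F in Fs])))
    (realization R (avoid (avoid K [set F in Fs] : complex (bool * 'I_n)%type)
      (S :|: [set [set (true, a0); (false, a0); (false, ordS a0)]]))) ->
  (forall t b, t \in simplices (avoid (avoid K [set F in Fs]) S) ->
     (forall e, (~~ b, e) \notin t) ->
     (b, a0) |: t \in simplices (avoid (avoid K [set F in Fs]) S)) ->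
  homotopy_equivalent R (realization R K)
    (wedge_spheres R (2 :: [seq #|(F : {set bool * 'I_n})|.-1 | F <- Fs])).
Proof.
move=> KX mixK uFs FK Ffar Fmax S Sfar heS cone.
set T0 := [set (true, a0); (false, a0); (false, ordS a0)].
have T0X : T0 \in simplices X by exact: lower_in.
have c0 : (true, a0) \in T0 by rewrite !inE eqxx.
have d0 : (false, a0) \in T0 by rewrite !inE eqxx orbT.
have T0F : T0 \notin Fs.
  by apply/negP => /Ffar h; have := far_mixed h T0X c0 d0; rewrite fintype.subxx.
have neS : (ordS a0 == a0) = false by apply: ordS_neq; lia.
have -> : 2 = #|T0|.-1.
  by rewrite /T0 setUC cardsU1 cards2 !inE !xpair_eqE /= neS.
apply: (@wedge_of_facet_seq R _ K (T0 :: Fs)) => //=.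
- by rewrite T0F.
- move=> F; rewrite inE => /orP[/eqP ->|/FK//]; exact: mixK T0X c0 d0.
- move=> F t; rewrite inE => /orP[/eqP -> /KX tX|]; last exact: Fmax.
  exact: lower_facet.
have -> : [set F in T0 :: Fs] = [set T0] :|: [set F in Fs].
  by apply/setP => F; rewrite !inE.
apply: contractible_equiv heS _; rewrite -avoid_avoid.
have AX t : t \in simplices (avoid (avoid K [set F in Fs]) S) -> t \in simplices X.
  by move=> /avoidP[/avoidP[/KX]].
have mixA t a e : t \in simplices X -> (true, a) \in t -> (false, e) \in t ->
    t \in simplices (avoid (avoid K [set F in Fs]) S).
  move=> tX ta te; apply/avoidP; split; last by move=> s /Sfar h; exact: far_mixed h tX ta te.
  apply/avoidP; split; first exact: mixK tX ta te.
  by move=> s; rewrite inE => /Ffar h; exact: far_mixed h tX ta te.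
apply: strip_contractible => //; first by lia.
- by move=> t a e /AX /XP[_ tm _]; exact: tm.
- move=> a; apply: (mixA _ a (ordS a)); [exact: upper_in| |]; by rewrite !inE eqxx ?orbT.
- move=> a; apply: (mixA _ a a); [exact: lower_in| |]; by rewrite !inE eqxx ?orbT.
Qed.

End Blocks.

Lemma homotopy_equivalent_simplices (R : realType) (V : finType) (K L : complex V) :
  (forall t, (t \in simplices K) = (t \in simplices L)) ->
  homotopy_equivalent R (realization R K) (realization R L).
Proof.
move=> h; have -> : K = L by apply/complex_eq/setP.
exact: homotopy_equivalent_refl.
Qed.

Lemma avoid_eq (V : finType) (K : complex V) (S S' : {set {set V}}) t :
  (forall s, (s \in S) = (s \in S')) ->
  (t \in simplices (avoid K S)) = (t \in simplices (avoid K S')).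
Proof. by move=> h; have -> : S = S' by apply/setP. Qed.

(** * The case where 3 divides the number of vertices *)

Section Case0.
Variables (R : realType) (n k : nat).
Hypotheses (n6 : 6 <= n) (k2 : 2 <= k) (nk : n = 3 * k).
Implicit Types (t : {set bool * 'I_n}) (b : bool).

Local Notation o := (o n6).
Local Notation X := (X n).
Local Notation bset := (@bset n).
Local Notation Z := (Z k n6).

Let kn : 3 * k <= n. Proof. by rewrite nk. Qed.

(** As [n = 3 * k], the residues other than [q] leave no two consecutive gaps and form no simplex.
    Without the vertex 1, the apex of the cone below, a single pair of gaps appears. *)
Definition facet0 b q : {set bool * 'I_n} :=
  bset b (fun i => [&& i < 3 * k, i != 1 & i %% 3 != q]).

Let qs := [:: (true, 0); (true, 2); (false, 0); (false, 2)].
Let Fs : seq {set bool * 'I_n} := [seq facet0 bq.1 bq.2 | bq <- qs].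

Let FsP F : F \in Fs -> exists b q, F = facet0 b q /\ (q = 0 \/ q = 2).
Proof.
case/mapP => -[b q] bq ->; exists b, q; split=> //.
by move: bq; rewrite !inE !xpair_eqE => /or4P[] /andP[_ /eqP]; [left|right|left|right].
Qed.

Let Fs_in b q : (q = 0 \/ q = 2) -> facet0 b q \in Fs.
Proof.
move=> q02; apply/mapP; exists (b, q) => //.
by rewrite !inE !xpair_eqE; case: b; case: q02 => ->.
Qed.

Let in_facet0 b q b' p : p < n ->
  ((b', o p) \in facet0 b q) = (b' == b) && [&& p < 3 * k, p != 1 & p %% 3 != q].
Proof. by move=> pn; rewrite in_bset. Qed.

Let facet0_other b q e : (~~ b, e) \notin facet0 b q.
Proof. by rewrite inE /= negb_and; case: b. Qed.

Let facet0_far b q : (q = 0 \/ q = 2) -> far_set n6 (facet0 b q).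
Proof.
case=> ->; [exists b, 2, 4|exists b, 0, 3]; by split; rewrite ?in_facet0 ?eqxx; lia.
Qed.

Let facet0_Z b q : (q = 0 \/ q = 2) -> facet0 b q \in simplices Z.
Proof.
move=> q02; apply/ZP; split.
  apply/XP; split.
  - by apply/set0Pn; exists (b, o 4); rewrite in_facet0 ?eqxx; lia.
  - by move=> a e; have := facet0_other b q; case: (b) => h ha he; [have := h e|have := h a]; rewrite ?ha ?he.
  - move=> b'; have [->|bb] := eqVneq b' b; last first.
      have -> : b' = ~~ b by case: (b') (b) bb => -[].
      by exists (o 0).
    case: q02 => ->; [exists (o 0)|exists (o 1)]; rewrite ordS_o !in_facet0; lia.
by move=> b' j jk; rewrite !in_facet0; lia.
Qed.

Lemma wedge_case0 : homotopy_equivalent R (realization R X)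
  (wedge_spheres R [:: 2; 2 * k - 2; 2 * k - 2; 2 * k - 2; 2 * k - 2]).
Proof.
apply: homotopy_equivalent_trans (X_Z R n6 k2 kn) _.
have -> : [:: 2; 2 * k - 2; 2 * k - 2; 2 * k - 2; 2 * k - 2] =
    2 :: [seq #|(F : {set bool * 'I_n})|.-1 | F <- Fs].
  rewrite /= /facet0 !(card_residue1 n6 k2 kn)//.
  by have -> : (2 * k).-2 = 2 * k - 2 by lia.
apply: (@strip_wedge R n k n6 k2 kn Z (o 1) Fs _ _ _ _ _ _ finset.set0).
- by move=> t /ZP[].
- exact: Z_mixed.
- rewrite map_inj_in_uniq// => -[b q] [b' q'] bq bq' /= e.
  have eb : b = b'.
    have : (b, o 4) \in facet0 b q.
      rewrite in_facet0 ?eqxx; try lia.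
      by move: bq; rewrite !inE !xpair_eqE; lia.
    by rewrite e in_facet0; [case/andP => /eqP|lia].
  rewrite -eb in e *; congr pair.
  have := in_facet0 b q b (_ : 0 < n); have := in_facet0 b q b (_ : 2 < n).
  rewrite e !in_facet0 ?eqxx; try lia.
  move: bq bq'; rewrite !inE !xpair_eqE => h h' /(_ ltac:(lia)) e2 /(_ ltac:(lia)) e0.
  by lia.
- by move=> F /FsP[b [q [-> /facet0_Z]]].
- by move=> F /FsP[b [q [-> /facet0_far]]].
- move=> F t /FsP[b [q [-> q02]]] tZ Ft; apply/eqP; rewrite eqEsubset Ft andbT.
  have [tX tJ] := (ZP _ _ _).1 tZ.
  have hF p : p < n -> [&& p < 3 * k, p != 1 & p %% 3 != q] -> (b, o p) \in t.
    by move=> pn hp; have [h _] := bset_sub n6 b (fun i => [&& i < 3 * k, i != 1 & i %% 3 != q]) t; exact: h.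
  have tb e : (~~ b, e) \notin t.
    have [b' [p [p' [h1 h2 h3 h4 h5]]]] := facet0_far b q02.
    have eb : b' = b by move: h4; rewrite inE /= => /andP[/eqP].
    rewrite eb in h4 h5.
    by apply: (X_far tX h1 h2 h3); exact: (subsetP Ft).
  apply/subsetP => -[b' i] it.
  have eb : b' = b by case: b' b it tb {hF Ft q02} => -[] // it /(_ i); rewrite it.
  rewrite eb in it *; rewrite -(oE n6 i) in it *; have ik := ltn_ord i.
  rewrite in_facet0// eqxx /=.
  have iq : nat_of_ord i %% 3 != q.
    apply/negP => /eqP iq.
    case: q02 hF iq => -> hF iq.
      have := tJ b (i %/ 3) ltac:(lia); have -> : 3 * (i %/ 3) = i by lia.
      by move=> /(_ it); rewrite hF; lia.
    have := tJ b (i %/ 3) ltac:(lia); have -> : 3 * (i %/ 3) + 2 = i by lia.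
    by rewrite it hF => [/(_ isT)| |]; lia.
  apply/and3P; split=> //; first by lia.
  (* Adding 1 would leave gaps of residue [q] only, and these are never consecutive. *)
  apply/eqP => i1; have /XP[_ _ /(_ b)[x [xt xt']]] := tX.
  have hq (y : 'I_n) : (b, y) \notin t -> y %% 3 = q.
    move=> yt; apply/eqP; apply: contraNT yt => yq; rewrite -(oE n6 y).
    have [y1|y1] := eqVneq (y : nat) 1; first by rewrite y1 -i1.
    by apply: hF => //; move: (ltn_ord y) y1 yq nk; clear; lia.
  by move: (hq _ xt) (hq _ xt') (ordS_cases n6 x) (ltn_ord x) q02 nk; clear; lia.
- by move=> s; rewrite inE.
- apply: homotopy_equivalent_simplices => t; rewrite avoid_avoid.
  by apply: avoid_eq => s; rewrite !inE /= orbC.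
- move=> t b; rewrite avoid0 => /avoidP[tZ tF] tb.
  have tF' q : q = 0 \/ q = 2 -> exists p, [/\ p < n, p != 1, p %% 3 != q & (b, o p) \notin t].
    move=> /(Fs_in b) qF; have := tF (facet0 b q); rewrite inE qF => /(_ isT) /subsetPn[[b' i]].
    rewrite -(oE n6 i) in_facet0// => /andP[/eqP -> /and3P[? ? ?] ?].
    by exists i; split.
  (* Adding the apex 1 to a one-coloured simplex fails only if the simplex contains one of the
     removed facets. *)
  have [addZ|[gap J]] := Z_nogap k2 kn tZ tb (ltac:(lia) : 1 < n) ltac:(lia) ltac:(lia).
    apply/avoidP; split=> // F; rewrite inE => FFs.
    apply: contra (tF F _); last by rewrite inE.
    move=> /subsetP Fs'; apply/subsetP => v vF; have := Fs' v vF.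
    case/setU1P => // ve; have [b' [q [FE _]]] := FsP FFs.
    by move: vF; rewrite ve FE in_facet0 ?andbF//; lia.
  pose P p := (b, o p) \in (b, o 1) |: t.
  have PJ j : j < k -> P (3 * j) -> ~~ P (3 * j + 2) by exact: J.
  have Pg p : p.+1 < 3 * k -> P p || P p.+1 by move=> _; exact: gap.
  have Pt p : p < n -> p != 1 -> P p -> (b, o p) \in t.
    move=> pn p1; rewrite /P in_setU1 xpair_eqE eqxx o_eq//; last by lia.
    by rewrite (negbTE p1).
  have [P0|P0] := boolP (P 0).
    have [p [pn p1 p2]] := tF' 2 ltac:(by right).
    by rewrite Pt//; apply: (residues_left PJ Pg P0) => //; lia.
  (* Without 0 its cyclic predecessor must be present, which excludes the switching pattern by
     [chain_last]. *)
  have Pl : P (3 * k).-1.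
    have := gap (3 * k).-1; have -> : (3 * k).-1.+1 = n by lia.
    by rewrite o_n => /orP[//|h]; rewrite /P h in P0.
  have [hR|[j jk [nP _]]] := residues_right PJ Pg.
    have [p [pn p1 p0]] := tF' 0 ltac:(by left).
    by rewrite Pt//; apply: hR => //; lia.
  by have := chain_last PJ Pg jk nP; rewrite Pl.
Qed.

End Case0.

(** * Chains, for a number of vertices not divisible by 3 *)

Section Case12.
Variables (R : realType) (n k : nat) (f : bool).
Hypotheses (n6 : 6 <= n) (k2 : 2 <= k) (nk : n = 3 * k + 1 + f).
Implicit Types (t : {set bool * 'I_n}) (b : bool).

Local Notation o := (o n6).
Local Notation X := (X n).
Local Notation bset := (@bset n).
Local Notation Z := (Z k n6).

Let kn : 3 * k <= n. Proof. by rewrite nk -addnA leq_addr. Qed.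

(** The clause [3 * k < p] adds the vertex [3k + 1] when [f] holds and nothing otherwise. The vertex
    [3k] is left out on purpose: it is the apex of the later cone, and it meets every pair of
    consecutive gaps of such a set, so adding it leaves none. *)
Definition chain_set (i : bool * 'I_k) : {set bool * 'I_n} :=
  bset i.1 (fun p => chain_pred k i.2 p || (3 * k < p)).

Definition full_set b : {set bool * 'I_n} :=
  bset b (fun p => (p < 3 * k) && (p %% 3 != 0) || (3 * k < p)).

Definition chains : {set {set bool * 'I_n}} := chain_set @: [set: bool * 'I_k].

Lemma other_bset b P e : (~~ b, e) \notin bset b P.
Proof. by rewrite inE /= negb_and; case: b. Qed.

Lemma chain_far i : far_set n6 (chain_set i).
Proof.
case: i => b j; exists b, 1, 4; split; try lia.
  by rewrite in_bset ?eqxx /chain_pred /=; lia.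
by rewrite in_bset ?eqxx /chain_pred /=; lia.
Qed.

Lemma far_other s t b : far_set n6 s -> (forall e, (~~ b, e) \notin s) ->
  t \in simplices X -> s \subset t -> forall e, (~~ b, e) \notin t.
Proof.
move=> [b' [p [q [h1 h2 h3 h4 h5]]]] sb tX /subsetP st.
have eb : b' = b.
  apply: contrapT => /eqP bb; have e : b' = ~~ b by case: (b') (b) bb => -[].
  by have := sb (o p); rewrite -e h4.
by rewrite eb in h4 h5; apply: (X_far tX h1 h2 h3); exact: st.
Qed.

Lemma X_gap_val t b : t \in simplices X -> exists x y, [/\ x < n, y < n,
  (x.+1 = n /\ y = 0) \/ y = x.+1, (b, o x) \notin t & (b, o y) \notin t].
Proof.
move=> /XP[_ _ /(_ b)[i [h h']]]; exists i, (ordS i); rewrite !oE; split=> //.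
by case: (ordS_cases n6 i) => [[]|[_]]; [left|right].
Qed.

(** With [3k + 1] present, the gaps can only be multiples of 3 up to [3k], no two of which are
    consecutive around the cycle. *)
Lemma full_gap t b : f -> t \in simplices X -> ~~ (full_set b \subset t).
Proof.
move=> f1 tX; apply/negP => /(bset_sub n6) h.
have [x [y [xn yn xy xt yt]]] := X_gap_val b tX.
have hx : ~~ ((x < 3 * k) && (x %% 3 != 0) || (3 * k < x)) by apply: contra xt; exact: h.
have hy : ~~ ((y < 3 * k) && (y %% 3 != 0) || (3 * k < y)) by apply: contra yt; exact: h.
by move: nk; rewrite f1; lia.
Qed.

(** With [3j + 2] the simplex would contain the next chain or, for the last block, [full_set]. It
    does not contain [3k] either, since no pair of gaps would be left. Hence the gaps [3k - 1] and
    [3k] survive the addition of [3j]. *)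
Lemma chain_step t b (j : 'I_k) : t \in simplices Z -> chain_set (b, j) \subset t ->
  (forall j' : 'I_k, j < j' -> ~~ (chain_set (b, j') \subset t)) ->
  ~~ (full_set b \subset t) ->
  [/\ forall e, (~~ b, e) \notin t, (b, o (3 * j + 2)) \notin t &
      (b, o (3 * j)) |: t \in simplices Z].
Proof.
move=> tZ ct low nfull; have [tX tJ] := (ZP _ _ _).1 tZ.
have jk := ltn_ord j.
have tb : forall e, (~~ b, e) \notin t.
  exact: far_other (chain_far _) (other_bset _ _) tX ct.
have h p : p < n -> chain_pred k j p || (3 * k < p) -> (b, o p) \in t.
  by move/(bset_sub n6): ct => h; exact: h.
have et : (b, o (3 * k)) \notin t.
  apply/negP => et; have [x [y [xn yn xy xt yt]]] := X_gap_val b tX.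
  have hx : ~~ [|| chain_pred k j x, 3 * k < x | x == 3 * k].
    apply: contra xt => /or3P[c|c|/eqP -> //]; by apply: h => //; rewrite c ?orbT.
  have hy : ~~ [|| chain_pred k j y, 3 * k < y | y == 3 * k].
    apply: contra yt => /or3P[c|c|/eqP -> //]; by apply: h => //; rewrite c ?orbT.
  by move: hx hy xn yn xy jk nk; rewrite /chain_pred; clear; lia.
have j2 : (b, o (3 * j + 2)) \notin t.
  apply/negP => j2; have [j1k|j1k] := ltnP j.+1 k.
    have := low (Ordinal j1k) (ltnSn _); apply/negP; rewrite negbK.
    apply/(bset_sub n6) => p pn /= hp.
    have [->//|p2] := eqVneq p (3 * j + 2).
    by apply: h => //; move: hp; rewrite /chain_pred; lia.
  move/negP: nfull; apply; apply/(bset_sub n6) => p pn /= hp.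
  have [->//|p2] := eqVneq p (3 * j + 2).
  by apply: h => //; move: hp; rewrite /chain_pred; lia.
split=> //; apply: Z_add => //; try lia.
  exists (3 * k).-1; have -> : (3 * k).-1.+1 = 3 * k by lia.
  rewrite !in_setU1 !xpair_eqE eqxx /= !o_eq; try lia.
  rewrite !negb_or et; split; last by rewrite andbT; lia.
  apply/andP; split; first by lia.
  have [jl|jl] := eqVneq j.+1 k.
    by have -> : (3 * k).-1 = 3 * j + 2 by lia.
  have := tJ b k.-1 ltac:(lia); have -> : 3 * k.-1 + 2 = (3 * k).-1 by lia.
  by apply; apply: h; rewrite /chain_pred; lia.
by move=> i ik ji; have -> : i = j by lia.
Qed.

(** Chains are removed by decreasing block index, because [chain_step] needs the later chains to be
    gone. The sets of [S] are removed beforehand, so adding [3j] must not complete any of them. *)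
Lemma chain_collapse (S : {set {set bool * 'I_n}}) :
  (forall t b, t \in simplices (avoid Z S) -> ~~ (full_set b \subset t)) ->
  (forall t b j s, t \in simplices (avoid Z S) -> (forall e, (~~ b, e) \notin t) ->
     j < k -> (b, o (3 * j + 2)) \notin t -> s \in S ->
     ~~ (s \subset (b, o (3 * j)) |: t)) ->
  homotopy_equivalent R (realization R (avoid Z S))
    (realization R (avoid (avoid Z S) chains)).
Proof.
move=> nfull stab.
apply: (collapse R (c := fun i : bool * 'I_k => (i.1, o (3 * i.2)))
  (rk := fun i : bool * 'I_k => k - i.2)).
- by move=> [b j] _; apply/set0Pn; exists (b, o 1); rewrite in_bset ?eqxx /chain_pred /=; lia.
- by move=> [b j] _; have jk := ltn_ord j; rewrite in_bset ?eqxx /chain_pred /=; lia.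
- move=> [b j] t _ tS ct low; have jk := ltn_ord j.
  have tZ : t \in simplices Z by case/avoidP: tS.
  have [|tb j2 addZ] := chain_step tZ ct _ (nfull _ b tS).
    by move=> j' jj'; apply: low; rewrite ?inE //=; have := ltn_ord j'; lia.
  split; first by apply/avoidP; split=> // s; exact: stab.
  move=> [b' j'] _ /= rk; have j'k := ltn_ord j'; move=> /(bset_sub n6) sub.
  have jn : 3 * j + 2 < n by move: jk kn; clear; lia.
  have j0n : 3 * j < n by move: jn; clear; lia.
  have n1 : 1 < n by move: n6; clear; lia.
  have eb : b' = b.
    have := sub 1 n1; have -> /= : chain_pred k j' 1.
      by rewrite /chain_pred; move: j'k; clear; lia.
    rewrite in_setU1 xpair_eqE /= o_eq//.
    have -> : (1 == 3 * j) = false by clear; lia.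
    by rewrite andbF => /(_ isT); case: (b) (b') tb => -[] // tb'; rewrite (negbTE (tb' _)).
  (* A chain that switches later contains [3j + 2], which the enlarged simplex lacks. *)
  rewrite eb in sub *; have [jj|jj] := ltnP j j'.
    have := sub (3 * j + 2) jn; have -> /= : chain_pred k j' (3 * j + 2).
      by rewrite /chain_pred; move: jj jk; clear; lia.
    rewrite in_setU1 xpair_eqE /= o_eq// (negbTE j2) orbF.
    by have -> : (3 * j + 2 == 3 * j) = false by [clear; lia]; rewrite andbF => /(_ isT).
  by have -> : j' = j by apply: val_inj => /=; move: rk jj jk j'k; clear; lia.
Qed.

(* The apex [3 * k] lies in none of the avoided sets, so a push can only
   fail for want of a gap. *)
Lemma cone_step (K : complex (bool * 'I_n)%type) S t b :
  simplices K = simplices (avoid Z S) ->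
  (forall s b', s \in S -> (b', o (3 * k)) \notin s) ->
  (forall j : 'I_k, chain_set (b, j) \in S) ->
  (~~ f -> full_set b \in S) ->
  (f -> bset b (fun p => (p < 3 * k) && (p %% 3 != 2)) \in S) ->
  t \in simplices K -> (forall e, (~~ b, e) \notin t) ->
  (b, o (3 * k)) |: t \in simplices K.
Proof.
move=> KE Se Sc Sfull Sleft; rewrite KE => /avoidP[tZ tS] tb.
have kn' : 3 * k < n by lia.
have [addZ|[gap J]] := Z_nogap k2 kn tZ tb kn' ltac:(lia) ltac:(lia).
  apply/avoidP; split=> // s sS; apply: contra (tS s sS) => /subsetP sub.
  apply/subsetP => v vs; have := sub v vs; case/setU1P => // ve.
  by have := Se s b sS; rewrite -ve vs.
pose P p := (b, o p) \in (b, o (3 * k)) |: t.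
have PJ j : j < k -> P (3 * j) -> ~~ P (3 * j + 2) by exact: J.
have Pg p : p.+1 < 3 * k -> P p || P p.+1 by move=> _; exact: gap.
have Pt p : p < n -> p != 3 * k -> P p -> (b, o p) \in t.
  move=> pn p1; rewrite /P in_setU1 xpair_eqE eqxx o_eq//.
  by rewrite (negbTE p1).
have tX : t \in simplices X by case/ZP: tZ.
(* If [3k + 1] is present or does not exist, the simplex contains a chain or [full_set]. If it is a
   gap, its successor 0 must be present, which gives the pattern of residues 0 and 1. *)
have [Pf|nPf] := boolP (~~ f || P (3 * k + 1)).
  have Pk p : p < n -> 3 * k < p -> P p.
    move=> pn kp; case/orP: Pf => [nf|]; first by move: nk; rewrite (negbTE nf); lia.
    by have -> : p = 3 * k + 1 by move: nk; case: (f); lia.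
  have [hR|[j jk [nP hc]]] := residues_right PJ Pg.
    have sub : full_set b \subset t.
      apply/(bset_sub n6) => p pn hp; apply: Pt => //; first by lia.
      by case/orP: hp => [/andP[? ?]|?]; [exact: hR|exact: Pk].
    have [f1|f0] := boolP f; first by have := full_gap b f1 tX; rewrite sub.
    by have := tS _ (Sfull f0); rewrite sub.
  have sub : chain_set (b, Ordinal jk) \subset t.
    apply/(bset_sub n6) => p pn /= hp; apply: Pt => //.
      by move: hp; rewrite /chain_pred; lia.
    by case/orP: hp => [|?]; [exact: hc|exact: Pk].
  by have := tS _ (Sc (Ordinal jk)); rewrite sub.
move: nPf; rewrite negb_or negbK => /andP[f1 nP].
have P0 : P 0.
  have := gap (3 * k + 1); have -> : (3 * k + 1).+1 = n by move: nk; rewrite f1; lia.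
  by rewrite o_n => /orP[h|//]; rewrite /P h in nP.
have sub : bset b (fun p => (p < 3 * k) && (p %% 3 != 2)) \subset t.
  apply/(bset_sub n6) => p pn /andP[pk p2]; apply: Pt => //; first by lia.
  exact: (residues_left PJ Pg).
by have := tS _ (Sleft f1); rewrite sub.
Qed.

Lemma chain_apex s b' : s \in chains -> (b', o (3 * k)) \notin s.
Proof.
move=> /imsetP[[b j] _ ->]; rewrite in_bset ?negb_and; last by lia.
by have jk := ltn_ord j; rewrite /chain_pred /=; lia.
Qed.

Lemma residue_Z b q : q < 3 -> q != 1 -> ~~ f || (q == 2) ->
  bset b (fun p => (p < 3 * k) && (p %% 3 != q)) \in simplices Z.
Proof.
move=> q3 q1 fq; apply/ZP; split.
  apply/XP; split.
  - by apply/set0Pn; exists (b, o 1); rewrite in_bset ?eqxx; lia.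
  - move=> a e; have := other_bset b (fun p => (p < 3 * k) && (p %% 3 != q)).
    by case: (b) => h ha he; [have := h e|have := h a]; rewrite ?ha ?he.
  - move=> b'; have [->|bb] := eqVneq b' b; last first.
      have -> : b' = ~~ b by case: (b') (b) bb => -[].
      by exists (o 0); rewrite !other_bset.
    have [q2|q2] := eqVneq q 2.
      by exists (o (3 * k).-1); rewrite ordS_o !in_bset; lia.
    exists (o (3 * k)); rewrite ordS_o.
    have -> : (3 * k).+1 = n by move: nk fq; rewrite (negbTE q2) orbF; case: (f); lia.
    by rewrite o_n !in_bset; lia.
by move=> b' j jk; rewrite !in_bset; lia.
Qed.

Lemma residue_far b q : q < 3 -> q != 1 ->
  far_set n6 (bset b (fun p => (p < 3 * k) && (p %% 3 != q))).
Proof.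
by move=> q3 q1; exists b, 1, 4; split; rewrite ?in_bset ?eqxx; lia.
Qed.

Lemma residue_pair_uniq q : q < 3 -> q != 1 ->
  uniq [seq bset b (fun p => (p < 3 * k) && (p %% 3 != q)) | b <- [:: true; false]].
Proof.
move=> q3 q1; rewrite /= andbT inE; apply/negP => /eqP e.
have : (true, o 1) \in bset true (fun p => (p < 3 * k) && (p %% 3 != q)).
  by rewrite in_bset ?eqxx; lia.
by rewrite e in_bset; lia.
Qed.

End Case12.

(** * The case of remainder 1 *)

Section Case1.
Variables (R : realType) (n k : nat).
Hypotheses (n6 : 6 <= n) (k2 : 2 <= k) (nk : n = 3 * k + 1 + false).
Implicit Types (t : {set bool * 'I_n}) (b : bool).

Local Notation o := (o n6).
Local Notation X := (X n).
Local Notation bset := (@bset n).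
Local Notation Z := (Z k n6).

Let kn : 3 * k <= n. Proof. by rewrite nk -addnA leq_addr. Qed.

(** This is [full_set], as no vertex lies beyond [3k]; its only pair of gaps is formed by [3k] and
    0. *)
Let F b : {set bool * 'I_n} := bset b (fun p => (p < 3 * k) && (p %% 3 != 0)).
Let Fs := [seq F b | b <- [:: true; false]].
Let T0 : {set bool * 'I_n} :=
  [set (true, o (3 * k)); (false, o (3 * k)); (false, ordS (o (3 * k)))].

Let FsP G : G \in Fs -> exists b, G = F b.
Proof. by rewrite !inE => /orP[] /eqP ->; [exists true|exists false]. Qed.

Let F_in b : F b \in Fs.
Proof. by rewrite !inE; case: b; rewrite eqxx ?orbT. Qed.

Let F_max b t : t \in simplices Z -> F b \subset t -> t = F b.
Proof.
move=> tZ Ft; have [tX tJ] := (ZP _ _ _).1 tZ.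
have tb : forall e, (~~ b, e) \notin t.
  by apply: (far_other (residue_far n6 k2 nk b _ _) _ tX Ft) => // e; exact: other_bset.
have hF p : p < n -> (p < 3 * k) && (p %% 3 != 0) -> (b, o p) \in t.
  by move/(bset_sub n6): Ft => h; exact: h.
apply/eqP; rewrite eqEsubset Ft andbT; apply/subsetP => -[b' i] it.
have eb : b' = b by case: b b' it tb {hF Ft} => -[] // it /(_ i); rewrite it.
rewrite eb in it *; rewrite -(oE n6 i) in it *; have ik := ltn_ord i.
rewrite in_bset// eqxx /=; apply/negPn/negP => hi.
have [ik3|ik3] := ltnP i (3 * k).
  have := tJ b (i %/ 3) ltac:(lia); have -> : 3 * (i %/ 3) = i by lia.
  by move=> /(_ it); rewrite hF; lia.
have ie : nat_of_ord i = 3 * k by lia.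
have [x [y [xn yn xy xt yt]]] := X_gap_val n6 b tX.
have hq p : p < n -> (b, o p) \notin t -> p %% 3 = 0 /\ p < 3 * k.
  move=> pn pt; have pk : p != 3 * k.
    by apply: contraNneq pt => ->; rewrite -ie.
  have pk' : p < 3 * k by move: pn pk nk; clear; lia.
  by split=> //; apply/eqP; apply: contraNT pt => p3; apply: hF => //; rewrite pk'.
by move: (hq x xn xt) (hq y yn yt) xy nk; clear; lia.
Qed.

Lemma wedge_case1 : homotopy_equivalent R (realization R X)
  (wedge_spheres R [:: 2; 2 * k - 1; 2 * k - 1]).
Proof.
apply: homotopy_equivalent_trans (X_Z R n6 k2 kn) _.
have -> : [:: 2; 2 * k - 1; 2 * k - 1] =
    2 :: [seq #|(G : {set bool * 'I_n})|.-1 | G <- Fs].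
  by rewrite /= /F !(card_residue n6 k2 kn)// subn1.
have mixed_T0 t b : (forall e, (~~ b, e) \notin t) -> ~~ (T0 \subset t).
  move=> tb; apply/negP; rewrite !subUset !sub1set => /andP[/andP[h1 h2] _].
  by case: b tb => tb; have := tb (o (3 * k)); rewrite /= ?h1 ?h2.
apply: (@strip_wedge R n k n6 k2 kn Z (o (3 * k)) Fs _ _ _ _ _ _ (chains n k)).
- by move=> t /ZP[].
- exact: Z_mixed.
- exact: (@residue_pair_uniq _ _ _ n6 k2 nk 0).
- by move=> _ /FsP[b ->]; exact: (residue_Z n6 k2 nk).
- by move=> _ /FsP[b ->]; exact: (residue_far n6 k2 nk).
- by move=> _ t /FsP[b ->]; exact: F_max.
- by move=> _ /imsetP[i _ ->]; exact: (chain_far n6 k2 nk).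
(* The facets go before the chains: [chain_step] requires that [full_set], which here is [F b], is
   not contained in the simplex. *)
- apply: homotopy_equivalent_trans (chain_collapse (S := [set T0] :|: [set G in Fs]) R k2 nk _ _) _.
  + move=> t b /avoidP[_ tS]; have := tS (F b); rewrite !inE => /(_ ltac:(by case: (b); rewrite eqxx ?orbT)).
    apply: contra => /(bset_sub n6) h; apply/(bset_sub n6) => p pn hp.
    by apply: h; rewrite ?hp.
  + move=> t b j s _ tb jk j2; rewrite in_setU in_set1 in_set => /orP[/eqP ->|/FsP[b' ->]].
      apply: (mixed_T0 _ b) => e; rewrite in_setU1 negb_or tb xpair_eqE.
      by case: (b).
    apply/negP => /(bset_sub n6) h.
    have [eb|bb] := eqVneq b' b.
      have := h (3 * j + 2); rewrite eb in_setU1 xpair_eqE eqxx o_eq; try lia.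
      by rewrite (negbTE j2) orbF => /(_ ltac:(lia) ltac:(lia)); lia.
    have := h 1; rewrite in_setU1 xpair_eqE (negbTE bb) /= => /(_ ltac:(lia) ltac:(lia)).
    by have -> : b' = ~~ b by [case: (b') (b) bb => -[]]; rewrite (negbTE (tb _)).
  + apply: homotopy_equivalent_simplices => t; rewrite !avoid_avoid.
    apply: avoid_eq => s; rewrite !inE -/T0 -!orbA; congr orb.
    by case: (s == T0); rewrite /= ?orbT ?orbF.
- move=> t b; apply: (cone_step k2 nk (S := [set G in Fs] :|: chains n k)).
  + by rewrite avoid_avoid.
  + move=> s b'; rewrite in_setU in_set => /orP[/FsP[b1 ->]|]; last exact: (chain_apex n6 k2 nk b').
    by rewrite in_bset; lia.
  + by move=> j; rewrite in_setU imset_f ?orbT.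
  + move=> _; rewrite in_setU in_set; have -> : full_set n k b = F b.
      apply/setP => -[b' i]; rewrite !inE /=; have := ltn_ord i.
      by case: (b' == b) => //=; lia.
    by rewrite F_in.
  + by [].
Qed.

End Case1.

(** * The case of remainder 2 *)

Section Case2.
Variables (R : realType) (n k : nat).
Hypotheses (n6 : 6 <= n) (k2 : 2 <= k) (nk : n = 3 * k + 1 + true).
Implicit Types (t : {set bool * 'I_n}) (b : bool).

Local Notation o := (o n6).
Local Notation X := (X n).
Local Notation bset := (@bset n).
Local Notation Z := (Z k n6).

Let kn : 3 * k <= n. Proof. by rewrite nk -addnA leq_addr. Qed.

Let F b : {set bool * 'I_n} := bset b (fun p => (p < 3 * k) && (p %% 3 != 2)).
Let Fs := [seq F b | b <- [:: true; false]].
Let K := avoid Z (chains n k).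

Let FsP G : G \in Fs -> exists b, G = F b.
Proof. by rewrite !inE => /orP[] /eqP ->; [exists true|exists false]. Qed.

Let F_in b : F b \in Fs.
Proof. by rewrite !inE; case: b; rewrite eqxx ?orbT. Qed.

Let k0 : 0 < k. Proof. by lia. Qed.

(** This is why the chains are collapsed first here: in [Z] the vertex [3k + 1] can be added to
    [F b], keeping the gaps [3k - 1] and [3k], but the result contains the chain of block 0. Adding
    [3k] instead leaves no pair of gaps. *)
Let F_max b t : t \in simplices K -> F b \subset t -> t = F b.
Proof.
move=> /avoidP[tZ tc] Ft; have [tX tJ] := (ZP _ _ _).1 tZ.
have tb : forall e, (~~ b, e) \notin t.
  by apply: (far_other (residue_far n6 k2 nk b _ _) _ tX Ft) => // e; exact: other_bset.
have hF p : p < n -> (p < 3 * k) && (p %% 3 != 2) -> (b, o p) \in t.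
  by move/(bset_sub n6): Ft => h; exact: h.
apply/eqP; rewrite eqEsubset Ft andbT; apply/subsetP => -[b' i] it.
have eb : b' = b by case: b b' it tb {hF Ft} => -[] // it /(_ i); rewrite it.
rewrite eb in it *; rewrite -(oE n6 i) in it *; have ik := ltn_ord i.
rewrite in_bset// eqxx /=; apply/negPn/negP => hi.
have [ik3|ik3] := ltnP i (3 * k).
  have := tJ b (i %/ 3) ltac:(lia); have -> : 3 * (i %/ 3) + 2 = i by lia.
  by rewrite it hF => [/(_ isT)| |]; lia.
have [ie|ie] := eqVneq (i : nat) (3 * k + 1).
  have := tc (chain_set n (b, Ordinal k0)); rewrite imset_f// => /(_ isT) /negP; apply.
  apply/(bset_sub n6) => p pn /= hp; have [->|pe] := eqVneq p (3 * k + 1).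
    by rewrite -ie.
  by apply: hF => //; move: hp; rewrite /chain_pred; lia.
have ie' : nat_of_ord i = 3 * k by lia.
have [x [y [xn yn xy xt yt]]] := X_gap_val n6 b tX.
have hq p : p < n -> (b, o p) \notin t -> p = 3 * k + 1 \/ p %% 3 = 2 /\ p < 3 * k.
  move=> pn pt; have pk : p != 3 * k.
    by apply: contraNneq pt => ->; rewrite -ie'.
  have [|pk1] := eqVneq p (3 * k + 1); first by left.
  have pk' : p < 3 * k by move: pn pk pk1 nk; clear; lia.
  right; split=> //; apply/eqP; apply: contraNT pt => p3.
  by apply: hF => //; rewrite pk'.
by move: (hq x xn xt) (hq y yn yt) xy nk; clear; lia.
Qed.

Lemma wedge_case2 : homotopy_equivalent R (realization R X)
  (wedge_spheres R [:: 2; 2 * k - 1; 2 * k - 1]).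
Proof.
apply: homotopy_equivalent_trans (X_Z R n6 k2 kn) _.
have := @chain_collapse R n k true n6 k2 nk finset.set0; rewrite avoid0.
move=> h; apply: homotopy_equivalent_trans (h _ _) _ => {h}.
- by move=> t b /ZP[tX _]; exact: (full_gap n6 k2 nk).
- by move=> t b j s; rewrite in_set0.
have -> : [:: 2; 2 * k - 1; 2 * k - 1] =
    2 :: [seq #|(G : {set bool * 'I_n})|.-1 | G <- Fs].
  by rewrite /= /F !(card_residue n6 k2 kn)// subn1.
apply: (@strip_wedge R n k n6 k2 kn K (o (3 * k)) Fs _ _ _ _ _ _ finset.set0).
- by move=> t /avoidP[/ZP[]].
- move=> t a e tX ta te; apply/avoidP; split; first exact: Z_mixed ta te.
  by move=> _ /imsetP[i _ ->]; exact: far_mixed (chain_far n6 k2 nk i) tX ta te.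
- exact: (@residue_pair_uniq _ _ _ n6 k2 nk 2).
- move=> _ /FsP[b ->]; apply/avoidP; split; first exact: (residue_Z n6 k2 nk).
  move=> _ /imsetP[[b' j] _ ->]; apply/negP => /(bset_sub n6) h.
  by have := h (3 * k + 1); rewrite in_bset; [move=> /(_ ltac:(lia) ltac:(lia))|]; lia.
- by move=> _ /FsP[b ->]; exact: (residue_far n6 k2 nk).
- by move=> _ t /FsP[b ->]; exact: F_max.
- by move=> s; rewrite in_set0.
- apply: homotopy_equivalent_simplices => t; rewrite !avoid_avoid.
  apply: avoid_eq => s; rewrite !inE /= -!orbA.
  by do 2!congr orb; case: (s == [set _; _; _]); rewrite /= ?orbT ?orbF.
- move=> t b; rewrite avoid0; apply: (cone_step k2 nk (S := [set G in Fs] :|: chains n k)).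
  + by rewrite avoid_avoid setUC.
  + move=> s b'; rewrite in_setU in_set => /orP[/FsP[b1 ->]|]; last exact: (chain_apex n6 k2 nk b').
    by rewrite in_bset; lia.
  + by move=> j; rewrite in_setU imset_f ?orbT.
  + by [].
  + by move=> _; rewrite in_setU in_set F_in.
Qed.

End Case2.

(** * Filtrations with one maximum and one minimum *)

Section Arcs.
Variables (R : realType) (n : nat).
Hypothesis n6 : 6 <= n.
Implicit Types (t : {set bool * 'I_n}) (b : bool) (x y a e i : 'I_n).

(* The number of steps of [ordS] from [x] to [y]. *)
Definition cd x y : nat := if x <= y then y - x else y + n - x.

Lemma cd_cases x y : (x <= y /\ cd x y = y - x) \/ (y < x /\ cd x y = y + n - x).
Proof. by rewrite /cd; case: leqP; [left|right]. Qed.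

Lemma cd_lt x y : cd x y < n.
Proof. by have := ltn_ord x; have := ltn_ord y; have := cd_cases x y; lia. Qed.

Lemma cdxx x : cd x x = 0.
Proof. by rewrite /cd leqnn subnn. Qed.

Lemma cd_rel x i j : (cd x i <= cd x j /\ cd i j = cd x j - cd x i) \/
  (cd x j < cd x i /\ cd i j = cd x j + n - cd x i).
Proof.
have := ltn_ord x; have := ltn_ord i; have := ltn_ord j.
by have := cd_cases x i; have := cd_cases x j; have := cd_cases i j; lia.
Qed.

Lemma cd_le x i j : cd x i <= cd x j -> cd i j = cd x j - cd x i.
Proof. by have := cd_rel x i j; lia. Qed.

Lemma cd_gt x i j : cd x j < cd x i -> cd i j = cd x j + n - cd x i.
Proof. by have := cd_rel x i j; lia. Qed.

Lemma cd_inj x i j : cd x i = cd x j -> i = j.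
Proof.
move=> h; apply: val_inj => /=; have := ltn_ord x; have := ltn_ord i; have := ltn_ord j.
by have := cd_cases x i; have := cd_cases x j; lia.
Qed.

Lemma cd_ordS x i : (cd x i).+1 < n -> cd x (ordS i) = (cd x i).+1.
Proof.
have := ltn_ord x; have := ltn_ord i; have := ordS_cases n6 i.
by have := cd_cases x i; have := cd_cases x (ordS i); lia.
Qed.

Lemma cd_ord_pred x i : 0 < cd x i -> cd x (ord_pred i) = (cd x i).-1.
Proof.
have := ltn_ord x; have := ltn_ord (ord_pred i); have := ordS_cases n6 (ord_pred i).
rewrite ord_predK.
by have := cd_cases x i; have := cd_cases x (ord_pred i); lia.
Qed.

Lemma cd_pred x : cd x (ord_pred x) = n.-1.
Proof.
have := ltn_ord x; have := ordS_cases n6 (ord_pred x); rewrite ord_predK.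
by have := cd_cases x (ord_pred x); lia.
Qed.

Lemma cd_onto x m : m < n -> exists y, cd x y = m.
Proof.
move=> mn; exists (o n6 (x + m)); have := ltn_ord x; have := cd_cases x (o n6 (x + m)).
have [h|h] := ltnP (x + m) n.
  by have -> : nat_of_ord (o n6 (x + m)) = x + m by [rewrite /= modn_small]; lia.
have -> : nat_of_ord (o n6 (x + m)) = x + m - n; last by lia.
have := ltn_ord x => xn.
by rewrite /= -{1}(subnK h) modnDr modn_small; lia.
Qed.

Definition arc x y i := 0 < cd x i < cd x y.

(* [(true, i)] and [(false, i)] stand for the pairs ([i], edge towards
   [ordS i]) and ([i], edge towards [ord_pred i]). A filtration with a single
   local maximum [x] and minimum [y] matches the first on the arc from [x] to
   [y] and the second on the arc from [y] to [x]. *)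
Definition Delta_simplices : {set {set bool * 'I_n}} := [set t : {set bool * 'I_n} |
  (t != set0) && [exists x, exists y, (x != y) && [forall b, forall i,
    ((b, i) \in t) ==> arc (if b then x else y) (if b then y else x) i]]].

Lemma DeltaP t : reflect (t != set0 /\ exists x y, x <> y /\
    forall b i, (b, i) \in t -> arc (if b then x else y) (if b then y else x) i)
  (t \in Delta_simplices).
Proof.
rewrite inE; apply: (iffP andP) => -[t0].
  move=> /existsP[x /existsP[y /andP[/eqP xy /forallP h]]]; split=> //.
  by exists x, y; split=> // b i; have /forallP/(_ i)/implyP := h b.
move=> [x [y [/eqP xy h]]]; split=> //; apply/existsP; exists x; apply/existsP; exists y.
by rewrite xy; apply/forallP => b; apply/forallP => i; apply/implyP; exact: h.
Qed.

Fact Delta_nonempty : set0 \notin Delta_simplices.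
Proof. by rewrite inE eqxx. Qed.

Fact Delta_closed (s t : {set bool * 'I_n}) : s \in Delta_simplices -> t \subset s ->
  t != set0 -> t \in Delta_simplices.
Proof.
move=> /DeltaP[_ [x [y [xy h]]]] /subsetP ts t0; apply/DeltaP; split=> //.
by exists x, y; split=> // b i /ts; exact: h.
Qed.

Definition Delta : complex (bool * 'I_n)%type := Complex Delta_nonempty Delta_closed.

Let arc_swap x y e : x <> y -> arc y x e <-> cd x y < cd x e.
Proof.
move=> xy; have y0 : 0 < cd x y.
  by rewrite lt0n; apply/eqP => h; apply: xy; apply: (@cd_inj x); rewrite cdxx.
have := cd_lt x y; have := cd_lt x e; have := cd_rel x y e; have := cd_rel x y x.
by rewrite /arc cdxx; split; lia.
Qed.

(* The two colours play symmetric roles, so one may measure from the start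
   of the arc of either of them. *)
Lemma Delta_from b t : t \in simplices Delta <-> t != set0 /\
  exists x m, [/\ 0 < m < n, forall i, (b, i) \in t -> 0 < cd x i < m &
    forall i, (~~ b, i) \in t -> m < cd x i].
Proof.
split.
  move=> /DeltaP[t0 [x [y [xy h]]]]; split=> //.
  exists (if b then x else y), (cd (if b then x else y) (if b then y else x)).
  have ne : (if b then x else y) <> (if b then y else x) by case: (b) => // /esym.
  split; last 2 first.
  - by move=> i /h.
  - move=> i /h hi; apply/(arc_swap _ ne); move: hi; by case: (b).
  rewrite cd_lt andbT lt0n; apply/eqP => h0; apply: ne.
  by apply: (@cd_inj (if b then x else y)); rewrite cdxx.
move=> [t0 [x [m [/andP[m0 mn] hb hnb]]]].
have [y ym] := cd_onto x mn; apply/DeltaP; split=> //.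
have xy : x <> y by move=> e; move: ym; rewrite -e cdxx; lia.
exists (if b then x else y), (if b then y else x); split.
  by case: (b) => // /esym.
move=> b' i it; have [eb|bb] := eqVneq b' b.
  by rewrite eb in it *; rewrite /arc; have := hb i it; case: (b); rewrite /= ym.
have eb : b' = ~~ b by case: (b') (b) bb => -[].
rewrite eb in it *; have := hnb i it; rewrite -ym => hi.
by have := (arc_swap i xy).2 hi; case: (b).
Qed.

Notation idx := (bool * 'I_n * 'I_n * 'I_n)%type.

Definition span_set (i : idx) : {set bool * 'I_n} :=
  let: (b, a, a', e) := i in [set (b, a); (b, a'); (~~ b, e)].

(** The third vertex records a direction: in a simplex of [Delta], the condition [cd a a' < cd a e]
    says that [a'] comes after [a] on the arc of colour [b]. *)
Definition span_idx : {set idx} :=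
  [set i : idx | let: (b, a, a', e) := i in (2 <= cd a a') && (cd a a' < cd a e)].

Let span_ap (i : idx) : bool * 'I_n := let: (b, a, _, _) := i in (b, ordS a).
Let span_rk (i : idx) : nat := let: (b, a, a', _) := i in n - cd a a' + (if b then 0 else n).

Let near_side x m a a' e : cd x a < m -> cd x a' < m -> m < cd x e ->
  (cd a a' < cd a e) = (cd x a <= cd x a').
Proof.
move=> h1 h2 h3; rewrite (@cd_le x a e); last by lia.
have := cd_lt x e; have [h|h] := leqP (cd x a) (cd x a').
  by rewrite (cd_le h); lia.
by rewrite (cd_gt h); lia.
Qed.

Let far_side x m a a' e : m < cd x a -> m < cd x a' -> cd x e < m ->
  (cd a a' < cd a e) = (cd x a <= cd x a').
Proof.
move=> h1 h2 h3; rewrite (@cd_gt x a e); last by lia.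
have := cd_lt x a; have := cd_lt x a'; have [h|h] := leqP (cd x a) (cd x a').
  by rewrite (cd_le h); lia.
by rewrite (cd_gt h); lia.
Qed.

Let rank_le (s s' c : nat) : s' < n -> n - s' + c <= n - s + c -> s <= s'.
Proof. by lia. Qed.

Let rank_lt (s s' c : nat) : s < s' -> s' < n -> n - s' + c < n - s + c.
Proof. by lia. Qed.

Let spanP b a a' e t : (span_set (b, a, a', e) \subset t) =
  [&& (b, a) \in t, (b, a') \in t & (~~ b, e) \in t].
Proof. by rewrite !subUset !sub1set andbA. Qed.

Let in_span b a a' e : ((b, a, a', e) \in span_idx) = (2 <= cd a a') && (cd a a' < cd a e).
Proof. by rewrite inE. Qed.

(** The purpose is to confine each colour of a mixed simplex to two adjacent vertices. Long spans go
    first, and those of colour [true] before those of colour [false]. The apex [ordS a] lies between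
    [a] and [a']. If it is an end of a new span at least as long, moving that end out to [a'] or [a]
    gives a longer span in [t], already removed; if it is the third vertex of a new set, [a] can
    replace it. *)
Lemma span_collapse : homotopy_equivalent R (realization R Delta)
  (realization R (avoid Delta (span_set @: span_idx))).
Proof.
apply: (collapse R (c := span_ap) (rk := span_rk)).
- by move=> [[[b a] a'] e] _; apply/set0Pn; exists (b, a); rewrite !inE eqxx.
- move=> [[[b a] a'] e]; rewrite in_span => /andP[h1 h2].
  rewrite /span_ap /span_set !inE !xpair_eqE eqxx /=; apply/negP.
  have ca := cdxx a; have := cd_lt a a' => an.
  have cS : cd a (ordS a) = 1 by rewrite cd_ordS ca; lia.
  case/orP => [/orP[]|/andP[]]; last by case: (b).
    by move=> /eqP h; move: cS; rewrite h ca.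
  by move=> /eqP h; move: cS; rewrite h; lia.
- move=> [[[b a] a'] e] t; rewrite in_span => /andP[h1 h2] tD.
  rewrite spanP => /and3P[ta ta' te] low.
  have [t0 [x [m [/andP[m0 mn] hb hnb]]]] := (Delta_from b t).1 tD.
  have /andP[pa1 pa2] := hb a ta; have /andP[pa'1 pa'2] := hb a' ta'; have pe := hnb e te.
  have en := cd_lt x e.
  have aa' : cd x a <= cd x a' by rewrite -(near_side pa2 pa'2 pe).
  have sE := cd_le aa'; rewrite sE in h1.
  have pS : cd x (ordS a) = (cd x a).+1 by apply: cd_ordS; move: pa2 mn; clear; lia.
  have hb' i : (b, i) \in span_ap (b, a, a', e) |: t -> 0 < cd x i < m.
    rewrite in_setU1 => /orP[/eqP[->]|/hb//]; rewrite pS.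
    by move: h1 pa'2; clear; lia.
  have nbt i : (~~ b, i) \in span_ap (b, a, a', e) |: t -> (~~ b, i) \in t.
    by rewrite in_setU1 xpair_eqE => /orP[/andP[]|//]; case: (b).
  split.
    apply/(Delta_from b); split; first by apply/set0Pn; exists (b, ordS a); rewrite setU11.
    exists x, m; split=> //; first by rewrite m0.
    by move=> i /nbt; exact: hnb.
  move=> [[[b1 a1] a1'] e1]; rewrite in_span => /andP[k1 k2] rk.
  rewrite !spanP => /and3P[u1 u2 u3]; apply: contrapT => /negP nt.
  have cS (c : bool) i : (c, i) \in span_ap (b, a, a', e) |: t -> (c, i) \notin t -> c = b /\ i = ordS a.
    by rewrite in_setU1 => /orP[/eqP[-> ->]//|->].
  have [eb|nb] := eqVneq b1 b.
    rewrite eb in u1 u2 u3 nt rk; have t3 := nbt _ u3.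
    have /andP[q1 q1'] := hb' _ u1; have /andP[q2 q2'] := hb' _ u2; have q3 := hnb _ t3.
    have e1n := cd_lt x e1.
    have aa1 : cd x a1 <= cd x a1' by rewrite -(near_side q1' q2' q3).
    have s1E := cd_le aa1.
    have rk' := rank_le (cd_lt _ _) rk; rewrite sE s1E in rk'; rewrite s1E in k1.
    have more a2 a2' : (b, a2) \in t -> (b, a2') \in t -> cd x a' - cd x a < cd x a2' - cd x a2 -> False.
      move=> v1 v2 lt; have /andP[w1 w1'] := hb _ v1; have /andP[w2 w2'] := hb _ v2.
      have le2 : cd x a2 <= cd x a2' by move: lt; clear; lia.
      have s2E := cd_le le2.
      have := low (b, a2, a2', e1); rewrite in_span spanP v1 v2 t3 /span_rk.
      rewrite (near_side w1' w2' q3) le2 andbT s2E => lw.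
      have g2 : 2 <= cd x a2' - cd x a2 by move: h1 lt; clear; lia.
      have := lw g2; rewrite sE => /(_ _) lw'.
      suff lt' : n - (cd x a2' - cd x a2) + (if b then 0 else n) <
          n - (cd x a' - cd x a) + (if b then 0 else n) by have := lw' lt'.
      by apply: rank_lt => //; rewrite -s2E cd_lt.
    have [t1|n1] := boolP ((b, a1) \in t).
      have [t2|n2] := boolP ((b, a1') \in t); first by move: nt; rewrite t1 t2 t3.
      have [_ ea1'] := cS _ _ u2 n2; apply: (more a1 a') => //.
      by move: rk' k1 h1; rewrite ea1' pS; clear; lia.
    have [_ ea1] := cS _ _ u1 n1; apply: (more a a1') => //; last first.
      by move: rk' k1 h1; rewrite ea1 pS; clear; lia.
    apply: contrapT => /negP n2; have [_ ea1'] := cS _ _ u2 n2.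
    by move: k1; rewrite ea1 ea1' subnn.
  have eb : b1 = ~~ b by case: (b1) (b) nb => -[].
  rewrite eb in u1 u2 u3 nt rk; rewrite negbK in u3 nt.
  have t1 := nbt _ u1; have t2 := nbt _ u2; rewrite t1 t2 /= in nt.
  have [_ ee] := cS _ _ u3 nt; rewrite ee in k2.
  have q1 := hnb _ t1; have q2 := hnb _ t2.
  have pSm : cd x (ordS a) < m by rewrite pS; move: h1 pa'2; clear; lia.
  rewrite (far_side q1 q2 pSm) in k2.
  (* A set of the other colour and of no larger rank must have colour [true], by the offset [n] in
     [span_rk]. *)
  have bt : b = false.
    move: rk; rewrite /span_rk; case: (b) => //=; have := cd_lt a1 a1'; clear; lia.
  have := low (~~ b, a1, a1', a); rewrite in_span spanP t1 t2 negbK ta /span_rk.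
  rewrite (far_side q1 q2 pa2) k2 k1 bt /= => lw.
  suff lt : n - cd a1 a1' + 0 < n - cd a a' + n by have := lw isT lt.
  by have := cd_lt a1 a1'; have := cd_lt a a'; clear; lia.
Qed.

Let D1 := avoid Delta (span_set @: span_idx).

Definition wide_set (i : 'I_n * 'I_n) : {set bool * 'I_n} := [set (true, i.1); (false, i.2)].
(** The minimum lies strictly between [a] and [e], so these distances are at least 2. The ones kept,
    2 and 3, become the two mixed edges at [a] once the colour [false] is shifted by two. *)
Definition wide_idx : {set 'I_n * 'I_n} := [set i : 'I_n * 'I_n | 4 <= cd i.1 i.2].

Let wideP a e t : (wide_set (a, e) \subset t) = ((true, a) \in t) && ((false, e) \in t).
Proof. by rewrite subUset !sub1set. Qed.

(** The widest pairs go first. Together with the absence of spans this leaves, at the turn of [a]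
    and [e], only [a] and [ordS a] in colour [true] and only [ord_pred e] and [e] in colour [false].
    The apex [ord_pred e] therefore creates neither a span nor a pair as wide. *)
Lemma wide_collapse : homotopy_equivalent R (realization R D1)
  (realization R (avoid D1 (wide_set @: wide_idx))).
Proof.
apply: (collapse R (c := fun i : 'I_n * 'I_n => (false, ord_pred i.2))
  (rk := fun i : 'I_n * 'I_n => n - cd i.1 i.2)).
- by move=> [a e] _; apply/set0Pn; exists (true, a); rewrite !inE eqxx.
- move=> [a e] _; rewrite !inE !xpair_eqE /=; apply/negP => /eqP h.
  by have := cd_pred e; rewrite h cdxx; lia.
- move=> [a e] t; rewrite inE /= => m4 /avoidP[tD tS].
  rewrite wideP => /andP[ta te] low.
  have [t0 [x [m [/andP[m0 mn] hc hd]]]] := (Delta_from true t).1 tD.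
  have /andP[pa0 pa] := hc a ta; have pe := hd e te; have le := cd_lt x e.
  have mE a1 e1 : cd x a1 < m -> m < cd x e1 -> cd a1 e1 = cd x e1 - cd x a1.
    by move=> g1 g2; apply: cd_le; move: g1 g2; clear; lia.
  have low' a1 e1 : (true, a1) \in t -> (false, e1) \in t -> cd a1 e1 <= cd a e.
    move=> t1 t2; rewrite leqNgt; apply/negP => lt; have l1 := cd_lt a1 e1.
    have := low (a1, e1); rewrite wideP t1 t2 inE /= => lw.
    have g4 : 4 <= cd a1 e1 by move: m4 lt; clear; lia.
    suff lt' : n - cd a1 e1 < n - cd a e by have := lw g4 lt'.
    by move: lt l1; clear; lia.
  have span b1 a1 a2 e1 : (b1, a1) \in t -> (b1, a2) \in t -> (~~ b1, e1) \in t ->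
      cd a1 a2 < cd a1 e1 -> cd a1 a2 < 2.
    move=> t1 t2 t3 lt; rewrite ltnNge; apply/negP => ge.
    have := tS (span_set (b1, a1, a2, e1)).
    by rewrite imset_f ?in_span ?ge// => /(_ isT); rewrite spanP t1 t2 t3.
  have Cs a1 : (true, a1) \in t -> cd x a <= cd x a1 <= (cd x a).+1.
    move=> t1; have /andP[_ p1] := hc a1 t1.
    have := low' a1 e t1 te; rewrite (mE a1 e p1 pe) (mE a e pa pe) => g1.
    have g2 : cd x a <= cd x a1 by move: g1 pa pe p1; clear; lia.
    have := @span true a a1 e ta t1 te; rewrite (near_side pa p1 pe) g2 (cd_le g2).
    by move=> /(_ isT); clear; lia.
  have Ds e1 : (false, e1) \in t -> (cd x e).-1 <= cd x e1 <= cd x e.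
    move=> t1; have p1 := hd e1 t1.
    have := low' a e1 ta t1; rewrite (mE a e1 pa p1) (mE a e pa pe) => g1.
    have g2 : cd x e1 <= cd x e by move: g1 pa pe p1; clear; lia.
    have := @span false e1 e a t1 te ta; rewrite (far_side p1 pe pa) g2 (cd_le g2).
    by move=> /(_ isT); clear; lia.
  have m4' : 4 + cd x a <= cd x e by move: m4; rewrite (mE a e pa pe); clear; lia.
  have pp : cd x (ord_pred e) = (cd x e).-1 by apply: cd_ord_pred; move: pe; clear; lia.
  have Ct a1 : (true, a1) \in (false, ord_pred e) |: t -> (true, a1) \in t.
    by rewrite in_setU1 xpair_eqE.
  have Ds' e1 : (false, e1) \in (false, ord_pred e) |: t -> (cd x e).-1 <= cd x e1 <= cd x e.
    by rewrite in_setU1 => /orP[/eqP[->]|/Ds//]; rewrite pp leqnn leq_pred.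
  have M0 : (cd x a).+2 < n by move: m4' le; clear; lia.
  split.
    apply/avoidP; split.
      apply/(Delta_from true); split; first by apply/set0Pn; exists (true, a); rewrite in_setU1 ta orbT.
      (* The minimum is moved two steps past [a]: beyond [ordS a] and, as [cd a e] is at least 4,
         still before [ord_pred e]. *)
      exists x, (cd x a).+2; split=> // i.
        by move=> /Ct it; have := Cs i it; have := hc i it; clear; lia.
      by move=> /Ds'; move: m4'; clear; lia.
    move=> _ /imsetP[[[[b1 a1] a2] e1] + ->]; rewrite in_span => /andP[g1 g2].
    rewrite spanP; apply/negP => /and3P[].
    case: b1 => /= [/Ct/Cs v1 /Ct/Cs v2 /Ds' v3|/Ds' v1 /Ds' v2 /Ct/Cs v3].
      have w1 : cd x a1 < (cd x a).+2 by move: v1; clear; lia.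
      have w2 : cd x a2 < (cd x a).+2 by move: v2; clear; lia.
      have w3 : (cd x a).+2 < cd x e1 by move: v3 m4'; clear; lia.
      rewrite (near_side w1 w2 w3) in g2; move: g1; rewrite (cd_le g2).
      by move: v1 v2; clear; lia.
    have w1 : (cd x a).+2 < cd x a1 by move: v1 m4'; clear; lia.
    have w2 : (cd x a).+2 < cd x a2 by move: v2 m4'; clear; lia.
    have w3 : cd x e1 < (cd x a).+2 by move: v3; clear; lia.
    rewrite (far_side w1 w2 w3) in g2; move: g1; rewrite (cd_le g2).
    by move: v1 v2; clear; lia.
  move=> [a1 e1]; rewrite inE /= => g1 rk; rewrite !wideP => /andP[/Ct u1].
  rewrite u1 in_setU1 => /orP[/eqP[ee]|//].
  have v1 := Cs _ u1.
  have g2 : cd x a1 <= cd x (ord_pred e) by rewrite pp; move: m4' v1; clear; lia.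
  move: rk; rewrite ee (mE a e pa pe) (cd_le g2) pp.
  by move: m4' le v1; clear; lia.
Qed.

Let D2 := avoid D1 (wide_set @: wide_idx).

(** Conversely, the arcs are rebuilt from local data. A mixed simplex admits a maximum just before
    its first [true] vertex and a minimum two or three steps after that maximum; a one-coloured
    simplex has room for both in its pair of gaps. *)
Lemma narrowP t : t \in simplices D2 <-> [/\ t != set0,
  forall a e, (true, a) \in t -> (false, e) \in t -> cd a e = 2 \/ cd a e = 3 &
  forall b, exists i, (b, i) \notin t /\ (b, ordS i) \notin t].
Proof.
split.
  move=> /avoidP[/avoidP[tD tS] tW].
  split; first by case: ((Delta_from true t).1 tD).
  - move=> a e ta te; have [t0 [x [m [mn hc hd]]]] := (Delta_from true t).1 tD.
    have := hc a ta; have := hd e te; have := cd_rel x a e.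
    have : ~~ (4 <= cd a e).
      apply/negP => h; have := tW (wide_set (a, e)).
      by rewrite imset_f ?inE// => /(_ isT); rewrite wideP ta te.
    by lia.
  - move=> b; have [t0 [x [m [mn hc hd]]]] := (Delta_from b t).1 tD.
    exists (ord_pred x); rewrite ord_predK; split; apply/negP => /hc.
      by rewrite cd_pred; lia.
    by rewrite cdxx.
move=> [t0 tm tg].
have cd1 u v w : cd u v = 2 \/ cd u v = 3 -> cd w v = 2 \/ cd w v = 3 ->
    w = u \/ w = ordS u \/ u = ordS w.
  move=> h1 h2; have r1 := cd_rel v u w; have r2 := cd_rel v w u.
  have u1 := cd_rel v u v; have w1 := cd_rel v w v; rewrite cdxx in u1 w1.
  have lu := cd_lt v u; have lw := cd_lt v w.
  have [e|[e|e]] : cd v w = cd v u \/ cd v w = (cd v u).+1 \/ cd v u = (cd v w).+1.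
  - by move: h1 h2 u1 w1 lu lw; clear; lia.
  - by left; exact: cd_inj e.
  - have lt : (cd v u).+1 < n by rewrite -e.
    by right; left; apply: (@cd_inj v); rewrite cd_ordS.
  - have lt : (cd v w).+1 < n by rewrite -e.
    by right; right; apply: (@cd_inj v); rewrite cd_ordS.
have mixed_lt a e : (true, a) \in t -> (false, e) \in t -> cd a e < 4.
  by move=> ta te; case: (tm a e ta te) => ->.
have tD : t \in simplices Delta.
  have [[a [e [ta te]]]|nmix] := pselect (exists a e, (true, a) \in t /\ (false, e) \in t).
    apply/(Delta_from true); split=> //.
    have at1 u : cd (ord_pred u) u = 1.
      by rewrite -{2}(ord_predK u) cd_ordS cdxx//; lia.
    have atD u v : cd u v = 2 \/ cd u v = 3 -> cd (ord_pred u) v = (cd u v).+1.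
      move=> h; have := cd_rel (ord_pred u) u v; rewrite at1.
      by have := cd_lt (ord_pred u) v; move: h n6; clear; lia.
    (* Two adjacent [true] vertices leave only distance 3 from the first one to any [false] vertex,
       so the minimum fits right after the second. *)
    have [[a1 [u1 u2]]|nadj] := pselect (exists a1, (true, a1) \in t /\ (true, ordS a1) \in t).
      have at2 : cd (ord_pred a1) (ordS a1) = 2 by rewrite cd_ordS at1//; lia.
      have D3 v : (false, v) \in t -> cd a1 v = 3.
        move=> tv; have := tm _ _ u1 tv; have := tm _ _ u2 tv.
        have := cd_rel (ord_pred a1) (ordS a1) v; have := cd_rel (ord_pred a1) a1 v.
        by rewrite at1 at2; have := cd_lt (ord_pred a1) v; move: n6; clear; lia.
      exists (ord_pred a1), 3; split; first by lia.
        move=> i ti; have := tm i e ti te; have := D3 e te.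
        have := cd_rel (ord_pred a1) i e; rewrite (atD a1 e); last by right; exact: D3.
        by have := cd_lt (ord_pred a1) i; move: n6; clear; lia.
      by move=> i ti; have := D3 i ti => h; rewrite atD h; [|right].
    exists (ord_pred a), 2; split; first by lia.
      move=> i ti; have [->|[ei|ei]] := cd1 _ _ _ (tm _ _ ta te) (tm _ _ ti te).
      - by rewrite at1.
      - by case: nadj; exists a; rewrite -ei.
      - by case: nadj; exists i; rewrite -ei.
    by move=> i ti; rewrite atD; [case: (tm _ _ ta ti) => ->|exact: tm].
  have [b tb] : exists b, forall e, (~~ b, e) \notin t.
    have [[e te]|ne] := pselect (exists e, (false, e) \in t).
      exists false => a; apply/negP => ta; apply: nmix; by exists a, e.
    by exists true => e; apply/negP => te; apply: ne; exists e.
  apply/(Delta_from b); split=> //; have [i [gi gi']] := tg b.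
  have pi : cd (ordS i) i = n.-1 by rewrite -{2}(ordSK i) cd_pred.
  exists (ordS i), n.-1; split; first by lia.
    move=> j tj; have := cd_lt (ordS i) j.
    have j0 : cd (ordS i) j <> 0.
      by move=> h; case/negP: gi'; rewrite -(@cd_inj (ordS i) j (ordS i)) ?cdxx.
    have j1 : cd (ordS i) j <> n.-1.
      by move=> h; case/negP: gi; rewrite -(@cd_inj (ordS i) j i) ?pi.
    by move: j0 j1; clear; lia.
  by move=> j; rewrite (negbTE (tb j)).
apply/avoidP; split; last first.
  move=> _ /imsetP[[a e] + ->]; rewrite inE wideP /= => h.
  by apply/negP => /andP[ta te]; have := mixed_lt _ _ ta te; rewrite ltnNge h.
apply/avoidP; split=> // _ /imsetP[[[[b a] a'] e] + ->].
rewrite in_span spanP => /andP[h1 h2]; apply/negP => /and3P[].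
case: b => /= ta ta' te.
  have := tm _ _ ta te; have := tm _ _ ta' te; have := cd_rel a a' e.
  by move: h1 h2 n6; clear; lia.
have := tm _ _ te ta; have := tm _ _ te ta'; have := cd_rel e a a'.
by have := cd_rel e a e; rewrite cdxx; move: h1 h2 n6; clear; lia.
Qed.

Let shift (v : bool * 'I_n) : bool * 'I_n :=
  if v.1 then v else (false, ord_pred (ord_pred v.2)).
Let unshift (v : bool * 'I_n) : bool * 'I_n :=
  if v.1 then v else (false, ordS (ordS v.2)).

Let shiftK : cancel shift unshift.
Proof. by move=> [[] i]; rewrite /shift /unshift //= !ord_predK. Qed.

Let unshiftK : cancel unshift shift.
Proof. by move=> [[] i]; rewrite /shift /unshift //= !ordSK. Qed.

Let in_shift t v : (v \in shift @: t) = (unshift v \in t).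
Proof. by rewrite -{1}(unshiftK v) (mem_imset _ _ (can_inj shiftK)). Qed.

Let cdS a : [/\ cd a (ordS a) = 1, cd a (ordS (ordS a)) = 2 &
  cd a (ordS (ordS (ordS a))) = 3].
Proof.
have h1 : cd a (ordS a) = 1 by rewrite cd_ordS cdxx//; lia.
have h2 : cd a (ordS (ordS a)) = 2 by rewrite cd_ordS h1//; lia.
by split=> //; rewrite cd_ordS h2//; lia.
Qed.

Let shift_X t : (t \in simplices D2) <-> (shift @: t \in simplices (X n)).
Proof.
split.
  move=> /narrowP[t0 tm tg]; apply/XP; split.
  - by case/set0Pn: t0 => v vt; apply/set0Pn; exists (shift v); exact: imset_f.
  - move=> a e; rewrite !in_shift /unshift /= => ta te; have [_ c2 c3] := cdS a.
    case: (tm _ _ ta te) => h; [left|right]; do 2!apply: ordS_inj;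
    by apply: (@cd_inj a); rewrite ?c2 ?c3.
  - move=> b; have [i [gi gi']] := tg b; case: b gi gi' => gi gi'.
      by exists i; rewrite !in_shift.
    by exists (ord_pred (ord_pred i)); rewrite !in_shift /unshift /= !ord_predK.
move=> /XP[t0 tm tg]; apply/narrowP; split.
- by apply: contraNneq t0 => ->; rewrite imset0.
- move=> a e ta te; have [_ c2 c3] := cdS a.
  have := tm a (ord_pred (ord_pred e)); rewrite !in_shift /unshift /= !ord_predK.
  move=> /(_ ta te)[] h; rewrite -(ord_predK e) -(ord_predK (ord_pred e)) h; first by left.
  by right.
- move=> b; have [i] := tg b; rewrite !in_shift; case: b => -[gi gi'].
    by exists i.
  by exists (ordS (ordS i)).
Qed.

Lemma Delta_X : homotopy_equivalent R (realization R Delta) (realization R (X n)).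
Proof.
apply: homotopy_equivalent_trans span_collapse _.
apply: homotopy_equivalent_trans wide_collapse _.
apply: (realization_iso R (can_inj shiftK)); apply/setP => t.
apply/idP/imsetP => [tX|[u uD ->]]; last exact/shift_X.
have e : t = shift @: (unshift @: t).
  by rewrite -imset_comp -[LHS]imset_id; apply: eq_imset => v /=; rewrite unshiftK.
by exists (unshift @: t) => //; apply/shift_X; rewrite -e.
Qed.

End Arcs.

(** * Strong Morse matchings on a cycle *)

Section StrongMorseCycle.
Variables (R : realType) (n : nat).
Hypothesis n6 : 6 <= n.
Implicit Types (g : 'I_n -> R) (b : bool) (v u a x y i : 'I_n).

Local Notation C := (cycle_complex n).
Local Open Scope ring_scope.

Let neS i : (ordS i == i) = false.
Proof. by apply: ordS_neq; lia. Qed.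

Let neSS i : (ordS (ordS i) == i) = false.
Proof.
apply/eqP => e; have := congr1 (@nat_of_ord n) e.
by have := ordS_cases n6 i; have := ordS_cases n6 (ordS i); lia.
Qed.

Let nePS i : (ord_pred i == ordS i) = false.
Proof. by rewrite -(inj_eq (@ordS_inj n)) ord_predK eq_sym neSS. Qed.

Let neP i : (ord_pred i == i) = false.
Proof. by rewrite -(inj_eq (@ordS_inj n)) ord_predK eq_sym neS. Qed.

Let single_in i : [set i] \in simplices C.
Proof. by rewrite !inE imset_f. Qed.

Let edge_in i : [set i; ordS i] \in simplices C.
Proof. by rewrite !inE (imset_f (fun i => [set i; ordS i])) ?orbT. Qed.

Let cycle_cases (s : {set 'I_n}) : s \in simplices C ->
  (exists i, s = [set i]) \/ (exists i, s = [set i; ordS i]).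
Proof. by rewrite !inE => /orP[] /imsetP[i _ ->]; [left|right]; exists i. Qed.

Let vertexC i : i \in vertices C.
Proof. by rewrite inE single_in. Qed.

Let nbr v u := (u == ordS v) || (u == ord_pred v).

Let nbr_edge v u : nbr v u -> [set v; u] \in simplices C.
Proof.
case/orP => /eqP ->; first exact: edge_in.
by have := edge_in (ord_pred v); rewrite ord_predK setUC.
Qed.

Let nbr_ne v u : nbr v u -> u != v.
Proof. by case/orP => /eqP ->; rewrite ?neS ?neP. Qed.

Let edge_nbr v (s : {set 'I_n}) : s \in simplices C -> s != finset.set0 ->
  v \notin s -> v |: s \in simplices C -> exists2 u, s = [set u] & nbr v u.
Proof.
move=> sC s0 vs /cycle_cases[[i e]|[i e]].
  case/set0Pn: s0 => w ws; have : w \in v |: s by rewrite in_setU1 ws orbT.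
  have : v \in v |: s by rewrite setU11.
  by rewrite e !inE => /eqP vi /eqP wi; move: vs; rewrite vi -wi ws.
have : v \in v |: s by rewrite setU11.
have sE : s = (v |: s) :\ v by rewrite setU1K.
rewrite {1}e !inE => /orP[] /eqP vi.
  exists (ordS i); last by rewrite /nbr vi eqxx.
  rewrite sE e vi; apply/setP => w; rewrite !inE; case: eqP => // ->.
  by rewrite eq_sym neS.
exists i; last by rewrite /nbr vi ordSK eqxx orbT.
rewrite sE e vi; apply/setP => w; rewrite !inE.
by case: (w =P ordS i) => [->|]; rewrite ?neS ?orbF //= orbF.
Qed.

Let low g v u := nbr v u && (g u <= g v).

Let in_sub g v (s : {set 'I_n}) : (s \in simplices (sublevel C g v)) =
  (s \in simplices C) && [forall w in s, g w <= g v].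
Proof.
rewrite inE; congr andb; apply/subsetP/forall_inP => h w ws.
  by have := h w ws; rewrite inE => /andP[].
by rewrite inE vertexC h.
Qed.

Let linkP g v (s : {set 'I_n}) :
  s \in link v (sublevel C g v) <-> exists2 u, s = [set u] & low g v u.
Proof.
split.
  rewrite inE !in_sub => /and3P[/andP[sC sg] vs /andP[vsC _]].
  have s0 : s != finset.set0 by apply: contraNneq (complex_nonempty C) => <-.
  have [u su vu] := edge_nbr sC s0 vs vsC; exists u => //.
  by rewrite /low vu; have /forall_inP := sg; apply; rewrite su inE.
move=> [u -> /andP[vu gu]]; rewrite inE !in_sub single_in inE eq_sym nbr_ne//.
rewrite nbr_edge//=; apply/andP; split.
  by apply/forall_inP => w /set1P ->.
by apply/forall_inP => w; rewrite !inE => /orP[] /eqP ->.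
Qed.

Let empty_complex_subproof1 : finset.set0 \notin (finset.set0 : {set {set 'I_n}}).
Proof. by rewrite inE. Qed.

Let empty_complex_subproof2 (s t : {set 'I_n}) : s \in (finset.set0 : {set {set 'I_n}}) ->
  t \subset s -> t != finset.set0 -> t \in (finset.set0 : {set {set 'I_n}}).
Proof. by rewrite inE. Qed.

Let empty_complex : complex 'I_n :=
  Complex empty_complex_subproof1 empty_complex_subproof2.

(* As [n] is large, lower neighbours are never adjacent, so a cone link is a
   single point. *)
Let dominatedP g v a : desc_dominated_by C g v a <->
  low g v a /\ forall u, low g v u -> u = a.
Proof.
split.
  move=> [_ _ [K0 [aK0 lk]]].
  have la : low g v a.
    have : [set a] \in link v (sublevel C g v) by rewrite lk !inE eqxx.
    by move=> /linkP[u /set1_inj ->].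
  split=> // u lu.
  have : [set u] \in link v (sublevel C g v) by apply/linkP; exists u.
  rewrite lk !inE => /orP[/orP[/eqP/set1_inj //|uK0]|/imsetP[s sK0 e]].
    have : a |: [set u] \in link v (sublevel C g v).
      rewrite lk !inE; apply/orP; right; exact: imset_f.
    move=> /linkP[w e _]; have : a \in [set w] by rewrite -e setU11.
    have : u \in [set w] by rewrite -e !inE eqxx orbT.
    by move=> /set1P -> /set1P ->.
  by apply/esym/set1P; rewrite e setU11.
move=> [la uniq_a]; split.
- rewrite inE in_sub single_in; apply/forall_inP => w /set1P ->; exact: lexx.
- by case/andP: la => /nbr_ne.
exists empty_complex; split; first by rewrite !inE.
apply/setP => s; apply/idP/idP => [/linkP[u -> /uniq_a ->]|].
  by rewrite !inE eqxx.
move=> sc; apply/linkP; exists a => //; move: sc.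
by rewrite !inE orbF => /orP[/eqP ->//|/imsetP[t]]; rewrite inE.
Qed.

Definition arrow_pair (p : bool * 'I_n) : {set 'I_n} * {set 'I_n} :=
  ([set p.2], [set p.2; if p.1 then ordS p.2 else ord_pred p.2]).

Lemma arrow_pair_inj : injective arrow_pair.
Proof.
move=> [b i] [b' i'] [/set1_inj/= <- e]; congr pair; move: e; rewrite /=.
case: b b' => -[] // /setP.
  move=> /(_ (ordS i)); rewrite !inE eqxx orbT neS /= => /esym /eqP h.
  by have := nePS i; rewrite -h eqxx.
move=> /(_ (ord_pred i)); rewrite !inE eqxx orbT neP /= => /esym /eqP h.
by have := nePS i; rewrite h eqxx.
Qed.

(** A vertex carries an arrow when exactly one of its two neighbours lies in its sublevel set; the
    weak inequality is the one of [sublevel]. *)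
Definition down g : {set bool * 'I_n} := [set p : bool * 'I_n |
  if p.1 then g (ordS p.2) <= g p.2 < g (ord_pred p.2)
  else g (ord_pred p.2) <= g p.2 < g (ordS p.2)].

Let target b v := if b then ordS v else ord_pred v.

Let down_dominated g v b : (b, v) \in down g <->
  low g v (target b v) /\ forall u, low g v u -> u = target b v.
Proof.
rewrite inE /low /nbr /target; case: b => /=; split.
- move=> /andP[g1 g2]; rewrite eqxx g1; split=> // u /andP[/orP[]/eqP -> //].
  by rewrite leNgt g2.
- move=> [/andP[_ ->] h] /=; rewrite ltNge; apply/negP => g2.
  by have := h (ord_pred v); rewrite eqxx orbT g2 => /(_ isT) /eqP; rewrite nePS.
- move=> /andP[g1 g2]; rewrite eqxx orbT g1; split=> // u /andP[/orP[]/eqP -> //].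
  by rewrite leNgt g2.
- move=> [/andP[_ ->] h] /=; rewrite ltNge; apply/negP => g2.
  by have := h (ordS v); rewrite eqxx g2 => /(_ isT) /eqP; rewrite eq_sym nePS.
Qed.

Let dominated_target g v a : desc_dominated_by C g v a ->
  exists2 b, a = target b v & (b, v) \in down g.
Proof.
move=> /dominatedP[la h]; have /andP[/orP[]/eqP av _] := la.
  by exists true => //; apply/down_dominated; rewrite /target -av.
by exists false => //; apply/down_dominated; rewrite /target -av.
Qed.

(** A simplex of the sublevel complex that contains [v] and a further vertex contains a lower
    neighbour of [v], which is [a v]. So only pairs starting at a single vertex arise. *)
Lemma matchingE g (a : 'I_n -> 'I_n) :
  (forall v, desc_dominated C g v -> desc_dominated_by C g v (a v)) ->
  matching C g a = [set arrow_pair p | p in down g].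
Proof.
move=> ha; apply/setP => -[s t]; rewrite inE /=; apply/existsP/imsetP.
  move=> [v /and5P[/asboolP dv sv vs avs /eqP te]].
  have [b ab bd] := dominated_target (ha v dv).
  have [_ h] := (dominatedP g v (a v)).1 (ha v dv).
  exists (b, v) => //; suff se : s = [set v].
    by rewrite /arrow_pair te se /= -/(target b v) -ab setUC.
  apply/eqP; rewrite eqEsubset sub1set vs andbT; apply/subsetP => u us; rewrite inE.
  apply: contraNT avs => uv; rewrite -(h u) // /low.
  move: sv; rewrite in_sub => /andP[sC /forall_inP/(_ u us) ->]; rewrite andbT.
  have [[i e]|[i e]] := cycle_cases sC.
    by move: us vs uv; rewrite e !inE => /eqP -> /eqP ->; rewrite eqxx.
  move: us vs uv; rewrite e !inE /nbr => /orP[]/eqP -> /orP[]/eqP ->; rewrite ?eqxx ?ordSK ?eqxx ?orbT//.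
move=> [[b v] bd [-> ->]]; exists v.
have dv : desc_dominated_by C g v (target b v).
  by apply/dominatedP; apply/down_dominated.
have av : a v = target b v.
  have [l h] := (dominatedP g v (target b v)).1 dv.
  apply: h; have dd : desc_dominated C g v by exists (target b v).
  by have [] := (dominatedP g v (a v)).1 (ha v dd).
apply/and5P; split.
- by apply/asboolP; exists (target b v).
- by rewrite in_sub single_in; apply/forall_inP => w /set1P ->; exact: lexx.
- by rewrite inE.
- have /dominatedP[/andP[/nbr_ne ne _] _] := dv; by rewrite inE av.
- by rewrite av setUC.
Qed.

Lemma strong_matchingP M : strong_matching R C M <->
  exists2 g, injective g & M = [set arrow_pair p | p in down g].
Proof.
split.
  move=> [g [a [ginj ha ->]]]; exists g; last exact: matchingE.
  by move=> i j e; apply: ginj.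
move=> [g ginj ->].
(* At vertices that are not descending dominated this takes the arbitrary value [ord_pred v]. *)
pose a v := if (true, v) \in down g then ordS v else ord_pred v.
have ha v : desc_dominated C g v -> desc_dominated_by C g v (a v).
  move=> [u du]; have [b ub bd] := dominated_target du.
  suff -> : a v = u by [].
  rewrite /a ub; case: b ub bd => ub bd; first by rewrite bd.
  case: ifP => // td; move: bd td; rewrite !inE /= => /andP[g1 g2] /andP[g3 _].
  by move: g2; rewrite ltNge g3.
exists g, a; split=> //; first by move=> i j _ _; exact: ginj.
by rewrite matchingE.
Qed.

End StrongMorseCycle.

(** * Matchings of maximal size *)

Section CriticalPairs.
Variables (R : realType) (n : nat).
Hypothesis n6 : 6 <= n.
Implicit Types (g : 'I_n -> R) (b : bool) (x y i : 'I_n).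

Local Open Scope ring_scope.

Definition arcs x y : {set bool * 'I_n} := [set p : bool * 'I_n |
  arc (if p.1 then x else y) (if p.1 then y else x) p.2].

Let cd_gt0 x y : x <> y -> (0 < cd x y)%N.
Proof.
by move=> xy; rewrite lt0n; apply/eqP => h; apply: xy; apply: (@cd_inj n n6 x); rewrite cdxx.
Qed.

Let cd_side x y i : x <> y -> (cd y i < cd y x)%N = ~~ (cd x i < cd x y)%N.
Proof.
move=> xy; have y0 := cd_gt0 xy; have yn := cd_lt n6 x y; have i_n := cd_lt n6 x i.
have := cd_rel n6 x y i; have := cd_rel n6 x y x; rewrite cdxx; move: y0 yn i_n; clear; lia.
Qed.

Let card_snd (s : {set bool * 'I_n}) :
  (forall i, ((true, i) \in s) && ((false, i) \in s) = false) ->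
  #|s| = #|[set p.2 | p in s]|.
Proof.
move=> h; rewrite card_in_imset // => -[b i] [b' i'] /= h1 h2 e; rewrite -e in h2 *.
by have := h i; case: b b' h1 h2 => -[] // -> ->.
Qed.

Let card_compl2 x y : x <> y -> #|~: [set x; y]| = (n - 2)%N.
Proof. by move=> /eqP xy; rewrite cardsCs setCK cards2 xy card_ord. Qed.

(** Every vertex other than [x] and [y] lies on exactly one of the two arcs. *)
Lemma card_arcs x y : x <> y -> #|arcs x y| = (n - 2)%N.
Proof.
move=> xy; have yx : y <> x by move=> /esym.
have x0 := cd_gt0 yx; have y0 := cd_gt0 xy.
rewrite card_snd => [|i]; last first.
  rewrite !inE /arc /= (cd_side _ xy).
  by case: (cd x i < cd x y)%N; rewrite /= ?andbF.
rewrite -(card_compl2 xy); congr #|pred_of_set _|; apply/setP => i; apply/imsetP/idP.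
  move=> [[b j] + ->]; rewrite !inE /arc /= negb_or.
  by case: b => /andP[j0 j1]; apply/andP; split; apply/eqP => e; move: j0 j1;
    rewrite e ?cdxx ?ltnn.
rewrite !inE negb_or => /andP[/eqP ix /eqP iy].
have [h|h] := boolP (cd x i < cd x y)%N.
  by exists (true, i); rewrite // inE /arc /= h cd_gt0//; apply/nesym.
exists (false, i); rewrite // inE /arc /= (cd_side _ xy) h cd_gt0//; exact/nesym.
Qed.

Section Injective.
Variable g : 'I_n -> R.
Hypothesis g_inj : injective g.

Let lt_neq i j : i != j -> (g i <= g j) = (g i < g j).
Proof. by move=> ij; rewrite le_eqVlt (inj_eq g_inj) (negbTE ij). Qed.

Let neS i : (ordS i == i) = false.
Proof. by apply: ordS_neq; lia. Qed.

Let neP i : (ord_pred i == i) = false.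
Proof. by rewrite -(inj_eq (@ordS_inj n)) ord_predK eq_sym neS. Qed.

Lemma down_of_slopes x y : x <> y ->
  (forall i, (cd x i < cd x y)%N -> g (ordS i) < g i) ->
  (forall i, (cd y i < cd y x)%N -> g i < g (ordS i)) ->
  down g = arcs x y.
Proof.
move=> xy fall rise; have yx : y <> x by move=> /esym.
have fallE i : (g (ordS i) <= g i) = (cd x i < cd x y)%N.
  rewrite lt_neq ?neS//; apply/idP/idP => [|/fall//]; apply: contraTT => h.
  by rewrite -leNgt ltW// rise// cd_side.
have riseE i : (g i <= g (ordS i)) = (cd y i < cd y x)%N.
  by rewrite cd_side// -fallE -ltNge lt_neq// eq_sym neS.
have pred_lt u v i : u <> v ->
    (cd u i < cd u v)%N && (cd u (ord_pred i) < cd u v)%N = arc u v i.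
  move=> uv; have lt := cd_lt n6 u v; have [u0|u0] := posnP (cd u i).
    have -> : i = u by apply: (@cd_inj n n6 u); rewrite cdxx.
    by rewrite /arc cdxx (cd_pred n6); move: lt; clear; lia.
  by rewrite /arc u0 (cd_ord_pred n6 u0); move: u0; clear; lia.
apply/setP => -[b i]; rewrite !inE /=; case: b.
  rewrite -pred_lt// -!fallE ord_predK; congr andb.
  by rewrite lt_neq// eq_sym neP.
rewrite -pred_lt// -!riseE ord_predK andbC; congr andb.
by rewrite lt_neq// eq_sym neS.
Qed.

Let top_bottom : exists x y, [/\ x <> y, forall i, g i <= g x & forall i, g y <= g i].
Proof.
have i0 : 'I_n by exists 0%N; lia.
have [x _ mx] := @arg_maxP _ _ _ i0 xpredT g isT.
have [y _ my] := @arg_minP _ _ _ i0 xpredT g isT.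
have hx i : g i <= g x by exact: mx.
have hy i : g y <= g i by exact: my.
exists x, y; split=> // xy.
have e : ordS x = x by apply: g_inj; apply/eqP; rewrite eq_le hx// xy hy.
by have := neS x; rewrite e eqxx.
Qed.

Let down_excl i : ((true, i) \in down g) && ((false, i) \in down g) = false.
Proof.
by rewrite !inE /=; apply/negP => /andP[/andP[h _] /andP[_]]; rewrite ltNge h.
Qed.

Let down_sub x y : (forall i, g i <= g x) -> (forall i, g y <= g i) ->
  [set p.2 | p in down g] \subset ~: [set x; y].
Proof.
move=> hx hy; apply/subsetP => _ /imsetP[[b i] + ->]; rewrite !inE /= negb_or => h.
apply/andP; split; apply/eqP => e; rewrite e in h.
  by case: b h => /andP[_]; rewrite ltNge hx.
case: b h => /andP[h _].
  by have /negP := negbT (neS y); apply; rewrite -(inj_eq g_inj) eq_le h hy.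
by have /negP := negbT (neP y); apply; rewrite -(inj_eq g_inj) eq_le h hy.
Qed.

(** A vertex carries at most one arrow, and the highest and the lowest vertex carry none. *)
Lemma card_down : (#|down g| <= n - 2)%N.
Proof.
have [x [y [xy hx hy]]] := top_bottom.
by rewrite card_snd// -(card_compl2 xy) subset_leq_card// down_sub.
Qed.

(** With equality, every vertex except the top [x] and the bottom [y] carries an arrow. A vertex
    reached from [x] by descending cannot point back to its higher predecessor, so the descent
    continues until [y]. Likewise the ascent from [y] continues until [x], since a vertex with a
    lower predecessor must point back to it. *)
Lemma down_max : #|down g| = (n - 2)%N -> exists x y, x <> y /\ down g = arcs x y.
Proof.
have [x [y [xy hx hy]]] := top_bottom; rewrite card_snd// -(card_compl2 xy) => h.
have {h} dE : [set p.2 | p in down g] = ~: [set x; y].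
  by apply/eqP; rewrite eqEcard down_sub//= h.
have cover i : i <> x -> i <> y -> exists b, (b, i) \in down g.
  move=> ix iy; have : i \in ~: [set x; y] by rewrite !inE negb_or; apply/andP; split; apply/eqP.
  by rewrite -dE => /imsetP[[b j] jd /= ->]; exists b.
exists x, y; split=> //; have yx : y <> x by move=> /esym.
apply: down_of_slopes => // i.
  have [m] := ubnP (cd x i); elim: m i => // m IH i im iy.
  have [e|ix] := eqVneq i x; first by rewrite -lt_neq ?neS ?e.
  have x0 : (0 < cd x i)%N by apply: cd_gt0; apply/nesym/eqP.
  have gP : g i < g (ord_pred i).
    rewrite -[i in ltLHS](ord_predK i).
    by apply: IH; rewrite (cd_ord_pred n6 x0); move: x0 im iy; clear; lia.
  have [||b] := cover i; [exact/eqP|by move=> e; rewrite e ltnn in iy|].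
  rewrite inE /=; case: b => /andP[h1 h2]; first by rewrite -lt_neq ?neS.
  by move: h1; rewrite leNgt gP.
have [m] := ubnP (cd y i); elim: m i => // m IH i im iy.
have [e|ix] := eqVneq i y; first by rewrite -lt_neq 1?eq_sym ?neS ?e.
have x0 : (0 < cd y i)%N by apply: cd_gt0; apply/nesym/eqP.
have gP : g (ord_pred i) < g i.
  rewrite -[i in ltRHS](ord_predK i).
  by apply: IH; rewrite (cd_ord_pred n6 x0); move: x0 im iy; clear; lia.
have [||b] := cover i; [by move=> e; rewrite e ltnn in iy|exact/eqP|].
rewrite inE /=; case: b => /andP[h1 h2] //.
by move: h2; rewrite ltNge ltW.
Qed.

End Injective.

(** A filtration by the number [p] of steps from the maximum: even values fall to 0 at [Y], odd
    values rise afterwards. Parity keeps the two slopes apart, and [2 * n] at the maximum exceeds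
    all of them. *)
Let height (Y p : nat) : nat :=
  (if p == 0 then 2 * n else if p <= Y then 2 * (Y - p) else (2 * (p - Y)).-1)%N.

Let height_cases Y p : [\/ p = 0%N /\ height Y p = (2 * n)%N,
  (0 < p <= Y)%N /\ height Y p = (2 * (Y - p))%N |
  [/\ (0 < p)%N, (Y < p)%N & height Y p = ((2 * (p - Y)).-1)%N]].
Proof.
rewrite /height; case: posnP => p0; first by constructor 1.
by case: leqP; [constructor 2|constructor 3].
Qed.

Lemma arcs_down x y : x <> y -> exists2 g : 'I_n -> R, injective g & down g = arcs x y.
Proof.
move=> xy; have Y0 := cd_gt0 xy; have Yn := cd_lt n6 x y.
have inj : injective (fun i => (height (cd x y) (cd x i))%:R : R).
  move=> i j /eqP; rewrite eqr_nat => /eqP e; apply: (@cd_inj n n6 x).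
  have in_ := cd_lt n6 x i; have jn := cd_lt n6 x j.
  have := height_cases (cd x y) (cd x i); have := height_cases (cd x y) (cd x j).
  move: e Y0 Yn in_ jn; clear.
  by move=> e ? ? ? ? [[? ?]|[? ?]|[? ? ?]] [[? ?]|[? ?]|[? ? ?]]; lia.
exists (fun i => (height (cd x y) (cd x i))%:R : R) => //.
apply: down_of_slopes => // i; rewrite ltr_nat; last rewrite cd_side//.
  move=> h; rewrite (cd_ordS n6); last by move: h Yn; clear; lia.
  have := height_cases (cd x y) (cd x i); have := height_cases (cd x y) (cd x i).+1.
  move: h Yn Y0; clear.
  by move=> ? ? ? [[? ?]|[? ?]|[? ? ?]] [[? ?]|[? ?]|[? ? ?]]; lia.
rewrite -leqNgt => h; have i_n := cd_lt n6 x i.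
have [l|l] := ltnP (cd x i).+1 n.
  rewrite (cd_ordS n6) //.
  have := height_cases (cd x y) (cd x i); have := height_cases (cd x y) (cd x i).+1.
  move: h Yn Y0 l; clear.
  by move=> ? ? ? ? [[? ?]|[? ?]|[? ? ?]] [[? ?]|[? ?]|[? ? ?]]; lia.
have -> : ordS i = x.
  rewrite -(ord_predK x); congr ordS; apply: (@cd_inj n n6 x); rewrite (cd_pred n6).
  by move: i_n l; clear; lia.
rewrite cdxx.
have := height_cases (cd x y) (cd x i); have := height_cases (cd x y) 0.
move: h Yn Y0 i_n; clear.
by move=> ? ? ? ? [[? ?]|[? ?]|[? ? ?]] [[? ?]|[? ?]|[? ? ?]]; lia.
Qed.

Let SM_cycle := SM R (cycle_complex n).

Let in_SM N : N \in simplices SM_cycle <->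
  N != finset.set0 /\ exists2 g : 'I_n -> R, injective g & N \subset [set arrow_pair p | p in down g].
Proof.
rewrite inE; split.
  by move=> /andP[-> /asboolP[M [/(strong_matchingP R n6)[g gi ->] NM]]]; split=> //; exists g.
move=> [-> [g gi Ng]]; apply/asboolP; exists [set arrow_pair p | p in down g].
by split=> //; apply/(strong_matchingP R n6); exists g.
Qed.

Let card_arrow_pair (t : {set bool * 'I_n}) : #|[set arrow_pair p | p in t]| = #|t|.
Proof. exact/card_imset/arrow_pair_inj. Qed.

Let arcs_SM x y : x <> y -> [set arrow_pair p | p in arcs x y] \in simplices SM_cycle.
Proof.
move=> xy; apply/in_SM; split.
  by rewrite -card_gt0 card_arrow_pair card_arcs//; lia.
by have [g gi <-] := arcs_down xy; exists g.
Qed.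

Let dim_SM : Defs.dim SM_cycle = (n - 2).-1.
Proof.
apply/eqP; rewrite eqn_leq; apply/andP; split.
  apply/bigmax_leqP => s /in_SM[_ [g gi /subset_leq_card]]; rewrite card_arrow_pair => h.
  by have := card_down gi; move: h; clear; lia.
pose x := o n6 0; have xy : x <> ordS x.
  by move=> /esym/eqP; rewrite ordS_neq//; lia.
rewrite -(card_arcs xy) -card_arrow_pair.
by rewrite /Defs.dim (bigD1 _ (arcs_SM xy)) /= leq_maxl.
Qed.

(** A simplex of maximal dimension has [n - 2] pairs; by [card_down] it exhausts its matching, which
    [down_max] identifies with a pair of arcs. *)
Lemma SM_pure_simplices : simplices (SM_pure R (cycle_complex n)) =
  [set @arrow_pair n @: (t : {set bool * 'I_n}) | t in simplices (Delta n)].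
Proof.
apply/setP => s; rewrite inE -/SM_cycle; apply/andP/imsetP.
  move=> [sS /exists_inP[t tS /andP[st /eqP]]]; rewrite dim_SM => td.
  have [t0 [g gi tg]] := (in_SM t).1 tS.
  have tgE : t = [set arrow_pair p | p in down g].
    apply/eqP; rewrite eqEcard tg card_arrow_pair.
    have := card_down gi; move: t0; rewrite -card_gt0; move: td n6; clear; lia.
  have dE : #|down g| = (n - 2)%N.
    have tc : #|t| = #|down g| by rewrite tgE card_arrow_pair.
    move: t0 td; rewrite -card_gt0 tc; have := card_down gi; move: n6; clear; lia.
  have [x [y [xy dg]]] := down_max gi dE.
  have sE : s = [set arrow_pair p | p in @arrow_pair n @^-1: s].
    apply/setP => q; apply/idP/imsetP => [qs|[p + ->]]; last by rewrite inE.
    have := subsetP st q qs; rewrite tgE => /imsetP[p _ e].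
    by exists p; rewrite // inE -e.
  exists (@arrow_pair n @^-1: s) => //; apply/DeltaP; split.
    have /in_SM[s0 _] := sS; by apply: contraNneq s0 => e; rewrite sE e imset0.
  exists x, y; split=> // b i; rewrite inE => /(subsetP st).
  by rewrite tgE dg (mem_imset _ _ (@arrow_pair_inj n n6)) inE.
move=> [t /DeltaP[t0 [x [y [xy h]]]] ->].
have tA : [set arrow_pair p | p in t] \subset [set arrow_pair p | p in arcs x y].
  by apply/imsetS/subsetP => -[b i]; rewrite inE; exact: h.
split.
  apply: (complex_closed (arcs_SM xy)) => //.
  by rewrite -card_gt0 card_arrow_pair card_gt0.
apply/exists_inP; exists [set arrow_pair p | p in arcs x y]; first exact: arcs_SM.
by rewrite tA card_arrow_pair card_arcs// dim_SM eqxx.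
Qed.

End CriticalPairs.

Local Close Scope nat_scope.

Theorem theorem8p6 (R : realType) (n : nat) (n_ge6 : (6 <= n)%N) :
  (forall k : nat, n = (3 * k)%N ->
     homotopy_equivalent R
       (realization R (SM_pure R (cycle_complex n)))
       (wedge_spheres R
          [:: 2; 2 * k - 2; 2 * k - 2; 2 * k - 2; 2 * k - 2]%N)) /\
  (forall k : nat, n = (3 * k + 1)%N \/ n = (3 * k + 2)%N ->
     homotopy_equivalent R
       (realization R (SM_pure R (cycle_complex n)))
       (wedge_spheres R [:: 2; 2 * k - 1; 2 * k - 1]%N)).
Proof.
have SM_X : homotopy_equivalent R (realization R (SM_pure R (cycle_complex n)))
    (realization R (X n)).
  apply: homotopy_equivalent_trans (Delta_X R n_ge6); apply: homotopy_equivalent_sym.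
  apply: (realization_iso R (@arrow_pair_inj n n_ge6)).
  exact: SM_pure_simplices.
split=> k nk; apply: (homotopy_equivalent_trans SM_X).
  by apply: wedge_case0 => //; lia.
have k2 : (2 <= k)%N by lia.
by case: nk => nk; [apply: wedge_case1|apply: wedge_case2] => //; rewrite nk -addnA.
Qed.
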